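(* Let $u,v>0$. Let $\psi\ne0$ be a shearlet with at least $1+\varepsilon>1$ vanishing moments in $x_1$-direction, Fourier decay of order $\tau>1/2$ in the second coordinate and Fourier decay of order $\mu>0$ in the first variable. Then there exist $\Gamma,\Xi>0$ such that the family $(P_{\mathcal{C}_{u,v}}\psi_{ast})_{a\in[0,\Gamma],\,s\in[-\Xi,\Xi],\,t\in\mathbb{R}^2}$ constitutes a frame for $L^2(\mathcal{C}_{u,v})^\vee$.
   Context: Fourier transform: $\hat f(\omega)=\int_{\mathbb{R}^2}f(x)e^{-2\pi i x\omega}dx$. For $a>0$, $s\in\mathbb{R}$, $t\in\mathbb{R}^2$ let $\psi_{ast}(x)=a^{-3/4}\psi\big(\frac{x_1-t_1+s(x_2-t_2)}{a},\frac{x_2-t_2}{a^{1/2}}\big)$. $\mathcal{C}_{u,v}=\{\xi\in\mathbb{R}^2:|\xi_1|\ge u,\ |\xi_2|\le v|\xi_1|\}$, $L^2(\mathcal{C}_{u,v})^\vee=\{f\in L^2(\mathbb{R}^2):\operatorname{supp}\hat f\subseteq\mathcal{C}_{u,v}\}$, and $P_{\mathcal{C}_{u,v}}$ is the orthogonal projection of $L^2(\mathbb R^2)$ onto it. A shearlet is an admissible function, i.e. $\psi\in L^2(\mathbb R^2)$ with $C_\psi:=\int_{\mathbb{R}^2}\frac{|\hat\psi(\omega)|^2}{|\omega_1|^2}d\omega=\int_{\mathbb{R}}\int_0^\infty|\hat\psi(a\xi_1,\sqrt a(\xi_2-s\xi_1))|^2a^{-3/2}\,da\,ds<\infty$ for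 all $\xi$ with $\xi_1\ne0$. For real $n$, $\psi$ has $n$ vanishing moments in $x_1$-direction if $\int_{\mathbb{R}^2}|\hat\psi(\omega)|^2|\omega_1|^{-2n}d\omega<\infty$. $\psi$ has Fourier decay of order $r$ in the second variable if $\hat\psi(\xi_1,\xi_2)=O(|\xi_2|^{-r})$ for large $\xi_2$; analogously for the first variable. A family $(\varphi_x)_{x\in X}$ in a Hilbert space $\mathcal{H}$, indexed by a measure space $(X,m)$, is a frame if there are $A,B>0$ with $A\|f\|^2\le\int_X|\langle f,\varphi_x\rangle|^2dm(x)\le B\|f\|^2$ for all $f\in\mathcal{H}$. The measure on the parameters $(a,s,t)$ is $a^{-3}\,da\,ds\,dt$.
   Formalization: The printed admissibility identity forces ψ=0, since for a>0 its right side covers only the half-plane where ω₁ has the sign of ξ₁; here a shearlet has C_ψ<∞ and C_ψ equal to twice the (a,s)-integral, for all ξ with ξ₁≠0. *)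

(* Defs.v *)
From HB Require Import structures.
From mathcomp Require Import all_boot all_order all_algebra.
From mathcomp Require Import all_classical all_reals all_analysis.
From mathcomp Require Import measurable_realfun.
From mathcomp Require Import complex.

Set Implicit Arguments.
Unset Strict Implicit.
Unset Printing Implicit Defensive.

Import Order.TTheory GRing.Theory Num.Theory.
Import numFieldNormedType.Exports.

Local Open Scope classical_set_scope.
Local Open Scope ring_scope.
Local Open Scope complex_scope.

Notation normc := ComplexField.Normc.normc.

(* Elements of L^2(R^2) are represented by square integrable functions; all
   notions below are invariant under modification on a null set. *)
Section L2_plane.
Variable R : realType.
Implicit Types f g h : R * R -> R[i].

Definition leb2 : set (measurableTypeR R * measurableTypeR R) -> \bar R :=
  (@lebesgue_measure R \x @lebesgue_measure R)%E.

HB.instance Definition _ := Measure.on leb2.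

Let leb2_sigma_finite : sigma_finite setT leb2.
Proof.
have /sigma_finiteP[F [TF ndF Foo]] := sigma_finiteT (@lebesgue_measure R).
exists (fun n => F n `*` F n).
  rewrite -setXTT TF predeqE => -[x y]; split.
    move=> [/= [n _ Fnx] [k _ Fky]]; exists (maxn n k) => //; split.
      by move: x Fnx; exact/subsetPset/ndF/leq_maxl.
    by move: y Fky; exact/subsetPset/ndF/leq_maxr.
  by move=> [n _ []/= ? ?]; split; exists n.
move=> k; have [? ?] := Foo k; split; first exact: measurableX.
by rewrite /leb2 product_measure1E// lte_mul_pinfty// ge0_fin_numE.
Qed.

HB.instance Definition _ :=
  Measure_isSigmaFinite.Build _ _ _ leb2 leb2_sigma_finite.

Definition sqnorm2 f : \bar R := \int[leb2]_x (normc (f x) ^+ 2)%:E.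

Definition L2 : set (R * R -> R[i]) :=
  [set f | [/\ measurable_fun setT (fun x => complex.Re (f x)),
               measurable_fun setT (fun x => complex.Im (f x)) &
               (sqnorm2 f < +oo)%E]].

Definition cintegral f : R[i] :=
  Rintegral leb2 setT (fun x => complex.Re (f x)) +i*
  Rintegral leb2 setT (fun x => complex.Im (f x)).

Definition inner f g : R[i] := cintegral (fun x => f x * conjc (g x)).

Definition cexpi (theta : R) : R[i] := cos theta +i* sin theta.

Definition fourierL1 f (w : R * R) : R[i] :=
  cintegral (fun x => f x * cexpi (- (2 * pi * (x.1 * w.1 + x.2 * w.2)))).

Definition truncate f (n : nat) (x : R * R) : R[i] :=
  if (`|x.1| <= n%:R) && (`|x.2| <= n%:R) then f x else 0.

(* The Fourier transform on L^2: the limit in the mean of the transforms of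
   the truncations, which are integrable. *)
Definition is_fourier f g : Prop :=
  L2 g /\
  (fun n => sqnorm2 (fun w => fourierL1 (truncate f n) w - g w)) @ \oo
    --> (0 : \bar R)%E.

Definition fourier f : R * R -> R[i] := xget (fun=> 0) (is_fourier f).

Definition is_orth_proj (V : set (R * R -> R[i])) f g : Prop :=
  V g /\ forall h, V h -> inner (fun x => f x - g x) h = 0.

Definition orth_proj (V : set (R * R -> R[i])) f : R * R -> R[i] :=
  xget (fun=> 0) (is_orth_proj V f).

(* The second clause makes the integral in the third one meaningful. *)
Definition is_frame d (X : measurableType d) (m : {measure set X -> \bar R})
    (D : set X) (phi : X -> R * R -> R[i]) (V : set (R * R -> R[i])) : Prop :=
  [/\ forall x, D x -> V (phi x),
      forall f, V f -> measurable_fun D (fun x => normc (inner f (phi x))) &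
      exists A B : R, [/\ 0 < A, 0 < B &
        forall f, V f ->
          (A%:E * sqnorm2 f
             <= \int[m]_(x in D) (normc (inner f (phi x)) ^+ 2)%:E
             <= B%:E * sqnorm2 f)%E]].

End L2_plane.

Section shearlets.
Variable R : realType.
Implicit Types psi : R * R -> R[i].

Definition cone (u v : R) : set (R * R) :=
  [set xi | u <= `|xi.1| /\ `|xi.2| <= v * `|xi.1|].

(* The support of (the class of) a function is contained in the closed set
   [cone u v] iff the function vanishes almost everywhere outside of it. *)
Definition L2_cone (u v : R) : set (R * R -> R[i]) :=
  [set f | L2 f /\
           {ae @leb2 R, forall xi, ~ cone u v xi -> fourier f xi = 0}].

Definition shearlet_atom psi (a s : R) (t x : R * R) : R[i] :=
  (a `^ (- (3 / 4)))%:C *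
  psi ((x.1 - t.1 + s * (x.2 - t.2)) / a, (x.2 - t.2) / a `^ (1 / 2)).

Definition C_psi psi : \bar R :=
  \int[@leb2 R]_w (normc (fourier psi w) ^+ 2 / `|w.1| ^+ 2)%:E.

Definition orbit_integral psi (xi : R * R) : \bar R :=
  \int[@lebesgue_measure R]_s \int[@lebesgue_measure R]_(a in `]0%R, +oo[)
    (normc (fourier psi (a * xi.1, Num.sqrt a * (xi.2 - s * xi.1))) ^+ 2
       * a `^ (- (3 / 2)))%:E.

(* For a > 0 the substitution w = (a xi_1, sqrt a (xi_2 - s xi_1)) sweeps only
   the half-plane of the w such that w_1 has the sign of xi_1, so that the
   orbit integral is the integral of |psi^(w)|^2 / |w_1|^2 over that half-plane.
   Without the factor 2, the equality for both signs of xi_1 would force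
   psi = 0; with it, it says that the orbit integral does not depend on xi,
   which always holds for a real-valued psi. *)
Definition shearlet psi : Prop :=
  [/\ L2 psi, (C_psi psi < +oo)%E &
      forall xi : R * R, xi.1 != 0 ->
        C_psi psi = (2%:E * orbit_integral psi xi)%E].

Definition vanishing_moments psi (n : R) : Prop :=
  (\int[@leb2 R]_w
     (normc (fourier psi w) ^+ 2 * `|w.1| `^ (- (2 * n)))%:E < +oo)%E.

Definition fourier_decay1 psi (r : R) : Prop :=
  exists K M : R, {ae @leb2 R, forall xi,
    M <= `|xi.1| -> normc (fourier psi xi) <= K * `|xi.1| `^ (- r)}.

Definition fourier_decay2 psi (r : R) : Prop :=
  exists K M : R, {ae @leb2 R, forall xi,
    M <= `|xi.2| -> normc (fourier psi xi) <= K * `|xi.2| `^ (- r)}.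

(* The parameter (a, s, t) is encoded as ((a, s), t). *)
Local Notation param :=
  ((measurableTypeR R * measurableTypeR R) *
   (measurableTypeR R * measurableTypeR R))%type.

(* a^-3 da ds dt; only its restriction to a >= 0 is meaningful. *)
Definition shearlet_measure (A : set param) : \bar R :=
  \int[(@leb2 R \x @leb2 R)%E]_(p in A) (p.1.1 `^ (- 3))%:E.

Let shearlet_measure0 : shearlet_measure set0 = 0%E.
Proof. exact: integral_set0. Qed.

Let shearlet_measure_ge0 A : (0 <= shearlet_measure A)%E.
Proof. by apply: integral_ge0 => p _; rewrite lee_fin powR_ge0. Qed.

Let shearlet_measure_sigma_additive :
  semi_sigma_additive shearlet_measure.
Proof.
move=> F mF tF mUF; rewrite /shearlet_measure ge0_integral_bigcup //.
- by apply: is_cvg_ereal_nneg_natsum => n _; exact: shearlet_measure_ge0.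
- apply/measurable_EFinP; apply: (@measurable_funS _ _ _ _ setT) => //.
  apply: (@measurableT_comp _ _ _ _ _ _ (@powR R ^~ (- 3))).
    exact: measurable_powR.
  by apply: (measurableT_comp (@measurable_fst _ _ _ _)); exact: measurable_fst.
- by move=> p _; rewrite lee_fin powR_ge0.
Qed.

HB.instance Definition _ := isMeasure.Build _ param R shearlet_measure
  shearlet_measure0 shearlet_measure_ge0 shearlet_measure_sigma_additive.

End shearlets.

(* Main.v *)
(** In the Fourier domain the frame operator is diagonal. The transform of
    [psi_ast] is [a^(3/4) e(- t.w) psi^(a w_1, sqrt a (w_2 - s w_1))], so that
    for fixed [(a, s)] the coefficient of [f] against [psi_ast] is, as a
    function of [t], the Fourier transform of an integrable function;
    Plancherel's identity in [t] turns the frame integral into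
    [int |f^(w)|^2 Delta(w) dw], where [Delta(w)] is the orbit integral of
    [psi] at [w] restricted to the window [a <= Gamma], [|s| <= Xi]. The full
    orbit integral is [C_psi / 2]. For [w] in the cone and [Gamma = Xi = n], the
    substitution [(a, s) |-> (a w_1, sqrt a (w_2 - s w_1))] sends the parameters
    outside the window to points [x] such that [|x_1| > n u] or
    [x_2^2 > (n - v)^2 u |x_1|], whose share of [C_psi] tends to [0] by dominated
    convergence. Hence [C_psi / 4 <= Delta <= C_psi / 2] on the cone for some [n].

    Plancherel's identity is obtained by Fejer summation: if [k_n] is the Fejer
    kernel, with transform the tent function [W_n] and mass [K], then
    [int W_n |g^|^2 + 1/2 int int (g x - g y)^2 k_n(x - y) = K int g^2], and the
    double integral vanishes in the limit by [L^2]-continuity of translations. *)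

From HB Require Import structures.
From mathcomp Require Import all_boot all_order all_algebra.
From mathcomp Require Import all_classical all_reals all_analysis.
From mathcomp Require Import measurable_realfun.
From mathcomp Require Import complex ring lra.
Require Import Defs.

Set Implicit Arguments.
Unset Strict Implicit.
Unset Printing Implicit Defensive.

Import Order.TTheory GRing.Theory Num.Theory.
Import numFieldNormedType.Exports.

Local Open Scope classical_set_scope.
Local Open Scope ring_scope.

(** * Integration preliminaries *)

Section parametric_integral.
Context d1 d2 (T1 : measurableType d1) (T2 : measurableType d2) (R : realType).

(** For [f] in the cone space the projection is invisible: [psi_ast - P psi_ast] is orthogonal to
    [f], so [<f, P psi_ast> = <f, psi_ast>]. What has to be established about [P] is its existence,
    hence the closedness of the cone space.

    No Fourier inversion is used: it is enough that the transform multiplies inner products by a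
    positive constant [K]. Moving a coefficient to the frequency side costs [K^-1], Plancherel in
    [t] costs [K] on the squares, and the factor that remains is the one relating the norms of [f]
    and [f^].

    The product of [f^] with the conjugate of [psi^] is integrable for every [(a, s)] with [a > 0],
    but its square integrability, which Plancherel in [t] requires, is known only for almost every
    [(a, s)] of the window. It is extracted from the finiteness of the frequency integral, so the
    bound [Delta <= C_psi / 2] comes before the identity for the frame integral.

    One window has to serve all frequencies of the cone. The bounds [|w_1| >= u] and
    [|w_2| <= v |w_1|] confine the image of the discarded parameters to a set that depends on [n]
    only. *)

Lemma ge0_measurable_integral1 (m2 : {sigma_finite_measure set T2 -> \bar R})
    (f : T1 * T2 -> \bar R) : measurable_fun setT f -> (forall z, 0 <= f z)%E ->
  measurable_fun setT (fun x => \int[m2]_y f (x, y))%E.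
Proof. by move=> mf f0; exact: (measurable_fun_fubini_tonelli_F f mf f0). Qed.

Lemma ge0_measurable_integral2 (m1 : {sigma_finite_measure set T1 -> \bar R})
    (f : T1 * T2 -> \bar R) : measurable_fun setT f -> (forall z, 0 <= f z)%E ->
  measurable_fun setT (fun y => \int[m1]_x f (x, y))%E.
Proof. by move=> mf f0; exact: (measurable_fun_fubini_tonelli_G f mf f0). Qed.

(** Splitting into positive and negative parts reduces measurability to Tonelli; [fine] assigns a
    value also at the parameters where the integral diverges. *)
Lemma measurable_Rintegral1 (m2 : {sigma_finite_measure set T2 -> \bar R})
    (f : T1 * T2 -> R) : measurable_fun setT f ->
  measurable_fun setT (fun x => Rintegral m2 setT (fun y => f (x, y))).
Proof.
move=> mf; rewrite /Rintegral.
apply: (measurableT_comp (fine_measurable measurableT)).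
have mF : measurable_fun setT (EFin \o f) by exact/measurable_EFinP.
under eq_fun do rewrite integralE.
apply: emeasurable_funB.
  rewrite (_ : (fun x => _) = fun x => \int[m2]_y (EFin \o f)^\+ (x, y))%E.
    by apply: (@ge0_measurable_integral1 m2 _ (measurable_funepos mF)) => z; exact: funepos_ge0.
  by apply/funext => x; apply: eq_integral => y _; rewrite !funeposE.
rewrite (_ : (fun x => _) = fun x => \int[m2]_y (EFin \o f)^\- (x, y))%E.
    by apply: (@ge0_measurable_integral1 m2 _ (measurable_funeneg mF)) => z; exact: funeneg_ge0.
  by apply/funext => x; apply: eq_integral => y _; rewrite !funenegE.
Qed.

Lemma measurable_Rintegral2 (m1 : {sigma_finite_measure set T1 -> \bar R})
    (f : T1 * T2 -> R) : measurable_fun setT f ->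
  measurable_fun setT (fun y => Rintegral m1 setT (fun x => f (x, y))).
Proof.
move=> mf; rewrite /Rintegral.
apply: (measurableT_comp (fine_measurable measurableT)).
have mF : measurable_fun setT (EFin \o f) by exact/measurable_EFinP.
under eq_fun do rewrite integralE.
apply: emeasurable_funB.
  rewrite (_ : (fun y => _) = fun y => \int[m1]_x (EFin \o f)^\+ (x, y))%E.
    by apply: (@ge0_measurable_integral2 m1 _ (measurable_funepos mF)) => z; exact: funepos_ge0.
  by apply/funext => y; apply: eq_integral => x _; rewrite !funeposE.
rewrite (_ : (fun y => _) = fun y => \int[m1]_x (EFin \o f)^\- (x, y))%E.
    by apply: (@ge0_measurable_integral2 m1 _ (measurable_funeneg mF)) => z; exact: funeneg_ge0.
  by apply/funext => y; apply: eq_integral => x _; rewrite !funenegE.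
Qed.

End parametric_integral.

(** * Changes of variables with constant Jacobian *)

Section rescaling.
Context d (T : measurableType d) (R : realType) (mu : {measure set T -> \bar R}).

(** The constant [c] is the inverse of the Jacobian, so [c = 1] means measure preserving. The
    formula is asked of nonnegative functions only: it then composes freely, and signed functions
    follow through their positive and negative parts. *)
Definition rescales (phi : T -> T) (c : R) := [/\ 0 <= c, measurable_fun setT phi &
  forall f : T -> \bar R, measurable_fun setT f -> (forall x, 0 <= f x)%E ->
    (\int[mu]_x f (phi x) = c%:E * \int[mu]_x f x)%E].

Lemma rescales_Rintegral phi c (f : T -> R) : rescales phi c ->
  mu.-integrable setT (EFin \o f) ->
  Rintegral mu setT (f \o phi) = c * Rintegral mu setT f.
Proof.
move=> [c0 mphi phiE] intf; rewrite /Rintegral.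
have mF := measurable_int _ intf.
rewrite [in LHS]integralE.
under eq_integral do rewrite (funepos_comp (EFin \o f) phi)/=.
under [X in (_ - X)%E]eq_integral do rewrite (funeneg_comp (EFin \o f) phi)/=.
rewrite (phiE _ (measurable_funepos mF))// (phiE _ (measurable_funeneg mF))//.
have fp := integrable_pos_fin_num measurableT intf.
have fn := integrable_neg_fin_num measurableT intf.
rewrite [in RHS]integralE -muleBr ?fineM//.
- by rewrite fin_numB fp fn.
- by rewrite fin_num_adde_defr.
Qed.

Lemma rescales_integrable phi c (f : T -> R) : rescales phi c ->
  mu.-integrable setT (EFin \o f) ->
  mu.-integrable setT (EFin \o (f \o phi)).
Proof.
move=> [c0 mphi phiE] /integrableP[mf fy]; apply/integrableP; split.
  exact: (measurableT_comp mf mphi).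
rewrite (phiE (fun x => `|(f x)%:E|)%E)//; last first.
  exact: measurableT_comp.
rewrite lte_mul_pinfty//.
Qed.

Lemma rescales_comp (phi chi : T -> T) (k l : R) :
  rescales phi k -> rescales chi l -> rescales (phi \o chi) (l * k).
Proof.
move=> [k0 mphi phiE] [l0 mchi chiE].
split; [exact: mulr_ge0|exact: (measurableT_comp mphi mchi)|] => f mf f0.
rewrite (chiE (f \o phi) (measurableT_comp mf mphi) (fun x => f0 (phi x))).
by rewrite (phiE f mf f0) EFinM muleA.
Qed.

End rescaling.

Section affine_change_of_variables.
Context (R : realType).
Notation lambda := (@lebesgue_measure R).

Lemma measurable_affine (a b : R) :
  measurable_fun setT (fun x : measurableTypeR R => (a * x + b)%R : measurableTypeR R).
Proof. by apply: measurable_funD => //; exact: measurable_funM. Qed.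

(** The measure structure of a pushforward carries a proof that the map is measurable; the
    existential provides it once and keeps only the underlying set function. *)
Lemma pushforward_measure_ex d1 d2 (T1 : measurableType d1)
    (T2 : measurableType d2) (m : {measure set T1 -> \bar R}) (phi : T1 -> T2) :
  measurable_fun setT phi ->
  exists nu : {measure set T2 -> \bar R}, nu = pushforward m phi :> (_ -> _).
Proof.
by move=> mphi; eexists; reflexivity.
Unshelve. all: exact: mphi. Qed.

(** By uniqueness of the Lebesgue measure it is enough to compare, on half-open intervals, the
    length with the pushforward scaled by [|a|]. *)
Lemma lebesgue_measure_affine (a b : R) (A : set (measurableTypeR R)) :
  a != 0 -> measurable A ->
  lambda A = (`|a|%:E * lambda ((fun x : R => (a * x + b)%R) @^-1` A))%E.
Proof.
move=> a0 mA.
have [pf pfE] := pushforward_measure_ex lambda (measurable_affine a b).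
pose nu := mscale (NngNum (normr_ge0 a)) pf.
transitivity (nu A); last by rewrite /nu /mscale/= pfE.
apply: lebesgue_measure_unique => // _ [[c d] _ <-].
change (lambda `]c, d]%classic = (`|a|%:E * pf `]c, d]%classic)%E).
rewrite pfE /pushforward.
set phi := (fun x : measurableTypeR R => (a * x + b)%R).
rewrite lebesgue_measure_itv/=.
have [a_gt0|a_lt0|a_eq0] := ltgtP 0 a; last by rewrite a_eq0 eqxx in a0.
  have -> : phi @^-1` `]c, d]%classic = `](c - b) / a, (d - b) / a]%classic.
    apply/seteqP; split => x /=; rewrite !in_itv/= /phi ltr_pdivrMr// ler_pdivlMr//;
    by rewrite ltrBlDr lerBrDr mulrC.
  rewrite lebesgue_measure_itv/= !lte_fin ltr_pM2r ?invr_gt0// ltrD2r gtr0_norm//.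
  case: ifPn; rewrite ?mule0// => cd.
  by rewrite -!EFinD -EFinM; congr (_%:E); field.
(* A negative slope reverses the interval: the open end moves to the other side, without effect on
   the length. *)
have -> : phi @^-1` `]c, d]%classic = `[(d - b) / a, (c - b) / a[%classic.
  apply/seteqP; split => x /=; rewrite !in_itv/= /phi ler_ndivrMr// ltr_ndivlMr//;
  by rewrite ltrBlDr lerBrDr mulrC andbC.
rewrite lebesgue_measure_itv/= !lte_fin ltr_nM2r ?invr_lt0// ltrD2r ltr0_norm//.
case: ifPn; rewrite ?mule0// => cd.
by rewrite -!EFinD -EFinM; congr (_%:E); field.
Qed.

Lemma rescales_affine (a b : R) : a != 0 ->
  rescales lambda (fun x => a * x + b) `|a|^-1.
Proof.
move=> a0; split; [by rewrite invr_ge0|exact: measurable_affine|].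
move=> f mf f0.
have [pf pfE] := pushforward_measure_ex lambda (measurable_affine a b).
pose nu := mscale (NngNum (normr_ge0 a)) pf.
rewrite (@eq_measure_integral _ _ _ setT nu lambda f); last first.
  move=> A mA _; transitivity
    (`|a|%:E * lambda ((fun x : R => (a * x + b)%R) @^-1` A))%E.
    exact: lebesgue_measure_affine.
  by transitivity (`|a|%:E * pf A)%E; [rewrite pfE|].
rewrite ge0_integral_mscale//= pfE.
rewrite (ge0_integral_pushforward (measurable_affine a b))//=.
by rewrite preimage_setT muleA -EFinM mulVf ?normr_eq0// mul1e.
Qed.

End affine_change_of_variables.

Section plane_change_of_variables.
Context (R : realType).
Notation lambda := (@lebesgue_measure R).
Notation leb2 := (@leb2 R).
Implicit Types f : R * R -> \bar R.

Lemma leb2_tonelli1 f : measurable_fun setT f -> (forall x, 0 <= f x)%E ->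
  (\int[leb2]_z f z = \int[lambda]_x \int[lambda]_y f (x, y))%E.
Proof. exact: (@fubini_tonelli1 _ _ _ _ _ lambda lambda). Qed.

Lemma leb2_tonelli2 f : measurable_fun setT f -> (forall x, 0 <= f x)%E ->
  (\int[leb2]_z f z = \int[lambda]_y \int[lambda]_x f (x, y))%E.
Proof. exact: (@fubini_tonelli2 _ _ _ _ _ lambda lambda). Qed.

(** At fixed second coordinate [y] the first one undergoes an affine map with shift [b * y + c];
    Tonelli then leaves an affine map in [y]. Shears and parabolic dilations have this triangular
    form. *)
Lemma rescales_upper (a b c d e : R) : a != 0 -> d != 0 ->
  rescales leb2 (fun x : R * R => (a * x.1 + b * x.2 + c, d * x.2 + e))
    `|a * d|^-1.
Proof.
move=> a0 d0.
have m1 : measurable_fun setT (fun x : R * R => x.1) by exact: measurable_fst.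
have m2 : measurable_fun setT (fun x : R * R => x.2) by exact: measurable_snd.
have mphi : measurable_fun setT
    (fun x : R * R => (a * x.1 + b * x.2 + c, d * x.2 + e)).
  by apply: measurable_fun_pair => /=; repeat apply: measurable_funD => //;
    exact: measurable_funM.
split; [by rewrite invr_ge0|exact: mphi|] => f mf f0.
have [a'0 _ aE] := rescales_affine 0 a0.
have [_ _ dE] := rescales_affine e d0.
rewrite leb2_tonelli2//; last exact: measurableT_comp.
rewrite leb2_tonelli2//.
under eq_integral => y _.
  have [_ _ yE] := rescales_affine (b * y + c) a0.
  under eq_integral do rewrite -addrA.
  rewrite (yE (fun x => f (x, d * y + e)))//; last exact: measurableT_comp.
  over.
have mG : measurable_fun setT (fun y => \int[lambda]_x f (x, y))%E.
  exact: ge0_measurable_integral2.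
have H0 (y : R) : (0 <= \int[lambda]_x f (x, y))%E by exact: integral_ge0.
have mH : measurable_fun setT (fun y : R => \int[lambda]_x f (x, (d * y + e)%R))%E.
  by apply: (measurableT_comp mG); exact: measurable_affine.
have V0 : (0 <= (`|a|^-1)%:E)%E by rewrite lee_fin.
rewrite (ge0_integralZl lambda measurableT mH (fun y _ => H0 _) V0).
rewrite (dE (fun y => \int[lambda]_x f (x, y))%E mG H0).
by rewrite muleA -EFinM normrM invfM.
Qed.

Definition swap2 (x : R * R) := (x.2, x.1).

Lemma rescales_swap2 : rescales leb2 swap2 1.
Proof.
have ms : measurable_fun setT swap2 by exact: measurable_fun_pair.
split=> // f mf f0; rewrite leb2_tonelli1//; last exact: measurableT_comp.
by rewrite mul1e leb2_tonelli2.
Qed.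

(** Conjugation by the exchange of coordinates reduces this to the upper triangular case. *)
Lemma rescales_lower (a b c d e : R) : a != 0 -> d != 0 ->
  rescales leb2 (fun x : R * R => (a * x.1 + c, b * x.1 + d * x.2 + e))
    `|a * d|^-1.
Proof.
move=> a0 d0; have h := rescales_upper b e c d0 a0.
have := rescales_comp rescales_swap2 (rescales_comp h rescales_swap2).
rewrite mul1r mulr1 mulrC; congr rescales.
by apply/funext => x; rewrite /swap2/= [d * _ + _]addrC.
Qed.

End plane_change_of_variables.

(** * Completeness of the space of square integrable functions *)

Section riesz_fischer.
Context d (T : measurableType d) (R : realType) (mu : {measure set T -> \bar R}).

Lemma cvge0P (u : (\bar R)^nat) : (forall n, 0 <= u n)%E ->
  u @ \oo --> (0 : \bar R)%E <->
  forall e : R, 0 < e -> exists N, forall n, (N <= n)%N -> (u n <= e%:E)%E.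
Proof.
move=> u0; split => [/fine_cvgP[[N1 _ fu] /cvgrPdist_le ucv] e e0|h].
  have [N2 _ uN] := ucv _ e0; exists (maxn N1 N2) => n; rewrite geq_max => /andP[N1n N2n].
  have := uN n N2n; rewrite sub0r normrN => /(le_trans (ler_norm _)).
  by rewrite -lee_fin /= fineK//; exact: fu.
apply/fine_cvgP; split.
  have [N uN] := h 1 ltr01; exists N => // n Nn.
  by rewrite ge0_fin_numE// (le_lt_trans (uN _ Nn))// ltry.
apply/cvgrPdist_le => e e0; have [N uN] := h e e0; exists N => // n Nn /=.
rewrite sub0r normrN ger0_norm ?fine_ge0//.
rewrite -lee_fin fineK ?uN// ge0_fin_numE//.
by rewrite (le_lt_trans (uN _ Nn))// ltry.
Qed.

Lemma limn_einf_le_cst (u : (\bar R)^nat) (c : \bar R) :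
  (forall k, u k <= c)%E -> (limn_einf u <= c)%E.
Proof.
move=> uc; rewrite limn_einf_lim; apply: lime_le; first exact: is_cvg_einfs.
apply: nearW => n; apply: (@le_trans _ _ (u n)) => //.
by apply: ereal_inf_lbound; exists n => /=.
Qed.

(** Fatou's lemma for the lower limit, which coincides almost everywhere with [g]. *)
Lemma fatou_cvg (f : nat -> T -> \bar R) (g : T -> \bar R) (c : \bar R) :
  (forall n, measurable_fun setT (f n)) -> (forall n x, 0 <= f n x)%E ->
  measurable_fun setT g -> (forall x, 0 <= g x)%E ->
  {ae mu, forall x, f ^~ x @ \oo --> g x} ->
  (forall n, \int[mu]_x f n x <= c)%E -> (\int[mu]_x g x <= c)%E.
Proof.
move=> mf f0 mg g0 fg fc.
apply: (@le_trans _ _ (limn_einf (fun n => \int[mu]_x f n x))%E).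
  apply: le_trans (fatou mu measurableT mf (fun n x _ => f0 n x)).
  rewrite le_eqVlt; apply/orP; left; apply/eqP.
  apply: ge0_ae_eq_integral => //.
  - have -> : (fun x => limn_einf (f ^~ x)) =
        (fun x => - limn_esup (fun n => - f n x))%E.
      by apply/funext => x; rewrite -[LHS]oppeK -limn_esupN.
    apply: measurableT_comp => //; apply: measurable_fun_limn_esup => n.
    exact: measurableT_comp.
  - move=> x _; rewrite limn_einf_lim; apply: lime_ge; first exact: is_cvg_einfs.
    by apply: nearW => n; apply: le_ereal_inf_tmp => _ [m _ <-].
  - apply: filterS fg => x fx _.
    by have [-> _] := cvg_limn_einf_sup fx.
exact: limn_einf_le_cst.
Qed.

Lemma ae_cvg_fast (h : nat -> T -> R) :
  (forall n, measurable_fun setT (h n)) ->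
  (forall k, \int[mu]_x ((h k.+1 x - h k x) ^+ 2)%:E <= ((8 ^ k)%N%:R^-1)%:E)%E ->
  {ae mu, forall x, cvgn (h ^~ x)}.
Proof.
move=> mh hle.
(* The sum of the [4^k (h_{k+1} - h_k)^2] is integrable, hence finite almost
   everywhere, which makes the increments [O(2^-k)]. *)
pose F k x := ((4 ^ k)%N%:R * (h k.+1 x - h k x) ^+ 2 : R)%:E.
have F0 k x : (0 <= F k x)%E by rewrite lee_fin mulr_ge0// sqr_ge0.
have mF k : measurable_fun setT (F k).
  apply/measurable_EFinP; apply: measurable_funM => //.
  by apply: measurable_funX; exact: measurable_funB.
have mS : measurable_fun setT (fun x => \sum_(k <oo) F k x)%E.
  exact: ge0_emeasurable_sum.
have S0 x : (0 <= \sum_(k <oo) F k x)%E by apply: nneseries_ge0.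
have iS : mu.-integrable setT (fun x => \sum_(k <oo) F k x)%E.
  apply/integrableP; split => //.
  under eq_integral do rewrite gee0_abs//.
  rewrite integral_nneseries//.
  (* The term of rank [k] is at most [4^k 8^-k = 2^-k], and these add up to [2]. *)
  apply: (@le_lt_trans _ _ 2%:E); last exact: ltry.
  apply: le_trans (@epsilon_trick0 R 2 xpredT _) => //.
  apply: lee_nneseries => k _; first by move=> _; exact: integral_ge0.
  rewrite (_ : F k = fun x => (4 ^ k)%N%:R%:E * ((h k.+1 x - h k x) ^+ 2)%:E)%E//.
  rewrite ge0_integralZl//; last first.
    - by move=> x _; rewrite lee_fin sqr_ge0.
    - apply/measurable_EFinP.
      by apply: measurable_funX; exact: measurable_funB.
  apply: (@le_trans _ _ ((4 ^ k)%N%:R%:E * ((8 ^ k)%N%:R^-1)%:E)%E).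
    by apply: lee_wpmul2l => //; rewrite lee_fin.
  rewrite -EFinM lee_fin !natrX exprS invfM mulrA divff// mul1r.
  rewrite (_ : 8 = 4 * 2 :> R); last by rewrite -natrM.
  by rewrite exprMn invfM mulrA divff ?mul1r// expf_neq0.
apply: filterS (integrable_ae measurableT iS) => x /(_ Logic.I).
rewrite ge0_fin_numE// => Sx.
have [M ME] : exists M : R, (\sum_(k <oo) F k x = M%:E)%E.
  by exists (fine (\sum_(k <oo) F k x)%E); rewrite fineK// ge0_fin_numE.
have dM k : `|h k.+1 x - h k x| <= geometric (Num.sqrt M) (2^-1) k.
  have : (F k x <= M%:E)%E.
    rewrite -ME; apply: le_trans (nneseries_lim_ge k.+1 _) => //.
    by rewrite big_nat_recr//= leeDr// sume_ge0.
  rewrite lee_fin => FM.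
  rewrite -(@ler_pXn2r _ 2)// ?nnegrE ?mulr_ge0 ?sqrtr_ge0 ?exprn_ge0//.
  rewrite /geometric/= exprMn sqr_sqrtr; last first.
    by apply: le_trans FM; rewrite mulr_ge0 ?sqr_ge0.
  rewrite real_normK ?num_real//.
  have -> : (2^-1 ^+ k) ^+ 2 = (4 ^ k)%N%:R^-1 :> R.
    by rewrite -exprM mulnC exprM expr2 -invfM -natrM exprVn natrX.
  by rewrite ler_pdivlMr ?ltr0n ?expn_gt0// mulrC.
have : cvgn (series (telescope (h ^~ x))).
  apply: normed_cvg.
  apply: (@series_le_cvg _ _ (geometric (Num.sqrt M) (2^-1))) => //.
  - by move=> k /=.
  - by move=> k; rewrite /geometric/= mulr_ge0 ?sqrtr_ge0// exprn_ge0.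
  - by apply: is_cvg_geometric_series; rewrite ger0_norm// invf_lt1// ltr1n.
rewrite telescopeK => cvh.
rewrite (_ : h ^~ x = (fun n => h n x - h 0%N x) \+ cst (h 0%N x)); last first.
  by apply/funext => n /=; rewrite subrK.
by apply: is_cvgD => //; exact: is_cvg_cst.
Qed.

(** A subsequence whose increments have squared norm at most [8^-k] converges almost everywhere;
    Fatou's lemma along it turns the Cauchy bound for [g n - g m] into the same bound for
    [g n - h]. *)
Lemma riesz_fischer (g : nat -> T -> R) :
  (forall n, measurable_fun setT (g n)) ->
  (forall e : R, 0 < e -> exists N, forall m n, (N <= m)%N -> (N <= n)%N ->
    (\int[mu]_x ((g m x - g n x) ^+ 2)%:E <= e%:E)%E) ->
  exists2 h : T -> R, measurable_fun setT h &
    (fun n => \int[mu]_x ((g n x - h x) ^+ 2)%:E)%E @ \oo --> (0 : \bar R)%E.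
Proof.
move=> mg cg.
have /choice[N NE] : forall k, exists N, forall m n, (N <= m)%N -> (N <= n)%N ->
    (\int[mu]_x ((g m x - g n x) ^+ 2)%:E <= ((8 ^ k)%N%:R^-1)%:E)%E.
  by move=> k; apply: cg; rewrite invr_gt0 ltr0n expn_gt0.
(* The sum makes [p] nondecreasing and at least [N k]; the added [k] makes the subsequence pass
   every given rank. *)
pose p k := (\sum_(i < k.+1) N i + k)%N.
have Np k : (N k <= p k)%N.
  by rewrite /p big_ord_recr/= -addnA addnCA leq_addr.
have pS k : (p k <= p k.+1)%N.
  by rewrite /p [in leqRHS]big_ord_recr/= -addnA leq_add2l addnS leqW// leq_addl.
have kp k : (k <= p k)%N by rewrite leq_addl.
(* The upper limit is measurable and defined everywhere; where the subsequence converges it is the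
   limit. *)
pose h x := fine (limn_esup (fun k => (g (p k) x)%:E)).
have mh : measurable_fun setT h.
  apply: (measurableT_comp (fine_measurable measurableT)).
  by apply: measurable_fun_limn_esup => k; exact/measurable_EFinP.
have gh : {ae mu, forall x, (fun k => g (p k) x) @ \oo --> h x}.
  have cgp := @ae_cvg_fast (fun k => g (p k)) (fun k => mg _)
    (fun k => NE k _ _ (leq_trans (Np k) (pS k)) (Np k)).
  apply: filterS cgp => x cx; rewrite /h.
  have -> : limn_esup (fun k => (g (p k) x)%:E) = (limn (fun k => g (p k) x))%:E.
    by apply: (cvg_limn_einf_sup _).2; apply: cvg_EFin => //; exact: nearW.
  exact: cx.
exists h => //; apply/cvge0P => [n|e e0].
  by apply: integral_ge0 => x _; rewrite lee_fin sqr_ge0.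
have [M ME] := cg e e0; exists M => n Mn.
(* Starting the subsequence at [M] puts all its indices beyond the Cauchy rank. *)
apply: (@fatou_cvg (fun k x => ((g n x - g (p (k + M)%N) x) ^+ 2)%:E)).
- move=> k; apply/measurable_EFinP.
  by apply: measurable_funX; exact: measurable_funB.
- by move=> k x; rewrite lee_fin sqr_ge0.
- apply/measurable_EFinP.
  by apply: measurable_funX; exact: measurable_funB.
- by move=> x; rewrite lee_fin sqr_ge0.
- apply: filterS gh => x gx; apply: cvg_EFin; first exact: nearW.
  apply: (@cvg_comp _ _ _ (fun k => g n x - g (p (k + M)%N) x) (fun t => t ^+ 2)); last exact: exprn_continuous.
  apply: cvgB; first exact: cvg_cst.
  by rewrite (@cvg_shiftn M _ (fun k => g (p k) x)).
- move=> k; apply: ME => //; apply: leq_trans (kp _).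
  exact: leq_addl.
Qed.

End riesz_fischer.

(** * The Fejer kernel *)

Lemma integrable_le d (X : measurableType d) (R : realType)
    (mu : {measure set X -> \bar R}) (f g : X -> R) :
  measurable_fun setT f -> mu.-integrable setT (EFin \o g) ->
  (forall x, `|f x| <= g x) -> mu.-integrable setT (EFin \o f).
Proof.
move=> mf ig fg; apply: le_integrable ig => //; first exact/measurable_EFinP.
by move=> x _; rewrite /= lee_fin (le_trans (fg x))// ler_norm.
Qed.

(** * Fubini's theorem for kernels dominated by a product *)

Section product_integral.
Context d1 d2 (T1 : measurableType d1) (T2 : measurableType d2) (R : realType).
Variables (m1 : {sigma_finite_measure set T1 -> \bar R})
          (m2 : {sigma_finite_measure set T2 -> \bar R}).
Implicit Type F : T1 * T2 -> R.

Lemma integrable_prod_le F (a : T1 -> R) (b : T2 -> R) :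
  measurable_fun setT F ->
  m1.-integrable setT (EFin \o a) -> m2.-integrable setT (EFin \o b) ->
  (forall x y, `|F (x, y)| <= `|a x| * `|b y|) ->
  (m1 \x m2)%E.-integrable setT (EFin \o F).
Proof.
move=> mF ia ib Fab; apply/(integrable12ltyP m1 m2 _).
  exact/measurable_EFinP.
have [mb by_] := integrableP _ _ _ ib.
have [ma ay] := integrableP _ _ _ ia.
apply: (@le_lt_trans _ _ (\int[m1]_x (`|(a x)%:E| * \int[m2]_y `|(b y)%:E|))%E).
  apply: ge0_le_integral => //.
  - by move=> x _; apply: integral_ge0.
  - apply: (@ge0_measurable_integral1 _ _ _ _ _ m2 (fun z => `|(F z)%:E|)%E) => //.
    by apply: measurableT_comp => //; exact/measurable_EFinP.
  - apply: emeasurable_funM => //.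
    by apply: measurableT_comp => //.
  - move=> x _; rewrite -ge0_integralZl//; last exact: measurableT_comp.
    apply: ge0_le_integral => //.
    + apply: measurableT_comp => //; apply/measurable_EFinP.
      by apply: (measurableT_comp mF).
    + by apply: measurable_funeM; exact: measurableT_comp.
    + by move=> y _; rewrite /= -EFinM lee_fin Fab.
rewrite ge0_integralZr//; last 2 first.
- exact: measurableT_comp.
- exact: integral_ge0.
by rewrite lte_mul_pinfty// ?integral_ge0// ge0_fin_numE// integral_ge0.
Qed.

(** Every section, not just almost every one, is required to be integrable, because [Rintegral]
    applies [fine] to the inner integral at each point. *)
Lemma Rintegral_prod12 F : (m1 \x m2)%E.-integrable setT (EFin \o F) ->
  (forall x, m2.-integrable setT (fun y => (F (x, y))%:E)) ->
  Rintegral (m1 \x m2)%E setT F =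
  Rintegral m1 setT (fun x => Rintegral m2 setT (fun y => F (x, y))).
Proof.
move=> iF iFx; rewrite [LHS]/Rintegral -integral12_prod_meas1//.
congr fine; apply: eq_integral => x _.
by rewrite /Rintegral fineK//; exact: integrable_fin_num.
Qed.

Lemma Rintegral_prod21 F : (m1 \x m2)%E.-integrable setT (EFin \o F) ->
  (forall y, m1.-integrable setT (fun x => (F (x, y))%:E)) ->
  Rintegral (m1 \x m2)%E setT F =
  Rintegral m2 setT (fun y => Rintegral m1 setT (fun x => F (x, y))).
Proof.
move=> iF iFy; rewrite [LHS]/Rintegral -integral21_prod_meas1//.
congr fine; apply: eq_integral => y _.
by rewrite /Rintegral fineK//; exact: integrable_fin_num.
Qed.

(** Domination by a product of integrable functions of one variable each gives both joint
    integrability and integrability of every section. *)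
Lemma Rintegral_swap F (a : T1 -> R) (b : T2 -> R) :
  measurable_fun setT F ->
  m1.-integrable setT (EFin \o a) -> m2.-integrable setT (EFin \o b) ->
  (forall x y, `|F (x, y)| <= `|a x| * `|b y|) ->
  Rintegral m1 setT (fun x => Rintegral m2 setT (fun y => F (x, y))) =
  Rintegral m2 setT (fun y => Rintegral m1 setT (fun x => F (x, y))).
Proof.
move=> mF ia ib Fab; have iF := integrable_prod_le mF ia ib Fab.
rewrite -Rintegral_prod12// -?Rintegral_prod21//.
- move=> y; apply: (@integrable_le _ _ _ _ _ (fun x => `|b y| * `|a x|)).
  + exact: (measurableT_comp mF).
  + apply: (@eq_integrable _ _ _ m1 _ measurableT (fun x => `|b y|%:E * (`|a x|)%:E)%E) => //.
    by apply: integrableZl => //; apply: integrable_norm.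
  + by move=> x; rewrite mulrC Fab.
- move=> x; apply: (@integrable_le _ _ _ _ _ (fun y => `|a x| * `|b y|)).
  + exact: (measurableT_comp mF).
  + apply: (@eq_integrable _ _ _ m2 _ measurableT (fun y => `|a x|%:E * (`|b y|)%:E)%E) => //.
    by apply: integrableZl => //; apply: integrable_norm.
  + by move=> y; rewrite Fab.
Qed.

Lemma Rintegral_prodM (a : T1 -> R) (b : T2 -> R) :
  m1.-integrable setT (EFin \o a) -> m2.-integrable setT (EFin \o b) ->
  (m1 \x m2)%E.-integrable setT (EFin \o (fun z => a z.1 * b z.2)) /\
  Rintegral (m1 \x m2)%E setT (fun z => a z.1 * b z.2) =
  Rintegral m1 setT a * Rintegral m2 setT b.
Proof.
move=> ia ib.
have ma : measurable_fun setT a by exact/measurable_EFinP/(measurable_int m1).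
have mb : measurable_fun setT b by exact/measurable_EFinP/(measurable_int m2).
have iab : (m1 \x m2)%E.-integrable setT (EFin \o (fun z => a z.1 * b z.2)).
  apply: (integrable_prod_le _ ia ib); last by move=> x y /=; rewrite normrM.
  by apply: measurable_funM; apply: measurableT_comp.
split => //; rewrite Rintegral_prod12//; last first.
  by move=> x; exact: (integrableZl measurableT (a x) ib).
under eq_Rintegral do rewrite /= RintegralZl//.
by rewrite RintegralZr.
Qed.

End product_integral.

(** * The one-dimensional Fejer kernel and its mass *)

Section fejer_kernel.
Context (R : realType).
Notation lambda := (@lebesgue_measure R).
Implicit Types (t c z : R).

Definition tri t : R := Num.max 0 (1 - `|t|).

Lemma tri_ge0 t : 0 <= tri t. Proof. by rewrite /tri le_max lexx. Qed.

Lemma tri_le1 t : tri t <= 1.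
Proof. by rewrite /tri ge_max ler01 gerBl normr_ge0. Qed.

Lemma triN t : tri (- t) = tri t. Proof. by rewrite /tri normrN. Qed.

Lemma measurable_tri : measurable_fun setT tri.
Proof.
by apply: measurable_maxr => //; apply: measurable_funB => //;
  exact: normr_measurable.
Qed.

Lemma integrable_tri : lambda.-integrable setT (EFin \o tri).
Proof.
apply: (@integrable_le _ _ _ lambda tri (\1_`[-1, 1])).
- exact: measurable_tri.
- exact: integrable_indic_itv.
- move=> t; rewrite (ger0_norm (tri_ge0 t)) indicE mem_setE in_itv/=.
  have [|] := boolP (-1 <= t <= 1); first by rewrite tri_le1.
  rewrite -ler_norml -ltNge => /ltW t1.
  by rewrite /tri ge_max lexx subr_le0.
Qed.

Lemma measurable_cosM c : measurable_fun setT (fun t : R => cos (c * t)).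
Proof.
apply: (measurableT_comp (continuous_measurable_fun (@continuous_cos R))).
exact: measurable_funM.
Qed.

Lemma measurable_sinM c : measurable_fun setT (fun t : R => sin (c * t)).
Proof.
apply: (measurableT_comp (continuous_measurable_fun (@continuous_sin R))).
exact: measurable_funM.
Qed.

Lemma integrable_tri_cos c :
  lambda.-integrable setT (EFin \o (fun t => tri t * cos (c * t))).
Proof.
apply: (integrable_le _ integrable_tri).
  by apply: measurable_funM; [exact: measurable_tri|exact: measurable_cosM].
move=> t; rewrite normrM (ger0_norm (tri_ge0 _)).
rewrite ler_piMr ?tri_ge0//.
exact: cos_max.
Qed.

Lemma integrable_tri_sin c :
  lambda.-integrable setT (EFin \o (fun t => tri t * sin (c * t))).
Proof.
apply: (integrable_le _ integrable_tri).
  by apply: measurable_funM; [exact: measurable_tri|exact: measurable_sinM].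
move=> t; rewrite normrM (ger0_norm (tri_ge0 _)).
rewrite ler_piMr ?tri_ge0//.
exact: sin_max.
Qed.

(** The integrand is odd: reflection turns the integral into its opposite. *)
Lemma Rintegral_tri_sin c : Rintegral lambda setT (fun t => tri t * sin (c * t)) = 0.
Proof.
set f := fun t => tri t * sin (c * t).
have N10 : -1 != 0 :> R by rewrite oppr_eq0 oner_neq0.
have := rescales_Rintegral (rescales_affine 0 N10) (integrable_tri_sin c).
rewrite normrN1 invr1 mul1r.
rewrite (_ : _ \o _ = (fun t => -1 * f t)); last first.
  by apply/funext => t; rewrite /f/= addr0 !mulN1r triN mulrN sinN mulrN.
rewrite RintegralZl//; last exact: integrable_tri_sin.
rewrite -/f => fN.
by move: fN; rewrite mulN1r; lra.
Qed.

Lemma integral01_cos c : c != 0 ->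
  Rintegral lambda `[0, 1] (fun t => (1 - t) * cos (c * t)) = (1 - cos c) / c ^+ 2.
Proof.
move=> c0.
(* Primitive obtained by one integration by parts. *)
pose F t := (1 - t) * (sin (c * t) / c) - cos (c * t) / c ^+ 2.
have dF t : is_derive t 1 F ((1 - t) * cos (c * t)).
  rewrite /F; apply: is_derive_eq.
  by rewrite /GRing.scale/=; field.
rewrite /Rintegral (@continuous_FTC2 R _ F 0 1)//=.
- rewrite /F subrr mul0r mulr0 sin0 mul0r mulr0 cos0 mulr1.
  by field.
- apply: continuous_subspaceT => t.
  apply: cvgM; first by apply: cvgB; [exact: cvg_cst|exact: cvg_id].
  apply: continuous_comp; first by apply: cvgM; [exact: cvg_cst|exact: cvg_id].
  exact: continuous_cos.
- split.
  + by move=> t _; have [] := dF t.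
  + apply: cvg_at_right_filter; apply: differentiable_continuous.
    by apply/derivable1_diffP; have [] := dF 0.
  + apply: cvg_at_left_filter; apply: differentiable_continuous.
    by apply/derivable1_diffP; have [] := dF 1.
- by move=> t _; rewrite derive1E; exact: derive_val.
Qed.

Definition fejer z : R := Rintegral lambda setT (fun t => tri t * cos (2 * pi * z * t)).

Lemma Rintegral_tri_cos c : c != 0 ->
  Rintegral lambda setT (fun t => tri t * cos (c * t)) = 2 * (1 - cos c) / c ^+ 2.
Proof.
move=> c0.
pose u t := (1 - t) * cos (c * t).
have cu : {within `[0, 1], continuous (u : R -> R^o)}.
  apply: continuous_subspaceT => t.
  apply: cvgM; first by apply: cvgB; [exact: cvg_cst|exact: cvg_id].
  apply: continuous_comp; first by apply: cvgM; [exact: cvg_cst|exact: cvg_id].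
  exact: continuous_cos.
have iu : lambda.-integrable `[0, 1] (EFin \o u).
  by apply: continuous_compact_integrable => //; exact: segment_compact.
have iu1 : lambda.-integrable `]0, 1] (EFin \o u).
  apply: integrableS iu => //; exact: subset_itv_oc_cc.
have i1 : lambda.-integrable setT (EFin \o (u \_ `[0, 1])).
  by rewrite -restrict_EFin; apply/(integrable_mkcond _ _).1.
have i2 : lambda.-integrable setT (EFin \o (u \_ `]0, 1])).
  by rewrite -restrict_EFin; apply/(integrable_mkcond _ _).1.
have N10 : -1 != 0 :> R by rewrite oppr_eq0 oner_neq0.
have rN := rescales_affine 0 N10.
have i2N := rescales_integrable rN i2.
(* By parity the integral is twice the one over [[0, 1]]; the reflected half is taken on []0, 1]] so
   that [t = 0] is counted once. *)
rewrite (_ : (fun t => _) = (fun t => (u \_ `[0, 1]) t + ((u \_ `]0, 1]) \o (fun x => -1 * x + 0)) t)); last first.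
  apply/funext => t /=; rewrite !patchE !mem_setE !in_itv/= addr0 mulN1r /u.
  rewrite /tri; have [t0|t0] := leP 0 t.
    rewrite ger0_norm// oppr_gt0 ltNge t0/= addr0.
    have [t1|t1] := leP t 1; first by rewrite (max_idPr _)// subr_ge0.
    by rewrite (max_idPl _) ?mul0r// subr_le0 ltW.
  rewrite ltr0_norm// oppr_gt0 t0/= add0r.
  have [t1|t1] := leP (- t) 1; first by rewrite (max_idPr _) ?subr_ge0// mulrN cosN.
  by rewrite (max_idPl _) ?mul0r// subr_le0 ltW.
rewrite RintegralD// (rescales_Rintegral rN)//.
rewrite normrN1 invr1 mul1r -!Rintegral_mkcond Rintegral_itv_obnd_cbnd//.
rewrite integral01_cos//.
by field.
Qed.

Lemma fejerE z : z != 0 -> fejer z = (1 - cos (2 * pi * z)) / (2 * pi ^+ 2 * z ^+ 2).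
Proof.
move=> z0; have p0 : pi != 0 :> R by rewrite gt_eqF// pi_gt0.
rewrite /fejer Rintegral_tri_cos; last by rewrite !mulf_neq0.
have E (c p y : R) : p != 0 -> y != 0 ->
    2 * (1 - c) / (2 * p * y) ^+ 2 = (1 - c) / (2 * p ^+ 2 * y ^+ 2).
  by move=> p_neq0 y_neq0; field; rewrite p_neq0 y_neq0.
exact: E.
Qed.

Lemma fejer_ge0 z : 0 <= fejer z.
Proof.
have [->|z0] := eqVneq z 0.
  by apply: Rintegral_ge0 => t _; rewrite mulr0 mul0r cos0 mulr1 tri_ge0.
rewrite fejerE// divr_ge0// ?subr_ge0 ?cos_le1//.
by rewrite mulr_ge0 ?sqr_ge0// mulr_ge0 ?sqr_ge0.
Qed.

Lemma measurable_fejer : measurable_fun setT fejer.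
Proof.
pose f (zt : R * R) := tri zt.2 * cos (2 * pi * zt.1 * zt.2).
apply: (@measurable_Rintegral1 _ _ _ _ R lambda f).
apply: measurable_funM; first by apply: (measurableT_comp measurable_tri).
apply: (measurableT_comp (continuous_measurable_fun (@continuous_cos R))).
by apply: measurable_funM => //; exact: measurable_funM.
Qed.

(** Two bounds are added: [fejer z] is at most the integral of [tri], as [cos <= 1], and
    [z^2 fejer z <= 1] by the closed form. Together they give the decay [1 / (1 + z^2)], hence
    integrability. *)
Lemma fejer_le : exists2 C : R, 0 <= C & forall z, fejer z <= C * (oneDsqr z)^-1.
Proof.
have M0 : 0 <= Rintegral lambda setT tri by apply: Rintegral_ge0 => t _; exact: tri_ge0.
exists (1 + Rintegral lambda setT tri); first by rewrite addr_ge0.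
move=> z; have p0 : 0 < oneDsqr z by rewrite /oneDsqr ltr_pwDl// sqr_ge0.
rewrite ler_pdivlMr// /oneDsqr mulrDr mulr1 addrC lerD//.
  have [->|z0] := eqVneq z 0; first by rewrite expr0n/= mulr0.
  have pi0 : pi != 0 :> R by rewrite gt_eqF// pi_gt0.
  rewrite fejerE// (_ : _ / _ * z ^+ 2 = (1 - cos (2 * pi * z)) / (2 * pi ^+ 2)); last first.
    rewrite [X in _ / X * _]mulrC invfM -!mulrA; congr (_ * _).
    by rewrite mulrCA mulVf ?mulr1 ?sqrf_eq0.
  have pi2 : 2 <= pi :> R by exact: pi_ge2.
  rewrite ler_pdivrMr ?mulr_gt0 ?exprn_gt0 ?pi_gt0// mul1r.
  have := cos_geN1 (2 * pi * z); nra.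
apply: le_Rintegral => //; first exact: integrable_tri_cos.
  exact: integrable_tri.
move=> t _; rewrite ler_piMr ?tri_ge0//; exact: cos_le1.
Qed.

Lemma integrable_fejer : lambda.-integrable setT (EFin \o fejer).
Proof.
have [C C0 fC] := fejer_le.
apply: (@integrable_le _ _ _ lambda fejer (fun z => C * (oneDsqr z)^-1)).
- exact: measurable_fejer.
- apply: (@integrableZl _ _ _ lambda _ measurableT C (fun z => (oneDsqr z)^-1%:E)).
  have mo : measurable_fun setT (fun z : R => (oneDsqr z)^-1).
    by apply: continuous_measurable_fun => x; exact: continuous_oneDsqrV.
  apply/integrableP; split; first exact/measurable_EFinP.
  under eq_integral do rewrite /= ger0_norm ?oneDsqrV_ge0//.
  rewrite ge0_symfun_integralT.
  + rewrite (_ : [set x | 0 <= x] = `[0, +oo[%classic).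
      by rewrite integral0y_oneDsqr -EFinM ltry.
    by apply/seteqP; split => x /=; rewrite in_itv/= andbT.
  + by move=> x; rewrite invr_ge0 (le_trans ler01 (oneDsqr_ge1 _)).
  + by move=> x; exact: continuous_oneDsqrV.
  + by move=> x; rewrite /oneDsqr/= sqrrN.
- by move=> z; rewrite ger0_norm ?fejer_ge0.
Qed.

Definition fejer_mass : R := Rintegral lambda setT fejer.

(** A zero mass would make [fejer] vanish almost everywhere, whereas by the closed form it is
    positive on []0, 1[], where [1 - cos (2 pi z) = 2 sin^2 (pi z)]. *)
Lemma fejer_mass_gt0 : 0 < fejer_mass.
Proof.
have m0 : 0 <= fejer_mass by apply: Rintegral_ge0 => z _; exact: fejer_ge0.
rewrite lt_neqAle m0 andbT; apply/negP => /eqP m_eq0.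
have : (\int[lambda]_z `|(fejer z)%:E| = 0)%E.
  under eq_integral do rewrite gee0_abs ?lee_fin ?fejer_ge0//.
  have := integrable_fin_num measurableT integrable_fejer.
  by move/fineK => <-; rewrite -[fine _]/fejer_mass -m_eq0.
have mf : measurable_fun setT (EFin \o fejer).
  by apply/measurable_EFinP; exact: measurable_fejer.
move=> /(ae_eq_integral_abs lambda measurableT mf).1[].
move=> N [mN N0 subN].
have : (lambda `]0%R, 1%R[ <= lambda N)%E.
  apply: le_measure; rewrite ?inE//.
  move=> z /=; rewrite in_itv/= => /andP[z0 z1]; apply: subN => /= /(_ Logic.I) /eqP.
  rewrite /cst/= eqe fejerE ?gt_eqF//.
  have p0 := @pi_gt0 R.
  have s0 : 0 < sin (pi * z).
    by apply: sin_gt0_pi; rewrite mulr_gt0//= gtr_pMr.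
  have -> : 1 - cos (2 * pi * z) = 2 * sin (pi * z) ^+ 2.
    rewrite (_ : 2 * pi * z = pi * z + pi * z); last by rewrite -mulrA mulr2n mulrDl mul1r.
    by rewrite cosD -!expr2 cos2sin2; ring.
  by rewrite divr_gt0 ?mulr_gt0 ?exprn_gt0.
by rewrite lebesgue_measure_itv/= lte_fin ltr01 N0 oppr0 adde0 lee_fin ler10.
Qed.

Lemma integrable_tri_div (n : R) : 0 < n ->
  lambda.-integrable setT (EFin \o (fun t => tri (t / n))).
Proof.
move=> n0; have nV0 : n^-1 != 0 by rewrite invr_eq0 gt_eqF.
have := rescales_integrable (rescales_affine 0 nV0) integrable_tri.
by congr integrable; apply/funext => t /=; rewrite addr0 mulrC.
Qed.

Lemma Rintegral_tri_div_cos (n z : R) : 0 < n ->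
  Rintegral lambda setT (fun t => tri (t / n) * cos (2 * pi * z * t)) =
  n * fejer (n * z).
Proof.
move=> n0; have nV0 : n^-1 != 0 by rewrite invr_eq0 gt_eqF.
have := rescales_Rintegral (rescales_affine 0 nV0)
  (integrable_tri_cos (2 * pi * (n * z))).
rewrite gtr0_norm ?invr_gt0// invrK -/(fejer _) => <-.
congr Rintegral; apply/funext => t /=; rewrite addr0 [n^-1 * t]mulrC.
by congr (_ * cos _); field; rewrite gt_eqF.
Qed.

Lemma Rintegral_tri_div_sin (n z : R) : 0 < n ->
  Rintegral lambda setT (fun t => tri (t / n) * sin (2 * pi * z * t)) = 0.
Proof.
move=> n0; have nV0 : n^-1 != 0 by rewrite invr_eq0 gt_eqF.
have := rescales_Rintegral (rescales_affine 0 nV0)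
  (integrable_tri_sin (2 * pi * (n * z))).
rewrite Rintegral_tri_sin mulr0 => <-.
congr Rintegral; apply/funext => t /=; rewrite addr0 [n^-1 * t]mulrC.
by congr (_ * sin _); field; rewrite gt_eqF.
Qed.

End fejer_kernel.

(** * The Fejer kernel of the plane *)

Section fejer_kernel_plane.
Context (R : realType).
Notation lambda := (@lebesgue_measure R).
Notation leb2 := (@leb2 R).
Implicit Types (z w x y : R * R) (n : R).

Definition phase x w : R := 2 * pi * (x.1 * w.1 + x.2 * w.2).

Definition tri2 n w : R := tri (w.1 / n) * tri (w.2 / n).

(** The transform of [tri2 n]. Thanks to the factor [n^2] its integral is the same for all [n > 0],
    while its mass concentrates at the origin as [n] grows. *)
Definition fejer2 n z : R := n ^+ 2 * (fejer (n * z.1) * fejer (n * z.2)).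

Lemma integrable_tri2 n : 0 < n -> leb2.-integrable setT (EFin \o tri2 n).
Proof.
move=> n0; have i := integrable_tri_div n0.
exact: (Rintegral_prodM i i).1.
Qed.

Lemma tri2_ge0 n w : 0 <= tri2 n w.
Proof. by rewrite mulr_ge0// tri_ge0. Qed.

Lemma measurable_phase : measurable_fun setT (fun z : (R * R) * (R * R) => phase z.1 z.2).
Proof.
have m11 : measurable_fun setT (fun z : (R * R) * (R * R) => z.1.1).
  by apply: (measurableT_comp measurable_fst); exact: measurable_fst.
have m12 : measurable_fun setT (fun z : (R * R) * (R * R) => z.1.2).
  by apply: (measurableT_comp measurable_snd); exact: measurable_fst.
have m21 : measurable_fun setT (fun z : (R * R) * (R * R) => z.2.1).
  by apply: (measurableT_comp measurable_fst); exact: measurable_snd.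
have m22 : measurable_fun setT (fun z : (R * R) * (R * R) => z.2.2).
  by apply: (measurableT_comp measurable_snd); exact: measurable_snd.
by apply: measurable_funM => //; apply: measurable_funD; exact: measurable_funM.
Qed.

Lemma measurable_cos_phase : measurable_fun setT (fun z : (R * R) * (R * R) => cos (phase z.1 z.2)).
Proof.
apply: (measurableT_comp (continuous_measurable_fun (@continuous_cos R))).
exact: measurable_phase.
Qed.

Lemma measurable_sin_phase : measurable_fun setT (fun z : (R * R) * (R * R) => sin (phase z.1 z.2)).
Proof.
apply: (measurableT_comp (continuous_measurable_fun (@continuous_sin R))).
exact: measurable_phase.
Qed.

Lemma integrable_tri2_cos n z : 0 < n ->
  leb2.-integrable setT (EFin \o (fun w => tri2 n w * cos (phase z w))).
Proof.
move=> n0; apply: (integrable_le _ (integrable_tri2 n0)).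
  apply: measurable_funM.
    by apply/measurable_EFinP; exact: measurable_int (integrable_tri2 n0).
  exact: (measurableT_comp measurable_cos_phase
    (measurable_fun_pair (@measurable_cst _ _ _ _ setT z) (@measurable_id _ _ setT))).
by move=> w; rewrite normrM (ger0_norm (tri2_ge0 _ _)) ler_piMr ?tri2_ge0 ?cos_max.
Qed.

(** The cosine of the sum expands into a product of cosine integrals minus a product of sine
    integrals, and the latter vanish by parity. *)
Lemma Rintegral_tri2_cos n z : 0 < n ->
  Rintegral leb2 setT (fun w => tri2 n w * cos (phase z w)) = fejer2 n z.
Proof.
move=> n0; have i := integrable_tri_div n0.
have mt : measurable_fun setT (fun t : R => tri (t / n)).
  by apply/measurable_EFinP; exact: measurable_int i.
have ic c : lambda.-integrable setT (EFin \o (fun t => tri (t / n) * cos (c * t))).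
  apply: (integrable_le _ i).
    by apply: measurable_funM => //; exact: measurable_cosM.
  by move=> t; rewrite normrM (ger0_norm (tri_ge0 _)) ler_piMr ?tri_ge0 ?cos_max.
have is_ c : lambda.-integrable setT (EFin \o (fun t => tri (t / n) * sin (c * t))).
  apply: (integrable_le _ i).
    by apply: measurable_funM => //; exact: measurable_sinM.
  by move=> t; rewrite normrM (ger0_norm (tri_ge0 _)) ler_piMr ?tri_ge0 ?sin_max.
have [i1 e1] := Rintegral_prodM (ic (2 * pi * z.1)) (ic (2 * pi * z.2)).
have [i2 e2] := Rintegral_prodM (is_ (2 * pi * z.1)) (is_ (2 * pi * z.2)).
transitivity (Rintegral leb2 setT (fun w =>
    (tri (w.1 / n) * cos (2 * pi * z.1 * w.1)) * (tri (w.2 / n) * cos (2 * pi * z.2 * w.2)) -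
    (tri (w.1 / n) * sin (2 * pi * z.1 * w.1)) * (tri (w.2 / n) * sin (2 * pi * z.2 * w.2)))).
  congr Rintegral; apply/funext => w; rewrite /phase /tri2.
  by rewrite mulrDr !mulrA cosD; ring.
transitivity (n * fejer (n * z.1) * (n * fejer (n * z.2)) - 0); last first.
  by rewrite /fejer2; ring.
rewrite RintegralB//; congr (_ - _).
  by rewrite -!Rintegral_tri_div_cos// -e1.
by apply: (etrans e2); rewrite Rintegral_tri_div_sin// mul0r.
Qed.

Lemma fejer2_ge0 n z : 0 <= fejer2 n z.
Proof. by rewrite mulr_ge0 ?sqr_ge0// mulr_ge0// fejer_ge0. Qed.

(** The bound [cos <= 1] under the integral sign; it makes [g x * g y * fejer2 n (x - y)] jointly
    integrable for every integrable [g]. *)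
Lemma fejer2_le n z : 0 < n -> fejer2 n z <= Rintegral leb2 setT (tri2 n).
Proof.
move=> n0; rewrite -Rintegral_tri2_cos//; apply: le_Rintegral => //.
- exact: integrable_tri2_cos.
- exact: integrable_tri2.
- by move=> w _; rewrite ler_piMr ?tri2_ge0 ?cos_le1.
Qed.

Lemma measurable_fejer2 n : measurable_fun setT (fejer2 n).
Proof.
apply: measurable_funM => //; apply: measurable_funM;
  apply: (measurableT_comp (@measurable_fejer R)); exact: measurable_funM.
Qed.

Lemma integral_fejer2 : (\int[leb2]_z (fejer2 1 z)%:E = (fejer_mass R ^+ 2)%:E)%E.
Proof.
have i := @integrable_fejer R.
have [i2 e2] := Rintegral_prodM i i.
rewrite /fejer_mass expr2 -e2 /Rintegral fineK; last exact: integrable_fin_num i2.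
by apply: eq_integral => z _; rewrite /fejer2 expr1n !mul1r.
Qed.

End fejer_kernel_plane.

(** * Continuity of translations *)

Lemma integrable_indic_lty d (T : measurableType d) (R : realType)
    (mu : {measure set T -> \bar R}) (A : set T) :
  measurable A -> (mu A < +oo)%E -> mu.-integrable setT (EFin \o \1_A).
Proof.
move=> mA Aoo; apply/integrableP; split.
  by apply/measurable_EFinP; exact: measurable_indic.
under eq_integral do rewrite /= ger0_norm//.
by rewrite integral_indic// setIT.
Qed.

Lemma cvg_sqrB0 (R : realType) (u : nat -> R) (l : R) :
  u @ \oo --> l -> (fun n => (l - u n) ^+ 2) @ \oo --> (0 : R).
Proof.
move=> ul; have ul0 : (fun n => l - u n) @ \oo --> (0 : R).
  by rewrite -(subrr l); apply: cvgB => //; exact: cvg_cst.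
have h := cvgM ul0 ul0; rewrite mulr0 in h.
by rewrite (_ : (fun n => _) = (fun n => l - u n) \* (fun n => l - u n)); [exact: h|].
Qed.

Lemma sqrD_le2 (R : realDomainType) (a b : R) :
  (a + b) ^+ 2 <= 2 * a ^+ 2 + 2 * b ^+ 2.
Proof.
rewrite -subr_ge0 (_ : _ - _ = (a - b) ^+ 2) ?sqr_ge0//; ring.
Qed.

Lemma cvg_integral_dominated0 d (T : measurableType d) (R : realType)
    (mu : {measure set T -> \bar R}) (F : nat -> T -> R) (b : T -> R) :
  (forall n, measurable_fun setT (F n)) -> (forall n x, 0 <= F n x <= b x) ->
  mu.-integrable setT (EFin \o b) ->
  {ae mu, forall x, F ^~ x @ \oo --> 0} ->
  (fun n => \int[mu]_x (F n x)%:E)%E @ \oo --> (0 : \bar R)%E.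
Proof.
move=> mF Fb ib F0.
have mEF n : measurable_fun setT (EFin \o F n) by exact/measurable_EFinP.
have cF : {ae mu, forall x, setT x -> (fun n => (F n x)%:E) @ \oo --> (0 : \bar R)%E}.
  by apply: filterS F0 => x Fx _; apply: cvg_EFin => //; exact: nearW.
have dF : {ae mu, forall x n, setT x -> (`|(F n x)%:E| <= (b x)%:E)%E}.
  apply: aeW => x n _; have /andP[F0x Fbx] := Fb n x.
  by rewrite /= lee_fin ger0_norm.
have [_ _] := dominated_convergence measurableT mEF (measurable_cst 0%E) cF ib dF.
by rewrite integral0.
Qed.

(** * Closure properties of the functions whose translates converge in mean square *)

Section translation_continuity_abstract.
Context d (T : measurableType d) (R : realType) (mu : {measure set T -> \bar R}).
Variable tau : nat -> T -> T.
Hypothesis tauP : forall n, rescales mu (tau n) 1.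
Implicit Types (f g h : T -> R) (e c : R).

Definition osc n g := (\int[mu]_x ((g x - g (tau n x)) ^+ 2)%:E)%E.

Definition vanishing_osc g := forall e, 0 < e ->
  exists N, forall n, (N <= n)%N -> (osc n g <= e%:E)%E.

Let mtau n : measurable_fun setT (tau n). Proof. by have [] := tauP n. Qed.

Lemma measurable_sqr g : measurable_fun setT g ->
  measurable_fun setT (fun x => (g x ^+ 2)%:E).
Proof. by move=> mg; apply/measurable_EFinP; exact: measurable_funX. Qed.

Lemma integral_sqrD2 (m : {measure set T -> \bar R}) f g :
  measurable_fun setT f -> measurable_fun setT g ->
  (\int[m]_x ((f x + g x) ^+ 2)%:E <=
   2%:E * \int[m]_x (f x ^+ 2)%:E + 2%:E * \int[m]_x (g x ^+ 2)%:E)%E.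
Proof.
move=> mf mg; have f2 := measurable_sqr mf; have g2 := measurable_sqr mg.
rewrite -!ge0_integralZl//; try by move=> x _; rewrite lee_fin sqr_ge0.
rewrite -ge0_integralD//.
- apply: ge0_le_integral => //.
  + by move=> x _; rewrite lee_fin sqr_ge0.
  + by apply: measurable_sqr; exact: measurable_funD.
  + by apply: emeasurable_funD; exact: measurable_funeM.
  + by move=> x _; rewrite -!EFinM -EFinD lee_fin sqrD_le2.
- by move=> x _; rewrite -EFinM lee_fin mulr_ge0 ?sqr_ge0.
- exact: measurable_funeM.
- by move=> x _; rewrite -EFinM lee_fin mulr_ge0 ?sqr_ge0.
- exact: measurable_funeM.
Qed.

Lemma measurable_osc n g : measurable_fun setT g ->
  measurable_fun setT (fun x => g x - g (tau n x)).
Proof. by move=> mg; apply: measurable_funB => //; exact: measurableT_comp. Qed.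

Lemma vanishing_oscD f g : measurable_fun setT f -> measurable_fun setT g ->
  vanishing_osc f -> vanishing_osc g -> vanishing_osc (fun x => f x + g x).
Proof.
move=> mf mg vf vg e e0.
have e40 : 0 < e / 4 by rewrite divr_gt0.
have [N1 h1] := vf _ e40; have [N2 h2] := vg _ e40.
exists (maxn N1 N2) => n; rewrite geq_max => /andP[/h1 {}h1 /h2 {}h2].
rewrite /osc; under eq_integral do rewrite opprD addrACA.
apply: le_trans (integral_sqrD2 _ (measurable_osc n mf) (measurable_osc n mg)) _.
apply: (@le_trans _ _ (2%:E * (e / 4)%:E + 2%:E * (e / 4)%:E)%E).
  by apply: leeD; apply: lee_wpmul2l.
by rewrite -!EFinM -EFinD lee_fin; lra.
Qed.

Lemma vanishing_oscZ c g : measurable_fun setT g ->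
  vanishing_osc g -> vanishing_osc (fun x => c * g x).
Proof.
move=> mg vg e e0.
have c0 : 0 < c ^+ 2 + 1 by rewrite ltr_wpDl ?sqr_ge0.
have [N h] := vg _ (divr_gt0 e0 c0); exists N => n /h {}h.
have -> : osc n (fun x => c * g x) = ((c ^+ 2)%:E * osc n g)%E.
  rewrite -ge0_integralZl//.
  - by apply: eq_integral => x _; rewrite -EFinM -mulrBr exprMn.
  - by apply: measurable_sqr; exact: measurable_osc.
  - by move=> x _; rewrite lee_fin sqr_ge0.
  - by rewrite lee_fin sqr_ge0.
apply: (@le_trans _ _ ((c ^+ 2)%:E * (e / (c ^+ 2 + 1))%:E)%E).
  by apply: lee_wpmul2l => //; rewrite lee_fin sqr_ge0.
rewrite -EFinM lee_fin mulrA ler_pdivrMr// mulrC ler_wpM2l ?(ltW e0)//.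
by rewrite lerDl.
Qed.

Lemma vanishing_osc_sum (I : Type) (s : seq I) (c : I -> R) (g : I -> T -> R) :
  (forall i, measurable_fun setT (g i)) -> (forall i, vanishing_osc (g i)) ->
  vanishing_osc (fun x => \sum_(i <- s) c i * g i x).
Proof.
move=> mg vg; elim: s => [|i s ih].
  move=> e e0; exists 0%N => n _; rewrite /osc integral0_eq ?lee_fin ?ltW//.
  by move=> x _; rewrite !big_nil subrr expr0n.
rewrite (_ : (fun x => _) =
    (fun x => c i * g i x + \sum_(j <- s) c j * g j x)); last first.
  by apply/funext => x; rewrite big_cons.
apply: vanishing_oscD => //.
- exact: measurable_funM.
- by apply: measurable_sum => j; exact: measurable_funM.
- exact: vanishing_oscZ.
Qed.

(** In [f - f o tau = (f - g) - (f - g) o tau + (g - g o tau)] the first two terms are small for all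
    [n] at once, since [tau n] preserves the measure. *)
Lemma vanishing_osc_closed f : measurable_fun setT f ->
  (forall e, 0 < e -> exists g, [/\ measurable_fun setT g, vanishing_osc g &
    (\int[mu]_x ((f x - g x) ^+ 2)%:E <= e%:E)%E]) ->
  vanishing_osc f.
Proof.
move=> mf h e e0.
(* Two uses of [(a + b)^2 <= 2 a^2 + 2 b^2] produce [2 (2 + 2) + 2 = 10] times this quantity, hence
   less than [e]. *)
have e80 : 0 < e / 16 by rewrite divr_gt0.
have [g [mg vg fg]] := h _ e80.
have [N gN] := vg _ e80; exists N => n /gN {}gN.
have mfg : measurable_fun setT (fun x => f x - g x) by exact: measurable_funB.
have mfgt : measurable_fun setT (fun x => - (f (tau n x) - g (tau n x))).
  by apply: measurable_funN; exact: (measurableT_comp mfg (mtau n)).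
rewrite /osc (_ : (fun x => _) = fun x =>
    (((f x - g x) + - (f (tau n x) - g (tau n x)) + (g x - g (tau n x))) ^+ 2)%:E); last first.
  by apply/funext => x; congr (_%:E); ring.
apply: le_trans (integral_sqrD2 _ (measurable_funD mfg mfgt) (measurable_osc n mg)) _.
have h2 : (\int[mu]_x (((f x - g x) + - (f (tau n x) - g (tau n x))) ^+ 2)%:E <=
    2%:E * (e / 16)%:E + 2%:E * (e / 16)%:E)%E.
  apply: le_trans (integral_sqrD2 _ mfg mfgt) _.
  apply: leeD; apply: lee_wpmul2l => //.
  under eq_integral do rewrite sqrrN.
  have [_ _ tE] := tauP n.
  rewrite (tE (fun x => ((f x - g x) ^+ 2)%:E)) ?mul1e//.
    exact: (measurable_sqr mfg).
  by move=> x; rewrite lee_fin sqr_ge0.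
apply: (@le_trans _ _
    (2%:E * (2%:E * (e / 16)%:E + 2%:E * (e / 16)%:E) + 2%:E * (e / 16)%:E)%E).
  by apply: leeD; apply: lee_wpmul2l.
by rewrite -!EFinM -!EFinD -?EFinM -?EFinD lee_fin; lra.
Qed.

(** Dominated convergence makes [g n] tend to [f] in mean square, and the class is closed. *)
Lemma vanishing_osc_cvg f (g : nat -> T -> R) (b : T -> R) :
  measurable_fun setT f -> (forall n, measurable_fun setT (g n)) ->
  (forall n, vanishing_osc (g n)) ->
  mu.-integrable setT (EFin \o b) ->
  (forall n x, (f x - g n x) ^+ 2 <= b x) ->
  (forall x, g ^~ x @ \oo --> f x) ->
  vanishing_osc f.
Proof.
move=> mf mg vg ib fgb gf; apply: vanishing_osc_closed => // e e0.
have F0 : {ae mu, forall x, (fun n => (f x - g n x) ^+ 2) @ \oo --> (0 : R)}.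
  by apply: aeW => x; exact: cvg_sqrB0.
have mF n : measurable_fun setT (fun x => (f x - g n x) ^+ 2).
  by apply: measurable_funX; exact: measurable_funB.
have := cvg_integral_dominated0 mF _ ib F0.
move=> /(_ (fun n x => introT andP (conj (sqr_ge0 _) (fgb n x)))).
have i0 n : (0 <= \int[mu]_x ((f x - g n x) ^+ 2)%:E)%E.
  by apply: integral_ge0 => x _; rewrite lee_fin sqr_ge0.
move=> /(cvge0P i0).1 /(_ e e0)[N gN].
by exists (g N); split => //; exact: gN.
Qed.

End translation_continuity_abstract.

(** * From open sets to square integrable functions of the plane *)

Section translation_continuity.
Context (R : realType).
Notation lambda := (@lebesgue_measure R).
Notation leb2 := (@leb2 R).
Implicit Types (n : nat) (c : R) (z : R * R).

(** The step [c / n.+1] is the one that the substitution [z = n.+1 (x - y)] produces in an integral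
    against the Fejer kernel of scale [n.+1]. *)
Definition shift1 c n (t : R) : R := t - c / n.+1%:R.

Definition shift2 z n (x : R * R) : R * R := (shift1 z.1 n x.1, shift1 z.2 n x.2).

Lemma rescales_shift1 c n : rescales lambda (shift1 c n) 1.
Proof.
have := @rescales_affine R 1 (- (c / n.+1%:R)) (oner_neq0 _).
by rewrite normr1 invr1; congr rescales; apply/funext => t; rewrite mul1r.
Qed.

Lemma rescales_shift2 z n : rescales leb2 (shift2 z n) 1.
Proof.
have := @rescales_upper R 1 0 (- (z.1 / n.+1%:R)) 1 (- (z.2 / n.+1%:R))
  (oner_neq0 _) (oner_neq0 _).
rewrite mul1r normr1 invr1; congr rescales; apply/funext => x.
by rewrite !mul1r mul0r addr0.
Qed.

Lemma cvg_shift1 c t : shift1 c ^~ t @ \oo --> t.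
Proof.
rewrite -[X in _ --> X]subr0; apply: cvgB; first exact: cvg_cst.
rewrite -[X in _ --> X](mulr0 c); apply: cvgM; first exact: cvg_cst.
exact: cvg_harmonic.
Qed.

(** A point of [U] stays in [U] under small shifts, so [1_U (1 - 1_U o tau)] tends to [0]
    everywhere. Pointwise convergence may fail for [(1 - 1_U) 1_U o tau] at boundary points; but
    [tau] preserves the measure of [U], so both functions have the same integral, and the
    oscillation is the sum of the two. *)
Lemma vanishing_osc_open c (U : set R) : open U -> (lambda U < +oo)%E ->
  vanishing_osc lambda (shift1 c) \1_U.
Proof.
move=> oU Uoo.
have mU : measurable U by exact: open_measurable.
have mi : measurable_fun setT (\1_U : R -> R) by exact: measurable_indic.
have iU : lambda.-integrable setT (EFin \o \1_U) by exact: integrable_indic_lty.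
have msi n : measurable_fun setT (fun t => \1_U (shift1 c n t) : R).
  by have [_ ms _] := rescales_shift1 c n; exact: (measurableT_comp mi ms).
pose F n t := \1_U t * (1 - \1_U (shift1 c n t)) : R.
have mF n : measurable_fun setT (F n).
  by apply: measurable_funM => //; exact: measurable_funB.
have i01 : forall t : R, (0 : R) <= (\1_U t : R) <= (1 : R) by move=> t; rewrite indicE ler0n lern1; case: (_ \in _).
have F0 n t : 0 <= F n t <= \1_U t.
  have /andP[a b] := i01 t; have /andP[a' b'] := i01 (shift1 c n t).
  by rewrite /F mulr_ge0 ?subr_ge0//= ler_piMr// gerBl.
have cF : {ae lambda, forall t, F ^~ t @ \oo --> (0 : R)}.
  apply: aeW => t; have [Ut|Ut] := pselect (U t); last first.
    rewrite (_ : F ^~ t = cst 0); first exact: cvg_cst.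
    by apply/funext => n; rewrite /F indicE memNset// mul0r.
  apply: cvg_near_cst.
  have := @cvg_shift1 c t _ (open_nbhs_nbhs (conj oU Ut)).
  move=> [N _ hN]; exists N => // n /hN Un /=.
  by rewrite /F [in X in _ * X]indicE mem_set// subrr mulr0.
have FE n : osc lambda (shift1 c) n \1_U = (2%:E * \int[lambda]_t (F n t)%:E)%E.
  have h1 : (\int[lambda]_t (\1_U (shift1 c n t))%:E = \int[lambda]_t (\1_U t)%:E :> \bar R)%E.
    have [_ _ sE] := rescales_shift1 c n.
    rewrite (sE (fun t => (\1_U t)%:E)) ?mul1e//.
    exact/measurable_EFinP.
  have h2 : (osc lambda (shift1 c) n \1_U + \int[lambda]_t (\1_U t)%:E =
     2%:E * \int[lambda]_t (F n t)%:E + \int[lambda]_t (\1_U (shift1 c n t))%:E)%E.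
    rewrite -ge0_integralZl//; last 2 first.
    - by apply/measurable_EFinP; exact: mF.
    - by move=> t _; rewrite lee_fin; have /andP[] := F0 n t.
    have mE (f : R -> R) : measurable_fun setT f -> measurable_fun setT (fun t => (f t)%:E).
      by move=> mf; apply/measurable_EFinP.
    have mO : measurable_fun setT (fun t => ((\1_U t - \1_U (shift1 c n t) : R) ^+ 2)%:E).
      by apply: measurable_sqr; exact: measurable_funB.
    have mF2 : measurable_fun setT (fun t => (2%:E * (F n t)%:E)%E).
      by apply: measurable_funeM; exact: mE.
    rewrite /osc -[LHS]ge0_integralD//; last 2 first.
    - by move=> t _; rewrite lee_fin sqr_ge0.
    - exact: mE.
    rewrite -[RHS]ge0_integralD//; last 2 first.
    - by move=> t _; rewrite -EFinM lee_fin mulr_ge0//; have /andP[] := F0 n t.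
    - exact: mE.
    apply: eq_integral => t _; rewrite -EFinM -!EFinD; congr (_%:E).
    by rewrite /F !indicE; case: (t \in U); case: (shift1 c n t \in U) => /=; ring.
  have fU : (\int[lambda]_t (\1_U t)%:E \is a fin_num)%E by exact: integrable_fin_num iU.
  by move: h2; rewrite h1 => /(congr1 (fun e => e - \int[lambda]_t (\1_U t)%:E)%E); rewrite !addeK.
have := @cvg_integral_dominated0 _ _ _ lambda F \1_U mF F0 iU cF.
have I0 n : (0 <= \int[lambda]_t (F n t)%:E)%E.
  by apply: integral_ge0 => t _; rewrite lee_fin; have /andP[] := F0 n t.
move=> /(cvge0P I0).1 cv e e0.
have [N FN] := cv (e / 2) (divr_gt0 e0 (ltr0Sn _ 1)); exists N => n /FN FNn.
rewrite FE (@le_trans _ _ (2%:E * (e / 2)%:E)%E)//; first exact: lee_wpmul2l.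
by rewrite -EFinM lee_fin mulrC divfK.
Qed.

Lemma sqr_indicB (T : Type) (A B : set T) (x : T) :
  A `<=` B -> (\1_A x - \1_B x : R) ^+ 2 = \1_(B `\` A) x.
Proof.
move=> AB; rewrite !indicE in_setD.
have [xA|xA] := boolP (x \in A).
  by rewrite (mem_set (AB _ (set_mem xA))) subrr expr0n.
by rewrite sub0r sqrrN; case: (x \in B); rewrite ?expr1n ?expr0n.
Qed.

(** Outer regularity: [E] lies in an open set of finite measure that exceeds it by at most [e], and
    the squared distance of the indicators is the measure of the difference. *)
Lemma vanishing_osc_set c (E : set R) : measurable E -> (lambda E < +oo)%E ->
  vanishing_osc lambda (shift1 c) \1_E.
Proof.
move=> mE Eoo; apply: vanishing_osc_closed.
- by move=> n; exact: rescales_shift1.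
- exact: measurable_indic.
move=> e e0; have [U [oU EU UE]] := lebesgue_regularity_outer mE Eoo e0.
have mU : measurable U by exact: open_measurable.
exists \1_U; split; first exact: measurable_indic.
  apply: vanishing_osc_open => //.
  rewrite -(setDUK EU) (le_lt_trans (measureU2 _ _ _))//; last first.
    by rewrite lte_add_pinfty// (lt_le_trans UE)// leey.
  exact: measurableD.
rewrite (_ : (fun x => _) = (fun x => (\1_(U `\` E) x)%:E)); last first.
  by apply/funext => x; rewrite sqr_indicB.
rewrite integral_indic ?setIT//; last exact: measurableD.
exact: ltW.
Qed.

Let lebesgue2_rect (A B : set R) : measurable A -> measurable B ->
  leb2 (A `*` B) = (lambda A * lambda B)%E.
Proof. by move=> mA mB; exact: product_measure1E. Qed.

(** With primes for shifted sets, [1_A 1_B - 1_A' 1_B' = (1_A - 1_A') 1_B + 1_A' (1_B - 1_B')], and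
    the integral of the square of each term factors by Tonelli. *)
Lemma vanishing_osc_rect z (A B : set R) : measurable A -> measurable B ->
  (lambda A < +oo)%E -> (lambda B < +oo)%E ->
  vanishing_osc leb2 (shift2 z) \1_(A `*` B).
Proof.
move=> mA mB Aoo Boo e e0.
have fA : fine (lambda A) \is Num.nneg by rewrite nnegrE fine_ge0.
have mi (E : set R) : measurable E -> measurable_fun setT (\1_E : R -> R).
  by move=> mE; exact: measurable_indic.
have osc_le n : (osc leb2 (shift2 z) n \1_(A `*` B) <=
    2%:E * (osc lambda (shift1 z.1) n \1_A * lambda B) +
    2%:E * (lambda A * osc lambda (shift1 z.2) n \1_B))%E.
  pose a t : R := \1_A t - \1_A (shift1 z.1 n t).
  pose b t : R := \1_B t - \1_B (shift1 z.2 n t).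
  pose F (x : R * R) : R := a x.1 * \1_B x.2.
  pose G (x : R * R) : R := \1_A (shift1 z.1 n x.1) * b x.2.
  have ms1 c : measurable_fun setT (shift1 c n) by have [] := rescales_shift1 c n.
  have ma : measurable_fun setT a.
    by apply: measurable_funB; [exact: mi|exact: (measurableT_comp (mi _ mA) (ms1 _))].
  have mb : measurable_fun setT b.
    by apply: measurable_funB; [exact: mi|exact: (measurableT_comp (mi _ mB) (ms1 _))].
  have mF : measurable_fun setT F.
    apply: measurable_funM; first exact: (measurableT_comp ma).
    exact: (measurableT_comp (mi _ mB)).
  have mG : measurable_fun setT G.
    apply: measurable_funM; last exact: (measurableT_comp mb).
    by apply: (measurableT_comp (mi _ mA)); exact: (measurableT_comp (ms1 _)).
  rewrite /osc (_ : (fun x => _) = (fun x => ((F x + G x) ^+ 2)%:E)); last first.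
    apply/funext => x; congr (_%:E); congr (_ ^+ 2).
    rewrite /F /G /a /b !indicE !in_setX/=.
    by rewrite -!mulnb !natrM; ring.
  apply: le_trans (integral_sqrD2 leb2 mF mG) _.
  apply: leeD; apply: lee_wpmul2l => //.
    rewrite leb2_tonelli1; last 2 first.
    - exact: measurable_sqr.
    - by move=> x; rewrite lee_fin sqr_ge0.
    rewrite -ge0_integralZr//; last 2 first.
    - exact: measurable_sqr.
    - by move=> x _; rewrite lee_fin sqr_ge0.
    rewrite le_eqVlt; apply/orP; left; apply/eqP; apply: eq_integral => t _.
    rewrite -(setIT B) -[X in (_ * X)%E]integral_indic// -ge0_integralZl//; last 2 first.
    - by apply/measurable_EFinP; exact: mi.
    - by rewrite lee_fin sqr_ge0.
    apply: eq_integral => y _; rewrite /F/= -EFinM exprMn; congr (_ * _)%:E.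
    by rewrite indicE; case: (_ \in _); rewrite ?expr1n ?expr0n.
  rewrite leb2_tonelli2; last 2 first.
  - exact: measurable_sqr.
  - by move=> x; rewrite lee_fin sqr_ge0.
  rewrite -ge0_integralZl//; last 2 first.
  - exact: measurable_sqr.
  - by move=> x _; rewrite lee_fin sqr_ge0.
  rewrite le_eqVlt; apply/orP; left; apply/eqP; apply: eq_integral => t _.
  have [_ _ sE] := rescales_shift1 z.1 n.
  have miA : measurable_fun setT (fun t => (\1_A t)%:E : \bar R).
    by apply/measurable_EFinP; exact: mi.
  have -> : lambda A = (\int[lambda]_y (\1_A (shift1 z.1 n y))%:E)%E.
    rewrite (sE (fun t => (\1_A t)%:E))// mul1e.
    by rewrite integral_indic// setIT.
  rewrite -ge0_integralZr//; last 2 first.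
  - exact: (measurableT_comp miA (ms1 _)).
  - by rewrite lee_fin sqr_ge0.
  apply: eq_integral => y _; rewrite /G/= -EFinM exprMn; congr (_ * _)%:E.
  by rewrite indicE; case: (_ \in _); rewrite ?expr1n ?expr0n.
(* [M] dominates both measures; adding [1] keeps it positive when they vanish. *)
pose M := fine (lambda A) + fine (lambda B) + 1.
have M0 : 0 < M by rewrite ltr_wpDl// addr_ge0// fine_ge0.
have e10 : 0 < e / (4 * M) by rewrite divr_gt0// mulr_gt0.
have [N1 h1] := vanishing_osc_set z.1 mA Aoo e10.
have [N2 h2] := vanishing_osc_set z.2 mB Boo e10.
exists (maxn N1 N2) => n; rewrite geq_max => /andP[/h1 {}h1 /h2 {}h2].
apply: le_trans (osc_le n) _.
apply: (@le_trans _ _ (2%:E * ((e / (4 * M))%:E * M%:E) + 2%:E * (M%:E * (e / (4 * M))%:E))%E).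
  apply: leeD; apply: lee_wpmul2l => //; apply: lee_pmul => //.
  - by apply: integral_ge0 => x _; rewrite lee_fin sqr_ge0.
  - by rewrite -(@fineK _ (lambda B)) ?ge0_fin_numE// lee_fin /M; have := fine_ge0 (measure_ge0 lambda A); lra.
  - by apply: integral_ge0 => x _; rewrite lee_fin sqr_ge0.
  - by rewrite -(@fineK _ (lambda A)) ?ge0_fin_numE// lee_fin /M; have := fine_ge0 (measure_ge0 lambda B); lra.
rewrite -!EFinM -EFinD lee_fin le_eqVlt; apply/orP; left; apply/eqP.
by field; rewrite gt_eqF.
Qed.

Definition box (k : nat) : set (R * R) :=
  [set x | `|x.1| <= k%:R /\ `|x.2| <= k%:R].

Lemma in_box k x : (x \in box k) = (`|x.1| <= k%:R) && (`|x.2| <= k%:R).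
Proof. by apply/idP/andP; rewrite inE. Qed.

Lemma boxE k : box k = `[- k%:R, k%:R] `*` `[- k%:R, k%:R].
Proof.
by apply/seteqP; split => -[a b] /=; rewrite !in_itv/= -!ler_norml.
Qed.

Lemma measurable_box k : measurable (box k).
Proof. by rewrite boxE; apply: measurableX. Qed.

#[local] Hint Resolve measurable_box : core.

Lemma box_lty k : (leb2 (box k) < +oo)%E.
Proof.
rewrite boxE lebesgue2_rect// lebesgue_measure_itv/=.
by case: ifPn => _; rewrite ?mule0 ?ltry// -EFinD -EFinM ltry.
Qed.

#[local] Hint Resolve box_lty : core.

(** Rectangles are stable under intersection and generate the measurable sets, so the pi-lambda
    theorem applies. Intersecting with a box keeps all measures finite: complements become
    differences from the indicator of the box, and disjoint unions are limits dominated by it. *)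
Lemma vanishing_osc_box z k (A : set (R * R)) : measurable A ->
  vanishing_osc leb2 (shift2 z) \1_(A `&` box k).
Proof.
move=> mA.
pose G := [set C | exists2 B1, measurable B1 & exists2 B2 : set R, measurable B2 &
  C = B1 `*` B2] : set (set (R * R)).
have rP := rescales_shift2 z.
have mI (B : set (R * R)) : measurable B -> measurable_fun setT (\1_B : R * R -> R).
  by move=> mB; exact: measurable_indic.
have mEG : measurable = <<s G >>.
  rewrite measurable_prod_measurableType; congr (<<s _ >>).
  apply/seteqP; split => [C [B1 mB1 [B2 mB2 <-]]|C [B1 mB1 [B2 mB2 ->]]].
    by exists B1 => //; exists B2.
  by exists B1 => //; exists B2.
have itv_fin (B : set R) : measurable B ->
    (lambda (B `&` `[(- k%:R)%R, (k%:R)%R]%classic) < +oo)%E.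
  move=> mB; apply: (@le_lt_trans _ _ (lambda `[(- k%:R)%R, (k%:R)%R]%classic)).
    by apply: le_measure; rewrite ?inE//; exact: measurableI.
  by rewrite lebesgue_measure_itv/=; case: ifPn => // _; rewrite -EFinD ltry.
have GP : G `<=` [set B | vanishing_osc leb2 (shift2 z) \1_(B `&` box k)].
  move=> C [B1 mB1 [B2 mB2 ->]] /=; rewrite boxE -setXI.
  by apply: vanishing_osc_rect; rewrite ?itv_fin//; exact: measurableI.
have TP : vanishing_osc leb2 (shift2 z) \1_(setT `&` box k).
  by apply: GP; exists setT => //; exists setT => //; rewrite setXTT.
apply: (@dynkin_induction _ _ G
  [set B | vanishing_osc leb2 (shift2 z) \1_(B `&` box k)]) => //=.
- move=> _ _ [X1 mX1 [X2 mX2 ->]] [Y1 mY1 [Y2 mY2 ->]].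
  rewrite -setXI; exists (X1 `&` Y1); first exact: measurableI.
  by exists (X2 `&` Y2) => //; exact: measurableI.
- move=> S mS vS.
  rewrite (_ : \1_(~` S `&` box k) =
      (fun x => \1_(setT `&` box k) x + -1 * \1_(S `&` box k) x)); last first.
    apply/funext => x; rewrite !indicE !in_setI in_setC in_setT/=.
    by case: (x \in S); case: (x \in box k) => /=; ring.
  have mSb : measurable (S `&` box k) by exact: measurableI.
  apply: vanishing_oscD => //; first by apply: mI; exact: measurableI.
    by apply: measurable_funM => //; exact: mI.
  by apply: vanishing_oscZ => //; exact: mI.
- move=> F mF tF vF.
  have mFk n : measurable (F n `&` box k) by exact: measurableI.
  pose H m x : R := \sum_(i <- iota 0 m) 1 * \1_(F i `&` box k) x.
  have HE m x : H m x = \1_((\big[setU/set0]_(i < m) F i) `&` box k) x.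
    rewrite /H; elim: m => [|m ih].
      by rewrite big_nil big_ord0 set0I indicE in_set0.
    rewrite -addn1 iotaD big_cat/= big_seq1 ih mul1r addn1 big_ord_recr/= setIUl.
    rewrite [in RHS]indicE in_setU !indicE.
    have dis : ~ (x \in \big[setU/set0]_(i < m) F i `&` box k /\ x \in F m `&` box k).
      rewrite !inE => -[[]]; rewrite -bigcup_mkord => -[i /= im Fi _] [Fm _].
      have := tF i m Logic.I Logic.I (ex_intro _ x (conj Fi Fm)).
      by move=> iE; rewrite iE ltnn in im.
    move: dis; case: (x \in _) => /=; case: (x \in _) => /=; rewrite ?addr0 ?add0r//.
    by move=> h; exfalso; exact: h.
  have bU : measurable (\bigcup_n F n `&` box k).
    by apply: measurableI => //; exact: bigcupT_measurable.
  apply: (@vanishing_osc_cvg _ _ _ leb2 (shift2 z) rP _ H \1_(box k)).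
  + exact: mI.
  + move=> m; rewrite (_ : H m = \1_((\big[setU/set0]_(i < m) F i) `&` box k)).
      by apply: mI; apply: measurableI => //; exact: bigsetU_measurable.
    by apply/funext => x; exact: HE.
  + by move=> m; apply: vanishing_osc_sum => // i; exact: mI.
  + exact: (@integrable_indic_lty _ _ R leb2 _ (measurable_box k) (box_lty k)).
  + move=> m x; rewrite HE -sqrrN opprB sqr_indicB; last first.
      by apply: setSI; exact: bigsetU_bigcup.
    by rewrite !indicE ler_nat in_setD in_setI; case: (x \in box k); rewrite ?andbF// leq_b1.
  + move=> x; apply: cvg_near_cst.
    have [[[n _ Fnx] bx]|nx] := pselect ((\bigcup_n F n `&` box k) x).
      exists n.+1 => // m /= nm; rewrite HE !indicE !mem_set//.
        by split => //; exists n.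
      by split => //; rewrite -bigcup_mkord; exists n.
    exists 0%N => // m _; rewrite HE !indicE !memNset// => -[].
    by rewrite -bigcup_mkord => -[n _ Fnx] bx; apply: nx; split => //; exists n.
- by rewrite -mEG.
Qed.

Import HBNNSimple.

(** Increasing simple functions, cut off to growing boxes so that the pieces of their level sets
    have finite measure, stay between [0] and [f]; thus [f^2] dominates the squared errors. *)
Lemma vanishing_osc_ge0 z (f : R * R -> R) : measurable_fun setT f ->
  (forall x, 0 <= f x) -> (\int[leb2]_x (f x ^+ 2)%:E < +oo)%E ->
  vanishing_osc leb2 (shift2 z) f.
Proof.
move=> mf f0 f2.
have rP := rescales_shift2 z.
have mF : measurable_fun setT (EFin \o f) by exact/measurable_EFinP.
pose h := nnsfun_approx measurableT mF.
have h0 n x : 0 <= h n x by [].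
have hcvg x : h ^~ x @ \oo --> f x.
  have := @cvg_nnsfun_approx _ _ _ _ measurableT _ mF (fun x _ => f0 x) x Logic.I.
  by move=> /fine_cvgP[].
have hf n x : h n x <= f x.
  rewrite -lee_fin /h nnsfun_approxE.
  by apply: (@le_approx _ _ _ setT (EFin \o f)) => // y _; exact: f0.
pose g n x : R := h n x * \1_(box n) x.
apply: (@vanishing_osc_cvg _ _ _ leb2 (shift2 z) rP _ g (fun x => f x ^+ 2)) => //.
- move=> n; apply: measurable_funM; first exact: (measurable_funP (h n)).
  by apply: measurable_indic; exact: measurable_box.
- move=> n.
  rewrite (_ : g n = fun x => \sum_(r <- finmap.enum_fset (fset_set (range (h n))))
      r * \1_(h n @^-1` [set r] `&` box n) x); last first.
    apply/funext => x; rewrite /g fimfunE fsbig_finite//= big_distrl/=.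
    by apply: eq_bigr => r _; rewrite -mulrA indicI.
  have mhr r : measurable (h n @^-1` [set r]).
    by rewrite -[X in measurable X]setTI; exact: (measurable_funP (h n)).
  apply: vanishing_osc_sum => // r; last exact: vanishing_osc_box.
  by apply: measurable_indic; exact: (measurableI _ _ (mhr r) (measurable_box n)).
- apply/integrableP; split; first by apply: measurable_sqr.
  by under eq_integral do rewrite /= ger0_norm ?sqr_ge0//.
- move=> n x; rewrite ler_sqr ?nnegrE ?subr_ge0//.
  + by rewrite gerBl mulr_ge0.
  + by rewrite /g indicE; case: (_ \in _); rewrite ?mulr1// mulr0.
- move=> x; have [k kx] : exists k : nat, `|x.1| <= k%:R /\ `|x.2| <= k%:R.
    exists (Num.truncn (`|x.1| + `|x.2|)).+1.
    have := truncnS_gt (`|x.1| + `|x.2|).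
    have := normr_ge0 x.1; have := normr_ge0 x.2; lra.
  have : h n x @[n --> \oo] --> f x by exact: hcvg.
  apply: cvg_trans; apply: near_eq_cvg; exists k => // n /= kn.
  rewrite /g indicE mem_set ?mulr1//.
  by case: kx => k1 k2; split; [apply: le_trans k1 _|apply: le_trans k2 _]; rewrite ler_nat.
Qed.

Lemma translation_continuity z (f : R * R -> R) : measurable_fun setT f ->
  (\int[leb2]_x (f x ^+ 2)%:E < +oo)%E -> vanishing_osc leb2 (shift2 z) f.
Proof.
move=> mf f2; have rP := rescales_shift2 z.
pose p x := (`|f x| + f x) / 2; pose n x := (`|f x| - f x) / 2.
have mf' : measurable_fun setT (fun x => `|f x|) by exact: measurableT_comp.
have mp : measurable_fun setT p.
  by apply: measurable_funM => //; exact: measurable_funD.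
have mn : measurable_fun setT n.
  by apply: measurable_funM => //; exact: measurable_funB.
rewrite (_ : f = fun x => p x + -1 * n x); last first.
  by apply/funext => x; rewrite /p /n; field.
have fin (g : R * R -> R) : measurable_fun setT g ->
    (forall x, g x ^+ 2 <= f x ^+ 2) -> (\int[leb2]_x (g x ^+ 2)%:E < +oo)%E.
  move=> mg gf; apply: le_lt_trans f2; apply: ge0_le_integral => //.
  - by move=> x _; rewrite lee_fin sqr_ge0.
  - exact: measurable_sqr.
  - exact: measurable_sqr.
  - by move=> x _; rewrite lee_fin.
apply: vanishing_oscD => //.
- exact: measurable_funM.
- apply: vanishing_osc_ge0 => //.
    by move=> x; rewrite /p; have := ler_norm (- f x); rewrite normrN; lra.
  apply: fin => // x; rewrite /p -(real_normK (num_real (f x))).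
  have := ler_norm (f x); have := ler_norm (- f x); rewrite normrN.
  have := normr_ge0 (f x); nra.
- apply: vanishing_oscZ => //; apply: vanishing_osc_ge0 => //.
    by move=> x; rewrite /n; have := ler_norm (f x); lra.
  apply: fin => // x; rewrite /n -(real_normK (num_real (f x))).
  have := ler_norm (f x); have := ler_norm (- f x); rewrite normrN.
  have := normr_ge0 (f x); nra.
Qed.

End translation_continuity.

(** * Plancherel's identity for real functions *)

Section integrable_real.
Context d (T : measurableType d) (R : realType) (mu : {measure set T -> \bar R}).
Implicit Types f g : T -> R.

Lemma integrableD_EFin f g : mu.-integrable setT (EFin \o f) ->
  mu.-integrable setT (EFin \o g) ->
  mu.-integrable setT (EFin \o (fun x => f x + g x)).
Proof. by move=> if_ ig; exact: integrableD if_ ig. Qed.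

Lemma integrableB_EFin f g : mu.-integrable setT (EFin \o f) ->
  mu.-integrable setT (EFin \o g) ->
  mu.-integrable setT (EFin \o (fun x => f x - g x)).
Proof. by move=> if_ ig; exact: integrableB if_ ig. Qed.

Lemma integrableZl_EFin (c : R) f : mu.-integrable setT (EFin \o f) ->
  mu.-integrable setT (EFin \o (fun x => c * f x)).
Proof. by move=> if_; exact: (integrableZl measurableT c if_). Qed.

End integrable_real.

Section plancherel_real.
Context (R : realType).
Notation leb2 := (@leb2 R).
Implicit Types (x y z w : R * R) (n : R) (m : nat).

Definition sub2 x y : R * R := (x.1 - y.1, x.2 - y.2).

Lemma phaseB x y w : phase (sub2 x y) w = phase x w - phase y w.
Proof. by rewrite /phase /sub2/=; ring. Qed.

Lemma measurable_sub2 :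
  measurable_fun setT (fun z : (R * R) * (R * R) => sub2 z.1 z.2).
Proof.
have m1 : measurable_fun setT (fun z : (R * R) * (R * R) => z.1) by exact: measurable_fst.
have m2 : measurable_fun setT (fun z : (R * R) * (R * R) => z.2) by exact: measurable_snd.
by apply: measurable_fun_pair; apply: measurable_funB;
  exact: (measurableT_comp _ m1) || exact: (measurableT_comp _ m2).
Qed.

Lemma rescales_sub2 n x : n != 0 ->
  rescales leb2 (fun y => (n * (sub2 x y).1, n * (sub2 x y).2)) (n ^+ 2)^-1.
Proof.
move=> n0; have nn : - n != 0 by rewrite oppr_eq0.
have := @rescales_upper R (- n) 0 (n * x.1) (- n) (n * x.2) nn nn.
rewrite mulrNN normrM -expr2 real_normK ?num_real//; congr rescales.
by apply/funext => y; rewrite /sub2/=; congr (_, _); ring.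
Qed.

(** The substitution [y |-> n (x - y)] has Jacobian [n^2], which cancels the factor in
    [fejer2 n]. *)
Lemma integral_fejer2_sub n x : 0 < n ->
  (\int[leb2]_y (fejer2 n (sub2 x y))%:E = (fejer_mass R ^+ 2)%:E)%E.
Proof.
move=> n0; have [_ _ sE] := rescales_sub2 x (lt0r_neq0 n0).
have mf1 : measurable_fun setT (fun y => (fejer2 1 y)%:E : \bar R).
  by apply/measurable_EFinP; exact: measurable_fejer2.
have e : (fun y => (fejer2 n (sub2 x y))%:E) = (fun y => (n ^+ 2)%:E *
     (fejer2 1 (n * (sub2 x y).1, n * (sub2 x y).2))%:E)%E.
  by apply/funext => y; rewrite -EFinM /fejer2 expr1n !mul1r.
have [_ ms _] := rescales_sub2 x (lt0r_neq0 n0).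
rewrite e ge0_integralZl//; last 3 first.
- exact: (measurableT_comp mf1 ms).
- by move=> y _; rewrite lee_fin fejer2_ge0.
- by rewrite lee_fin sqr_ge0.
rewrite (sE (fun y => (fejer2 1 y)%:E))//; last by move=> y; rewrite lee_fin fejer2_ge0.
by rewrite muleA -EFinM mulfV ?mul1e ?integral_fejer2// expf_neq0// gt_eqF.
Qed.

Lemma fejer2N n z : fejer2 n (- z.1, - z.2) = fejer2 n z.
Proof.
have fN (t : R) : fejer (- t) = fejer t.
  by rewrite /fejer; congr Rintegral; apply/funext => s; rewrite mulrN mulNr cosN.
by rewrite /fejer2/= !mulrN !fN.
Qed.

Lemma fejer2_sub_sym n x y : fejer2 n (sub2 x y) = fejer2 n (sub2 y x).
Proof. by rewrite -fejer2N /sub2/= !opprB. Qed.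

Lemma leb4_tonelli1 (F : (R * R) * (R * R) -> \bar R) :
  measurable_fun setT F -> (forall p, 0 <= F p)%E ->
  (\int[(leb2 \x leb2)%E]_p F p = \int[leb2]_x \int[leb2]_y F (x, y))%E.
Proof. exact: (@fubini_tonelli1 _ _ _ _ _ leb2 leb2). Qed.

Lemma leb4_tonelli2 (F : (R * R) * (R * R) -> \bar R) :
  measurable_fun setT F -> (forall p, 0 <= F p)%E ->
  (\int[(leb2 \x leb2)%E]_p F p = \int[leb2]_y \int[leb2]_x F (x, y))%E.
Proof. exact: (@fubini_tonelli2 _ _ _ _ _ leb2 leb2). Qed.

Variable g : R * R -> R.
Hypotheses (mg : measurable_fun setT g)
  (ig : leb2.-integrable setT (EFin \o g))
  (g2 : (\int[leb2]_x (g x ^+ 2)%:E < +oo)%E).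

Definition cos_transform w := Rintegral leb2 setT (fun x => g x * cos (phase x w)).
Definition sin_transform w := Rintegral leb2 setT (fun x => g x * sin (phase x w)).

Let C := cos_transform.
Let S := sin_transform.
Let G := Rintegral leb2 setT (fun x => `|g x|).
Let K := fejer_mass R ^+ 2.
Let N := Rintegral leb2 setT (fun x => g x ^+ 2).

Let G0 : 0 <= G. Proof. by apply: Rintegral_ge0. Qed.

Let ng : leb2.-integrable setT (EFin \o (fun x => `|g x|)).
Proof. exact: integrable_norm. Qed.

Let mgcos : measurable_fun setT (fun z : (R * R) * (R * R) => g z.1 * cos (phase z.1 z.2)).
Proof.
apply: measurable_funM; last exact: measurable_cos_phase.
exact: (measurableT_comp mg measurable_fst).
Qed.

Let mgsin : measurable_fun setT (fun z : (R * R) * (R * R) => g z.1 * sin (phase z.1 z.2)).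
Proof.
apply: measurable_funM; last exact: measurable_sin_phase.
exact: (measurableT_comp mg measurable_fst).
Qed.

Let igcos w : leb2.-integrable setT (EFin \o (fun x => g x * cos (phase x w))).
Proof.
apply: (integrable_le _ ng).
  exact: (measurableT_comp mgcos (measurable_fun_pair (@measurable_id _ _ setT)
    (@measurable_cst _ _ _ _ setT w))).
by move=> x; rewrite normrM ler_piMr// cos_max.
Qed.

Let igsin w : leb2.-integrable setT (EFin \o (fun x => g x * sin (phase x w))).
Proof.
apply: (integrable_le _ ng).
  exact: (measurableT_comp mgsin (measurable_fun_pair (@measurable_id _ _ setT)
    (@measurable_cst _ _ _ _ setT w))).
by move=> x; rewrite normrM ler_piMr// sin_max.
Qed.

Lemma measurable_cos_transform : measurable_fun setT C.
Proof. exact: (measurable_Rintegral2 leb2 mgcos). Qed.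

Lemma measurable_sin_transform : measurable_fun setT S.
Proof. exact: (measurable_Rintegral2 leb2 mgsin). Qed.

Let C_le w : `|C w| <= G.
Proof.
apply: (le_trans (le_normr_Rintegral _ (igcos w))) => //.
apply: le_Rintegral => //; first exact: integrable_norm.
by move=> x _; rewrite normrM ler_piMr// cos_max.
Qed.

Let S_le w : `|S w| <= G.
Proof.
apply: (le_trans (le_normr_Rintegral _ (igsin w))) => //.
apply: le_Rintegral => //; first exact: integrable_norm.
by move=> x _; rewrite normrM ler_piMr// sin_max.
Qed.

Let mtri2 n : 0 < n -> measurable_fun setT (@tri2 R n).
Proof.
by move=> n0; apply/measurable_EFinP; exact: measurable_int (integrable_tri2 n0).
Qed.

Let integrable_energy n : 0 < n ->
  leb2.-integrable setT (EFin \o (fun w => tri2 n w * (C w ^+ 2 + S w ^+ 2))).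
Proof.
move=> n0.
have it : leb2.-integrable setT (EFin \o (fun w => (G ^+ 2 + G ^+ 2) * tri2 n w)).
  by apply: integrableZl_EFin; exact: integrable_tri2.
apply: (integrable_le _ it).
  apply: measurable_funM; first exact: mtri2.
  by apply: measurable_funD; apply: measurable_funX;
    [exact: measurable_cos_transform|exact: measurable_sin_transform].
move=> w; rewrite ger0_norm ?mulr_ge0 ?tri2_ge0 ?addr_ge0 ?sqr_ge0 ?tri_ge0//.
rewrite [leRHS]mulrC ler_wpM2l ?tri2_ge0// lerD//.
  by rewrite -(real_normK (num_real (C w))) ler_sqr ?nnegrE.
by rewrite -(real_normK (num_real (S w))) ler_sqr ?nnegrE.
Qed.

Let P n (z : (R * R) * (R * R)) := g z.1 * g z.2 * fejer2 n (sub2 z.1 z.2).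

Let mfejer_sub n : measurable_fun setT
  (fun z : (R * R) * (R * R) => fejer2 n (sub2 z.1 z.2)).
Proof. exact: (measurableT_comp (measurable_fejer2 n) measurable_sub2). Qed.

Let mg1 : measurable_fun setT (fun z : (R * R) * (R * R) => g z.1).
Proof. exact: (measurableT_comp mg measurable_fst). Qed.

Let mg2 : measurable_fun setT (fun z : (R * R) * (R * R) => g z.2).
Proof. exact: (measurableT_comp mg measurable_snd). Qed.

Let P_le n x y : 0 < n ->
  `|P n (x, y)| <= `|Rintegral leb2 setT (@tri2 R n) * g x| * `|g y|.
Proof.
move=> n0; rewrite /P/=; have := fejer2_le (sub2 x y) n0.
have := fejer2_ge0 n (sub2 x y); move: (fejer2 n _) => k k0 kle.
rewrite !normrM (ger0_norm k0).
have t0 : 0 <= Rintegral leb2 setT (@tri2 R n).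
  by apply: Rintegral_ge0 => w _; exact: tri2_ge0.
by rewrite (ger0_norm t0) mulrC mulrA ler_wpM2r// ler_wpM2r.
Qed.

Let itg n : leb2.-integrable setT
  (EFin \o (fun x => Rintegral leb2 setT (@tri2 R n) * g x)).
Proof.
exact: integrableZl_EFin.
Qed.

Let mP n : measurable_fun setT (P n).
Proof. by apply: measurable_funM => //; exact: measurable_funM. Qed.

Let integrable_P n : 0 < n -> (leb2 \x leb2)%E.-integrable setT (EFin \o P n).
Proof.
by move=> n0; apply: (@integrable_prod_le _ _ _ _ R leb2 leb2 (P n) _ _ (mP n) (itg n) ig) => x y; exact: P_le.
Qed.

(** The energy [C^2 + S^2] at [w] is a double integral of [g x g y cos (phase (x - y) w)], and
    integrating the cosine against the tent gives [fejer2]. The two factors are unfolded one after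
    the other, so that each exchange involves two variables only. *)
Let energy_kernel n : 0 < n ->
  Rintegral leb2 setT (fun w => tri2 n w * (C w ^+ 2 + S w ^+ 2)) =
  Rintegral (leb2 \x leb2)%E setT (P n).
Proof.
move=> n0.
(* One factor of each square is expanded; the other stays as [C] or [S], bounded by [G]. *)
pose F (z : (R * R) * (R * R)) : R :=
  g z.2 * (tri2 n z.1 * (C z.1 * cos (phase z.2 z.1) + S z.1 * sin (phase z.2 z.1))).
have swap : measurable_fun setT (fun z : (R * R) * (R * R) => (z.2, z.1)).
  by apply: measurable_fun_pair; [exact: measurable_snd|exact: measurable_fst].
have mF : measurable_fun setT F.
  apply: measurable_funM => //; apply: measurable_funM.
    exact: (measurableT_comp (mtri2 n0) measurable_fst).
  apply: measurable_funD; apply: measurable_funM.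
  - exact: (measurableT_comp measurable_cos_transform measurable_fst).
  - exact: (measurableT_comp (@measurable_cos_phase R) swap).
  - exact: (measurableT_comp measurable_sin_transform measurable_fst).
  - exact: (measurableT_comp (@measurable_sin_phase R) swap).
have it2 : leb2.-integrable setT (EFin \o (fun w => (G + G) * tri2 n w)).
  by apply: integrableZl_EFin; exact: integrable_tri2.
have F_le w x : `|F (w, x)| <= `|(G + G) * tri2 n w| * `|g x|.
  rewrite /F/= normrM mulrC ler_wpM2r//; have := tri2_ge0 n w.
  move: (tri2 n w) => k k0; rewrite !normrM (ger0_norm k0) mulrC.
  rewrite ler_wpM2r// (ger0_norm (addr_ge0 G0 G0)).
  apply: le_trans (ler_normD _ _) _; apply: lerD; rewrite normrM.
    by rewrite -[leRHS]mulr1 ler_pM// cos_max.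
  by rewrite -[leRHS]mulr1 ler_pM// sin_max.
transitivity (Rintegral leb2 setT (fun w => Rintegral leb2 setT (fun x => F (w, x)))).
  apply: eq_Rintegral => w _; rewrite /F/=.
  transitivity (tri2 n w * (C w * Rintegral leb2 setT (fun x => g x * cos (phase x w)) +
     S w * Rintegral leb2 setT (fun x => g x * sin (phase x w)))) => //.
  move: (C w) (S w) (tri2 n w) => c1 s1 t1.
  have ic c : leb2.-integrable setT (EFin \o (fun x => c * (g x * cos (phase x w)))).
    exact: integrableZl_EFin.
  have is_ c : leb2.-integrable setT (EFin \o (fun x => c * (g x * sin (phase x w)))).
    exact: integrableZl_EFin.
  rewrite mulrDr !mulrA -!RintegralZl// -RintegralD//.
  by apply: eq_Rintegral => x _; ring.
rewrite (@Rintegral_swap _ _ _ _ R leb2 leb2 F _ _ mF it2 ig F_le).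
rewrite [RHS](@Rintegral_prod12 _ _ _ _ R leb2 leb2 (P n)); last 2 first.
- exact: integrable_P.
- move=> x; apply: (@integrable_le _ _ _ leb2 (fun y => P n (x, y))
    (fun y => `|Rintegral leb2 setT (@tri2 R n) * g x| * `|g y|)).
  + exact: (measurableT_comp (mP n) (measurable_fun_pair (@measurable_cst _ _ _ _ setT x)
      (@measurable_id _ _ setT))).
  + exact: integrableZl_EFin.
  + by move=> y; exact: P_le.
apply: eq_Rintegral => x _.
(* At fixed [x] the remaining factor is expanded, and the addition formula for the cosine merges the
   two phases. *)
pose H (z : (R * R) * (R * R)) : R :=
  g x * (g z.2 * (tri2 n z.1 * cos (phase (sub2 x z.2) z.1))).
have mH : measurable_fun setT H.
  apply: measurable_funM => //; apply: measurable_funM => //; apply: measurable_funM.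
    exact: (measurableT_comp (mtri2 n0) measurable_fst).
  have ms : measurable_fun setT (fun z : (R * R) * (R * R) => (sub2 x z.2, z.1)).
    apply: measurable_fun_pair; last exact: measurable_fst.
    exact: (measurableT_comp measurable_sub2 (measurable_fun_pair
      (@measurable_cst _ _ _ _ setT x) (measurable_snd))).
  exact: (measurableT_comp (@measurable_cos_phase R) ms).
have itx : leb2.-integrable setT (EFin \o (fun w => g x * tri2 n w)).
  by apply: integrableZl_EFin; exact: integrable_tri2.
have H_le w y : `|H (w, y)| <= `|g x * tri2 n w| * `|g y|.
  rewrite /H/=; have := tri2_ge0 n w; move: (tri2 n w) => k k0.
  rewrite !normrM -mulrA ler_wpM2l// mulrC ler_wpM2r//.
  by rewrite ler_piMr// cos_max.
transitivity (Rintegral leb2 setT (fun w => Rintegral leb2 setT (fun y => H (w, y)))).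
  apply: eq_Rintegral => w _; rewrite /F /H/=.
  transitivity (g x * (tri2 n w * (cos (phase x w) * Rintegral leb2 setT (fun y => g y * cos (phase y w)) +
     sin (phase x w) * Rintegral leb2 setT (fun y => g y * sin (phase y w))))).
    by congr (_ * (_ * (_ + _))); rewrite mulrC.
  move: (tri2 n w) => t1.
  have ic c : leb2.-integrable setT (EFin \o (fun x => c * (g x * cos (phase x w)))).
    exact: integrableZl_EFin.
  have is_ c : leb2.-integrable setT (EFin \o (fun x => c * (g x * sin (phase x w)))).
    exact: integrableZl_EFin.
  rewrite !mulrDr !mulrA -!RintegralZl// -RintegralD//.
  by apply: eq_Rintegral => y _; rewrite phaseB cosB; ring.
rewrite (@Rintegral_swap _ _ _ _ R leb2 leb2 H _ _ mH itx ig H_le).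
apply: eq_Rintegral => y _; rewrite /P/= -Rintegral_tri2_cos// -RintegralZl//.
  by apply: eq_Rintegral => w _; rewrite /H/=; ring.
exact: integrable_tri2_cos.
Qed.

Let g2int : leb2.-integrable setT (EFin \o (fun x => g x ^+ 2)).
Proof.
apply/integrableP; split; first exact: (measurable_sqr mg).
by under eq_integral do rewrite /= ger0_norm ?sqr_ge0//.
Qed.

Let N_E : (\int[leb2]_x (g x ^+ 2)%:E = N%:E)%E.
Proof. by rewrite /N /Rintegral fineK//; exact: integrable_fin_num g2int. Qed.

Let K0 : 0 <= K. Proof. exact: sqr_ge0. Qed.

Let N0 : 0 <= N. Proof. by apply: Rintegral_ge0 => x _; exact: sqr_ge0. Qed.

Let A n (z : (R * R) * (R * R)) := g z.1 ^+ 2 * fejer2 n (sub2 z.1 z.2).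
Let B n (z : (R * R) * (R * R)) := g z.2 ^+ 2 * fejer2 n (sub2 z.1 z.2).
Let E n (z : (R * R) * (R * R)) := (g z.1 - g z.2) ^+ 2 * fejer2 n (sub2 z.1 z.2).

Let mA n : measurable_fun setT (A n).
Proof. by apply: measurable_funM => //; exact: measurable_funX. Qed.

Let mB n : measurable_fun setT (B n).
Proof. by apply: measurable_funM => //; exact: measurable_funX. Qed.

Let mE n : measurable_fun setT (E n).
Proof.
by apply: measurable_funM => //; apply: measurable_funX; exact: measurable_funB.
Qed.

Let sqr_fejer_ge0 n (a : R) z : (0 <= (a ^+ 2 * fejer2 n z)%:E)%E.
Proof. by rewrite lee_fin mulr_ge0 ?sqr_ge0 ?fejer2_ge0. Qed.

Let mfejer_subr n x : measurable_fun setT (fun y => (fejer2 n (sub2 x y))%:E : \bar R).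
Proof.
apply/measurable_EFinP.
exact: (measurableT_comp (mfejer_sub n) (measurable_fun_pair
  (@measurable_cst _ _ _ _ setT x) (@measurable_id _ _ setT))).
Qed.

Let integral_A n : 0 < n ->
  (\int[(leb2 \x leb2)%E]_z (A n z)%:E = (K * N)%:E)%E.
Proof.
move=> n0; rewrite (@leb4_tonelli1 (fun p => (A n p)%:E)); last 2 first.
- by apply/measurable_EFinP; exact: mA.
- by move=> z; exact: sqr_fejer_ge0.
transitivity (\int[leb2]_x (K%:E * (g x ^+ 2)%:E))%E.
  apply: eq_integral => x _; rewrite /A/=.
  under eq_integral do rewrite EFinM.
  rewrite ge0_integralZl// ?integral_fejer2_sub// 1?muleC//.
  - exact: mfejer_subr.
  - by move=> y _; rewrite lee_fin fejer2_ge0.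
  - by rewrite lee_fin sqr_ge0.
rewrite ge0_integralZl// ?N_E//.
- exact: measurable_sqr.
- by move=> x _; rewrite lee_fin sqr_ge0.
Qed.

Let integral_B n : 0 < n ->
  (\int[(leb2 \x leb2)%E]_z (B n z)%:E = (K * N)%:E)%E.
Proof.
move=> n0; rewrite (@leb4_tonelli2 (fun p => (B n p)%:E)); last 2 first.
- by apply/measurable_EFinP; exact: mB.
- by move=> z; exact: sqr_fejer_ge0.
transitivity (\int[leb2]_x (K%:E * (g x ^+ 2)%:E))%E.
  apply: eq_integral => x _; rewrite /B/=.
  under eq_integral do rewrite fejer2_sub_sym EFinM.
  rewrite ge0_integralZl// ?integral_fejer2_sub// 1?muleC//.
  - exact: mfejer_subr.
  - by move=> y _; rewrite lee_fin fejer2_ge0.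
  - by rewrite lee_fin sqr_ge0.
rewrite ge0_integralZl// ?N_E//.
- exact: measurable_sqr.
- by move=> x _; rewrite lee_fin sqr_ge0.
Qed.

Let integrable_A n : 0 < n -> (leb2 \x leb2)%E.-integrable setT (EFin \o A n).
Proof.
move=> n0; apply/integrableP; split.
  by apply/measurable_EFinP; exact: mA.
under eq_integral do rewrite gee0_abs ?sqr_fejer_ge0//.
by rewrite integral_A// ltry.
Qed.

Let integrable_B n : 0 < n -> (leb2 \x leb2)%E.-integrable setT (EFin \o B n).
Proof.
move=> n0; apply/integrableP; split.
  by apply/measurable_EFinP; exact: mB.
under eq_integral do rewrite gee0_abs ?sqr_fejer_ge0//.
by rewrite integral_B// ltry.
Qed.

(* From [2 g x g y = g x^2 + g y^2 - (g x - g y)^2]. *)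
Let energy_identity n : 0 < n ->
  Rintegral leb2 setT (fun w => tri2 n w * (C w ^+ 2 + S w ^+ 2)) =
  K * N - 2^-1 * Rintegral (leb2 \x leb2)%E setT (E n).
Proof.
move=> n0; rewrite energy_kernel//.
have iA := integrable_A n0; have iB := integrable_B n0; have iP := integrable_P n0.
have iAB : (leb2 \x leb2)%E.-integrable setT (EFin \o (fun p => A n p + B n p)).
  exact: integrableD iA iB.
have iP2 : (leb2 \x leb2)%E.-integrable setT (EFin \o (fun p => 2 * P n p)).
  exact: integrableZl_EFin.
have -> : Rintegral (leb2 \x leb2)%E setT (E n) =
    Rintegral (leb2 \x leb2)%E setT (fun p => (A n p + B n p) - 2 * P n p).
  by apply: eq_Rintegral => z _; rewrite /E /A /B /P; ring.
rewrite RintegralB// RintegralD// RintegralZl//.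
have -> : Rintegral (leb2 \x leb2)%E setT (A n) = K * N.
  by rewrite /Rintegral integral_A.
have -> : Rintegral (leb2 \x leb2)%E setT (B n) = K * N.
  by rewrite /Rintegral integral_B.
by field.
Qed.

(** The bound depends neither on the translation nor on [m]; multiplied by [fejer2 1] it is the
    integrable majorant for the limit of the error term. *)
Let osc_fin m z : (osc leb2 (shift2 z) m g <= (4 * N)%:E)%E.
Proof.
have [_ ms sE] := rescales_shift2 z m.
have mgs : measurable_fun setT (fun x => - g (shift2 z m x)).
  by apply: measurable_funN; exact: (measurableT_comp mg ms).
apply: le_trans (integral_sqrD2 leb2 mg mgs) _.
under [X in (_ + 2%:E * X)%E]eq_integral do rewrite sqrrN.
rewrite (sE (fun x => (g x ^+ 2)%:E)); last 2 first.
- exact: measurable_sqr.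
- by move=> x; rewrite lee_fin sqr_ge0.
rewrite mul1e N_E -!EFinM -EFinD lee_fin le_eqVlt; apply/orP; left; apply/eqP; ring.
Qed.

Let measurable_shifted m : measurable_fun setT (fun z : (R * R) * (R * R) =>
  ((g z.1 - g (shift2 z.2 m z.1)) ^+ 2)%:E).
Proof.
apply: measurable_sqr; apply: measurable_funB => //.
apply: (measurableT_comp mg).
have m1 : measurable_fun setT (fun z : (R * R) * (R * R) => z.1) by exact: measurable_fst.
have m2 : measurable_fun setT (fun z : (R * R) * (R * R) => z.2) by exact: measurable_snd.
apply: measurable_fun_pair; apply: measurable_funB.
- exact: (measurableT_comp measurable_fst m1).
- by apply: measurable_funM => //; exact: (measurableT_comp measurable_fst m2).
- exact: (measurableT_comp measurable_snd m1).
- by apply: measurable_funM => //; exact: (measurableT_comp measurable_snd m2).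
Qed.

(** For fixed [x] put [z = n (x - y)] with [n = m.+1], that is [y = shift2 z m x]: the Jacobian
    absorbs the [n^2] of [fejer2 n], and the dependence on [n] moves from the kernel to the
    translation. *)
Let integral_E m : (\int[(leb2 \x leb2)%E]_z (E m.+1%:R z)%:E =
  \int[leb2]_z ((fejer2 1 z)%:E * osc leb2 (shift2 z) m g))%E.
Proof.
pose n : R := m.+1%:R; have n0 : 0 < n by rewrite ltr0n.
rewrite (@leb4_tonelli1 (fun p => (E n p)%:E)); last 2 first.
- by apply/measurable_EFinP; exact: mE.
- by move=> z; exact: sqr_fejer_ge0.
pose H (z : (R * R) * (R * R)) : \bar R :=
  ((fejer2 1 z.2)%:E * ((g z.1 - g (shift2 z.2 m z.1)) ^+ 2)%:E)%E.
have mH : measurable_fun setT H.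
  apply: emeasurable_funM; last exact: measurable_shifted.
  by apply/measurable_EFinP; exact: (measurableT_comp (measurable_fejer2 1) measurable_snd).
have H0 p : (0 <= H p)%E.
  by rewrite /H -EFinM lee_fin mulr_ge0 ?sqr_ge0 ?fejer2_ge0.
transitivity (\int[leb2]_x \int[leb2]_z H (x, z))%E.
  apply: eq_integral => x _.
  have [_ ms sE] := rescales_sub2 x (lt0r_neq0 n0).
  have mHx : measurable_fun setT (fun z => H (x, z)).
    exact: (measurableT_comp mH (measurable_fun_pair (@measurable_cst _ _ _ _ setT x)
      (@measurable_id _ _ setT))).
  transitivity (\int[leb2]_y ((n ^+ 2)%:E * H (x, ((n * (sub2 x y).1)%R, (n * (sub2 x y).2)%R))))%E.
    apply: eq_integral => y _; rewrite /H /E/= -!EFinM; congr (_%:E).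
    have -> : shift2 (n * (x.1 - y.1), n * (x.2 - y.2)) m x = y.
      rewrite /shift2 /shift1/= -/n; case: y => y1 y2 /=.
      by congr (_, _); field; rewrite gt_eqF.
    by rewrite /fejer2 expr1n !mul1r; ring.
  rewrite ge0_integralZl//; last 2 first.
  - exact: (measurableT_comp mHx ms).
  - by rewrite lee_fin sqr_ge0.
  rewrite (sE (fun z => H (x, z)))//.
  by rewrite muleA -EFinM mulfV ?mul1e// expf_neq0// gt_eqF.
rewrite -leb4_tonelli1// leb4_tonelli2//; apply: eq_integral => z _.
rewrite /H/= ge0_integralZl//.
- exact: (measurableT_comp (measurable_shifted m) (measurable_fun_pair
    (@measurable_id _ _ setT) (@measurable_cst _ _ _ _ setT z))).
- by move=> x _; rewrite lee_fin sqr_ge0.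
- by rewrite lee_fin fejer2_ge0.
Qed.

(** For each [z] the oscillation tends to [0] by continuity of translations; dominated convergence
    handles the integral over [z]. *)
Let cvg_E : (fun m => \int[(leb2 \x leb2)%E]_z (E m.+1%:R z)%:E)%E @ \oo --> (0 : \bar R)%E.
Proof.
have o0 m z : (0 <= osc leb2 (shift2 z) m g)%E.
  by apply: integral_ge0 => x _; rewrite lee_fin sqr_ge0.
have ofin m z : (osc leb2 (shift2 z) m g)%E \is a fin_num.
  by rewrite ge0_fin_numE// (le_lt_trans (osc_fin _ _))// ltry.
pose F m z := fejer2 1 z * fine (osc leb2 (shift2 z) m g).
have -> : (fun m => \int[(leb2 \x leb2)%E]_z (E m.+1%:R z)%:E)%E =
    (fun m => \int[leb2]_z (F m z)%:E)%E.
  apply/funext => m; rewrite integral_E; apply: eq_integral => z _.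
  transitivity ((fejer2 1 z)%:E * (fine (osc leb2 (shift2 z) m g))%:E)%E.
    by rewrite fineK.
  by rewrite -EFinM.
have mF m : measurable_fun setT (F m).
  apply: measurable_funM; first exact: measurable_fejer2.
  apply: (measurableT_comp (fine_measurable measurableT)).
  apply: (@ge0_measurable_integral2 _ _ _ _ _ leb2 (fun z : (R * R) * (R * R) =>
    ((g z.1 - g (shift2 z.2 m z.1)) ^+ 2)%:E)); first exact: measurable_shifted.
  by move=> z; rewrite lee_fin sqr_ge0.
have if1 : leb2.-integrable setT (EFin \o @fejer2 R 1).
  apply/integrableP; split; first by apply/measurable_EFinP; exact: measurable_fejer2.
  under eq_integral do rewrite gee0_abs ?lee_fin ?fejer2_ge0//.
  by rewrite integral_fejer2 ltry.
have ib : leb2.-integrable setT (EFin \o (fun z => (4 * N) * fejer2 1 z)).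
  exact: integrableZl_EFin.
apply: (@cvg_integral_dominated0 _ _ _ leb2 F _ mF _ ib).
  move=> m z; rewrite /F mulr_ge0 ?fejer2_ge0 ?fine_ge0//= mulrC.
  by rewrite ler_wpM2r ?fejer2_ge0// -lee_fin fineK.
apply: aeW => z; rewrite /F -(mulr0 (fejer2 1 z)); apply: cvgM; first exact: cvg_cst.
apply: fine_cvg; apply/cvge0P => // e e0.
exact: (translation_continuity z mg g2).
Qed.

Let tri2_nd w : {homo (fun m => tri2 m.+1%:R w) : p q / (p <= q)%N >-> p <= q}.
Proof.
have t1 (t : R) : {homo (fun m => tri (t / m.+1%:R)) : p q / (p <= q)%N >-> p <= q}.
  move=> p q pq; rewrite /tri ge_max le_max lexx/= le_max; apply/orP; right.
  rewrite lerD2l lerN2 !normrM ler_wpM2l// !normfV !ger0_norm// lef_pV2 ?posrE ?ltr0n//.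
  by rewrite ler_nat ltnS.
by move=> p q pq; rewrite ler_pM ?tri_ge0 ?t1.
Qed.

Let tri2_cvg w : (fun m => tri2 m.+1%:R w) @ \oo --> (1 : R).
Proof.
have t1 (t : R) : (fun m => tri (t / m.+1%:R)) @ \oo --> (1 : R).
  have h : (fun m => 1 - `|t / m.+1%:R|) @ \oo --> (1 : R).
    rewrite -[X in _ --> X]subr0; apply: cvgB; first exact: cvg_cst.
    rewrite -(normr0 R); apply: cvg_norm; rewrite -(mulr0 t).
    by apply: cvgM; [exact: cvg_cst|exact: cvg_harmonic].
  apply: (@squeeze_cvgr _ _ _ _ (fun m => 1 - `|t / m.+1%:R|) (cst 1)) => //; last exact: cvg_cst.
  by apply: nearW => m; rewrite tri_le1 andbT /tri le_max lexx orbT.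
have h := cvgM (t1 w.1) (t1 w.2); rewrite mulr1 in h; exact: h.
Qed.

(** Two limits of the same integrals are compared: the tents increase to [1], so monotone
    convergence yields the full energy, finite or not; the energy identity yields [K * N], since its
    error term vanishes. *)
Lemma plancherel_real :
  (\int[leb2]_w (cos_transform w ^+ 2 + sin_transform w ^+ 2)%:E =
   (fejer_mass R ^+ 2)%:E * \int[leb2]_x (g x ^+ 2)%:E)%E.
Proof.
rewrite N_E -EFinM -/K -/C -/S.
pose Q w := C w ^+ 2 + S w ^+ 2.
have Q0 w : 0 <= Q w by rewrite addr_ge0 ?sqr_ge0.
have mQ : measurable_fun setT Q.
  by apply: measurable_funD; apply: measurable_funX;
    [exact: measurable_cos_transform|exact: measurable_sin_transform].
pose F m w : \bar R := (tri2 m.+1%:R w * Q w)%:E.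
have n0 m : 0 < m.+1%:R :> R by rewrite ltr0n.
have mF m : measurable_fun setT (F m).
  by apply/measurable_EFinP; apply: measurable_funM => //; exact: mtri2.
have F0 m w : (0 <= F m w)%E by rewrite lee_fin mulr_ge0 ?tri2_ge0.
have Fnd w : {homo F^~ w : p q / (p <= q)%N >-> (p <= q)%E}.
  by move=> p q pq; rewrite lee_fin ler_wpM2r// tri2_nd.
have cv1 := @cvg_monotone_convergence _ _ _ leb2 _ measurableT F mF
  (fun m w _ => F0 m w) (fun w _ => @Fnd w).
have limF w : limn (F^~ w) = (Q w)%:E.
  apply/cvg_lim => //; apply: cvg_EFin; first exact: nearW.
  by rewrite -[X in _ --> X]mul1r; apply: cvgM; [exact: tri2_cvg|exact: cvg_cst].
have cv2 : (fun m => \int[leb2]_w F m w)%E @ \oo --> (K * N)%:E.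
  have FE m : (\int[leb2]_w F m w = (K * N - 2^-1 * Rintegral (leb2 \x leb2)%E setT (E m.+1%:R))%:E)%E.
    rewrite -energy_identity// /Rintegral fineK//.
    exact: (integrable_fin_num measurableT (integrable_energy (n0 m))).
  rewrite (eq_cvg _ _ FE); apply: cvg_EFin; first exact: nearW.
  rewrite -[X in _ --> X]subr0 -(mulr0 2^-1); apply: cvgB; first exact: cvg_cst.
  apply: cvgM; first exact: cvg_cst.
  exact: fine_cvg cvg_E.
under eq_integral do rewrite -/(Q _) -limF.
exact: cvg_unique cv1 cv2.
Qed.

End plancherel_real.

(** * Square integrable complex functions *)

Section almost_everywhere.
Context d (T : measurableType d) (R : realType) (mu : {measure set T -> \bar R}).

Lemma ae_imp (P Q : T -> Prop) : (forall x, P x -> Q x) ->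
  {ae mu, forall x, P x} -> {ae mu, forall x, Q x}.
Proof. by move=> PQ; exact: filterS. Qed.

Lemma ae_imp2 (P Q S : T -> Prop) : (forall x, P x -> Q x -> S x) ->
  {ae mu, forall x, P x} -> {ae mu, forall x, Q x} -> {ae mu, forall x, S x}.
Proof. by move=> PQS; exact: filterS2. Qed.

Lemma ae_forall (P : T -> Prop) : (forall x, P x) -> {ae mu, forall x, P x}.
Proof. by move=> Px; apply: aeW. Qed.

End almost_everywhere.

Section square_integrable.
Local Open Scope complex_scope.
Context (R : realType).
Notation leb2 := (@leb2 R).
Implicit Types (f g h : R * R -> R[i]) (a b c : R[i]) (x w : R * R) (k e : R) (n m : nat).

Lemma normc_sqr a : normc a ^+ 2 = complex.Re a ^+ 2 + complex.Im a ^+ 2.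
Proof. by case: a => r i /=; rewrite sqr_sqrtr// addr_ge0 ?sqr_ge0. Qed.

Lemma normc_ge0 a : 0 <= normc a.
Proof. by case: a => r i /=; exact: sqrtr_ge0. Qed.

Lemma ReM a b : complex.Re (a * b) =
  complex.Re a * complex.Re b - complex.Im a * complex.Im b.
Proof. by case: a => ? ?; case: b. Qed.

Lemma ImM a b : complex.Im (a * b) =
  complex.Re a * complex.Im b + complex.Im a * complex.Re b.
Proof. by case: a => ? ?; case: b => ? ? /=. Qed.

Lemma ReD a b : complex.Re (a + b) = complex.Re a + complex.Re b.
Proof. by case: a => ? ?; case: b. Qed.

Lemma ImD a b : complex.Im (a + b) = complex.Im a + complex.Im b.
Proof. by case: a => ? ?; case: b. Qed.

Lemma ReB a b : complex.Re (a - b) = complex.Re a - complex.Re b.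
Proof. by case: a => ? ?; case: b. Qed.

Lemma ImB a b : complex.Im (a - b) = complex.Im a - complex.Im b.
Proof. by case: a => ? ?; case: b. Qed.

Lemma ReJ a : complex.Re (conjc a) = complex.Re a.
Proof. by case: a. Qed.

Lemma ImJ a : complex.Im (conjc a) = - complex.Im a.
Proof. by case: a. Qed.

Lemma normc_sqrM a b : normc (a * b) ^+ 2 = normc a ^+ 2 * normc b ^+ 2.
Proof. by rewrite !normc_sqr ReM ImM; ring. Qed.

Lemma complex_eqP a b : complex.Re a = complex.Re b ->
  complex.Im a = complex.Im b -> a = b.
Proof. by case: a => ? ?; case: b => ? ? /= -> ->. Qed.

Lemma normc_sqr_eq0 a : (normc a ^+ 2 == 0) = (a == 0).
Proof.
rewrite normc_sqr paddr_eq0 ?sqr_ge0// !sqrf_eq0.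
by apply/andP/eqP => [[/eqP ? /eqP ?]|->//]; exact: complex_eqP.
Qed.

Definition cmeasurable f :=
  measurable_fun setT (fun x => complex.Re (f x)) /\
  measurable_fun setT (fun x => complex.Im (f x)).

Lemma cmeasurable_cst c : cmeasurable (fun=> c).
Proof. by split; exact: measurable_cst. Qed.

Lemma cmeasurableD f g : cmeasurable f -> cmeasurable g ->
  cmeasurable (fun x => f x + g x).
Proof.
move=> [fr fi] [gr gi]; split.
  by under eq_fun do rewrite ReD; exact: measurable_funD.
by under eq_fun do rewrite ImD; exact: measurable_funD.
Qed.

Lemma cmeasurableB f g : cmeasurable f -> cmeasurable g ->
  cmeasurable (fun x => f x - g x).
Proof.
move=> [fr fi] [gr gi]; split.
  by under eq_fun do rewrite ReB; exact: measurable_funB.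
by under eq_fun do rewrite ImB; exact: measurable_funB.
Qed.

Lemma cmeasurableM f g : cmeasurable f -> cmeasurable g ->
  cmeasurable (fun x => f x * g x).
Proof.
move=> [fr fi] [gr gi]; split.
  by under eq_fun do rewrite ReM; apply: measurable_funB; exact: measurable_funM.
by under eq_fun do rewrite ImM; apply: measurable_funD; exact: measurable_funM.
Qed.

Lemma cmeasurable_conj f : cmeasurable f -> cmeasurable (fun x => conjc (f x)).
Proof.
move=> [fr fi]; split; first by under eq_fun do rewrite ReJ.
by under eq_fun do rewrite ImJ; exact: measurable_funN.
Qed.

Lemma cmeasurable_comp f (phi : R * R -> R * R) : cmeasurable f ->
  measurable_fun setT phi -> cmeasurable (fun x => f (phi x)).
Proof.
by move=> [fr fi] mphi; split;
  [exact: (measurableT_comp fr)|exact: (measurableT_comp fi)].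
Qed.

Lemma measurable_normc_sqr f : cmeasurable f ->
  measurable_fun setT (fun x => normc (f x) ^+ 2).
Proof.
move=> [fr fi]; under eq_fun do rewrite normc_sqr.
by apply: measurable_funD; exact: measurable_funX.
Qed.

Lemma measurable_EFin_normc_sqr f : cmeasurable f ->
  measurable_fun setT (fun x => (normc (f x) ^+ 2)%:E).
Proof. by move=> mf; apply/measurable_EFinP; exact: measurable_normc_sqr. Qed.

Lemma sqnorm2_ge0 f : (0 <= sqnorm2 f)%E.
Proof. by apply: integral_ge0 => x _; rewrite lee_fin sqr_ge0. Qed.

Lemma sqnorm2_ReIm f : cmeasurable f ->
  sqnorm2 f = (\int[leb2]_x (complex.Re (f x) ^+ 2)%:E +
               \int[leb2]_x (complex.Im (f x) ^+ 2)%:E)%E.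
Proof.
move=> [fr fi]; rewrite /sqnorm2; under eq_integral do rewrite normc_sqr EFinD.
rewrite ge0_integralD//.
- by move=> x _; rewrite lee_fin sqr_ge0.
- exact: measurable_sqr.
- by move=> x _; rewrite lee_fin sqr_ge0.
- exact: measurable_sqr.
Qed.

Lemma L2P f : L2 f <-> cmeasurable f /\ (sqnorm2 f < +oo)%E.
Proof. by split=> [[? ? ?]|[[? ?] ?]]. Qed.

Lemma L2_cmeasurable f : L2 f -> cmeasurable f.
Proof. by move=> /L2P[]. Qed.

Lemma sqnorm2_le f g : cmeasurable f -> cmeasurable g ->
  (forall x, normc (f x) ^+ 2 <= normc (g x) ^+ 2) -> (sqnorm2 f <= sqnorm2 g)%E.
Proof.
move=> mf mg fg; apply: ge0_le_integral => //.
- by move=> x _; rewrite lee_fin sqr_ge0.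
- exact: measurable_EFin_normc_sqr.
- exact: measurable_EFin_normc_sqr.
- by move=> x _; rewrite lee_fin.
Qed.

Lemma sqnorm2Z c f : cmeasurable f ->
  sqnorm2 (fun x => c * f x) = ((normc c ^+ 2)%:E * sqnorm2 f)%E.
Proof.
move=> mf; rewrite /sqnorm2; under eq_integral do rewrite normc_sqrM EFinM.
rewrite ge0_integralZl//.
- exact: measurable_EFin_normc_sqr.
- by move=> x _; rewrite lee_fin sqr_ge0.
- by rewrite lee_fin sqr_ge0.
Qed.

Lemma L2Z c f : L2 f -> L2 (fun x => c * f x).
Proof.
move=> /L2P[mf fy]; apply/L2P; split.
  by apply: cmeasurableM => //; exact: cmeasurable_cst.
by rewrite sqnorm2Z// lte_mul_pinfty// lee_fin sqr_ge0.
Qed.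

Lemma sqnorm2D_le2 f g : cmeasurable f -> cmeasurable g ->
  (sqnorm2 (fun x => f x + g x)%R <= 2%:E * sqnorm2 f + 2%:E * sqnorm2 g)%E.
Proof.
move=> mf mg; rewrite -!ge0_integralZl//;
  try by [exact: measurable_EFin_normc_sqr|move=> x _; rewrite lee_fin sqr_ge0].
rewrite -ge0_integralD//;
  try by [apply: measurable_funeM; exact: measurable_EFin_normc_sqr
         |move=> x _; rewrite -EFinM lee_fin mulr_ge0 ?sqr_ge0].
apply: ge0_le_integral => //.
- by move=> x _; rewrite lee_fin sqr_ge0.
- by apply: measurable_EFin_normc_sqr; exact: cmeasurableD.
- by apply: emeasurable_funD; apply: measurable_funeM; exact: measurable_EFin_normc_sqr.
- move=> x _; rewrite -!EFinM -EFinD lee_fin !normc_sqr ReD ImD.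
  have := sqrD_le2 (complex.Re (f x)) (complex.Re (g x)).
  have := sqrD_le2 (complex.Im (f x)) (complex.Im (g x)); lra.
Qed.

Lemma sqnorm2N f : sqnorm2 (fun x => - f x) = sqnorm2 f.
Proof.
apply: eq_integral => x _; rewrite !normc_sqr.
by case: (f x) => r i /=; rewrite !sqrrN.
Qed.

Lemma sqnorm2BC f g : sqnorm2 (fun x => f x - g x) = sqnorm2 (fun x => g x - f x).
Proof. by rewrite -sqnorm2N; congr sqnorm2; apply/funext => x; rewrite opprB. Qed.

Lemma L2D f g : L2 f -> L2 g -> L2 (fun x => f x + g x).
Proof.
move=> /L2P[mf fy] /L2P[mg gy]; apply/L2P; split; first exact: cmeasurableD.
apply: le_lt_trans (sqnorm2D_le2 mf mg) _.
by rewrite lte_add_pinfty// lte_mul_pinfty.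
Qed.

Lemma L2B f g : L2 f -> L2 g -> L2 (fun x => f x - g x).
Proof.
move=> hf hg; rewrite (_ : (fun x => _) = (fun x => f x + -1 * g x)); last first.
  by apply/funext => x; rewrite mulN1r.
by apply: L2D => //; exact: L2Z.
Qed.

Lemma L20 : L2 (fun=> 0 : R[i]).
Proof.
apply/L2P; split; first exact: cmeasurable_cst.
rewrite /sqnorm2 integral0_eq ?ltry// => x _.
by rewrite normc_sqr /= expr0n/= addr0.
Qed.

Lemma sqnorm2_eq0P f : cmeasurable f ->
  sqnorm2 f = 0%E <-> {ae leb2, forall x, f x = 0}.
Proof.
move=> mf; have mf2 := measurable_EFin_normc_sqr mf.
rewrite /sqnorm2; split => [f0|f0].
  have : (\int[leb2]_x `|(normc (f x) ^+ 2)%:E| = 0)%E.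
    by rewrite -[RHS]f0; apply: eq_integral => x _; rewrite gee0_abs// lee_fin sqr_ge0.
  move/(ae_eq_integral_abs leb2 measurableT mf2).1.
  by apply: ae_imp => x /(_ Logic.I) /eqP; rewrite eqe normc_sqr_eq0 => /eqP.
rewrite (_ : 0 = \int[leb2]_x (cst 0 x))%E; last by rewrite integral0.
apply: ge0_ae_eq_integral => //.
- by move=> x _; rewrite lee_fin sqr_ge0.
- by apply: ae_imp f0 => x fx _; rewrite fx normc_sqr/= expr0n/= addr0.
Qed.

Lemma sqnorm2_ae_eq f g : cmeasurable f -> cmeasurable g ->
  {ae leb2, forall x, f x = g x} -> sqnorm2 f = sqnorm2 g.
Proof.
move=> mf mg fg; apply: ge0_ae_eq_integral => //;
  try by [exact: measurable_EFin_normc_sqr|move=> x _; rewrite lee_fin sqr_ge0].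
by apply: ae_imp fg => x -> _.
Qed.

Lemma ae_eqB f g : {ae leb2, forall x, f x - g x = 0} <->
  {ae leb2, forall x, f x = g x}.
Proof.
split; apply: ae_imp => x; first by move/eqP; rewrite subr_eq0 => /eqP.
by move=> ->; rewrite subrr.
Qed.

(** Faithful to [sqnorm2] on [L2], where the latter is finite; [fine] would send an infinite norm to
    [0]. *)
Definition nrm2 f : R := fine (sqnorm2 f).

Lemma sqnorm2_fin f : L2 f -> sqnorm2 f \is a fin_num.
Proof. by move=> /L2P[_ fy]; rewrite ge0_fin_numE ?sqnorm2_ge0. Qed.

Lemma sqnorm2_nrm2 f : L2 f -> sqnorm2 f = (nrm2 f)%:E.
Proof. by move=> hf; rewrite /nrm2 fineK// sqnorm2_fin. Qed.

Lemma nrm2_ge0 f : 0 <= nrm2 f.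
Proof. by rewrite fine_ge0// sqnorm2_ge0. Qed.

(** The real part of [inner]. Being real bilinear and symmetric, it is governed by [nrm2] through
    polarisation; the imaginary part of [inner f g] is recovered as [ip] of [f] and ['i * g]. *)
Definition ip f g : R := Rintegral leb2 setT (fun x =>
  complex.Re (f x) * complex.Re (g x) + complex.Im (f x) * complex.Im (g x)).

Lemma integrable_L2M (u v : R * R -> R) :
  measurable_fun setT u -> measurable_fun setT v ->
  leb2.-integrable setT (EFin \o (fun x => u x ^+ 2)) ->
  leb2.-integrable setT (EFin \o (fun x => v x ^+ 2)) ->
  leb2.-integrable setT (EFin \o (fun x => u x * v x)).
Proof.
move=> mu mv iu iv.
have iuv : leb2.-integrable setT (EFin \o (fun x => u x ^+ 2 + v x ^+ 2)).
  exact: integrableD iu iv.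
apply: (integrable_le _ iuv); first exact: measurable_funM.
move=> x; rewrite normrM -(real_normK (num_real (u x))) -(real_normK (num_real (v x))).
have := sqr_ge0 (`|u x| - `|v x|); have := normr_ge0 (u x); have := normr_ge0 (v x); nra.
Qed.

Lemma L2_integral_lty f : L2 f ->
  (\int[leb2]_x (complex.Re (f x) ^+ 2)%:E < +oo)%E /\
  (\int[leb2]_x (complex.Im (f x) ^+ 2)%:E < +oo)%E.
Proof.
move=> /L2P[mf]; rewrite sqnorm2_ReIm// => fy; split; apply: le_lt_trans fy.
  by rewrite leeDl// integral_ge0// => x _; rewrite lee_fin sqr_ge0.
by rewrite leeDr// integral_ge0// => x _; rewrite lee_fin sqr_ge0.
Qed.

Lemma L2_integrable f : L2 f ->
  leb2.-integrable setT (EFin \o (fun x => complex.Re (f x) ^+ 2)) /\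
  leb2.-integrable setT (EFin \o (fun x => complex.Im (f x) ^+ 2)).
Proof.
move=> f2; have [ry iy] := L2_integral_lty f2; have /L2P[[mr mi] _] := f2.
split; apply/integrableP; split; try exact: measurable_sqr.
  by under eq_integral do rewrite gee0_abs ?lee_fin ?sqr_ge0//.
by under eq_integral do rewrite gee0_abs ?lee_fin ?sqr_ge0//.
Qed.

Lemma integrable_ip f g : L2 f -> L2 g ->
  leb2.-integrable setT (EFin \o (fun x =>
    complex.Re (f x) * complex.Re (g x) + complex.Im (f x) * complex.Im (g x))).
Proof.
move=> hf hg; have [fr fi] := L2_cmeasurable hf; have [gr gi] := L2_cmeasurable hg.
have [ifr ifi] := L2_integrable hf; have [igr igi] := L2_integrable hg.
have i1 := integrable_L2M fr gr ifr igr.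
have i2 := integrable_L2M fi gi ifi igi.
exact: integrableD i1 i2.
Qed.

Lemma ipC f g : ip f g = ip g f.
Proof. by apply: eq_Rintegral => x _; ring. Qed.

Lemma ipDl f g h : L2 f -> L2 g -> L2 h ->
  ip (fun x => f x + g x) h = ip f h + ip g h.
Proof.
move=> hf hg hh; rewrite /ip -RintegralD//; try exact: integrable_ip.
by apply: eq_Rintegral => x _; rewrite ReD ImD; ring.
Qed.

Lemma ipZl k f g : L2 f -> L2 g -> ip (fun x => k%:C * f x) g = k * ip f g.
Proof.
move=> hf hg; rewrite /ip -RintegralZl//; last exact: integrable_ip.
by apply: eq_Rintegral => x _; rewrite ReM ImM/=; ring.
Qed.

Lemma ipff f : ip f f = nrm2 f.
Proof.
rewrite /ip /nrm2 /sqnorm2 /Rintegral; congr fine; apply: eq_integral => x _.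
by rewrite normc_sqr -!expr2.
Qed.

Lemma ipDr f g h : L2 f -> L2 g -> L2 h ->
  ip h (fun x => f x + g x) = ip h f + ip h g.
Proof. by move=> *; rewrite ipC ipDl// ![ip _ h]ipC. Qed.

Lemma ipZr k f g : L2 f -> L2 g -> ip g (fun x => k%:C * f x) = k * ip g f.
Proof. by move=> *; rewrite ipC ipZl// ipC. Qed.

Lemma nrm2D f g : L2 f -> L2 g ->
  nrm2 (fun x => f x + g x) = nrm2 f + 2 * ip f g + nrm2 g.
Proof.
move=> hf hg; have hfg := L2D hf hg.
rewrite -ipff ipDl// !ipDr// !ipff [ip g f]ipC; ring.
Qed.

Lemma nrm2Z c f : L2 f -> nrm2 (fun x => c * f x) = normc c ^+ 2 * nrm2 f.
Proof.
move=> hf; rewrite /nrm2 sqnorm2Z ?fineM ?sqnorm2_fin//.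
exact: L2_cmeasurable.
Qed.

Lemma nrm2DZ k f g : L2 f -> L2 g ->
  nrm2 (fun x => f x + k%:C * g x) = nrm2 f + 2 * k * ip f g + k ^+ 2 * nrm2 g.
Proof.
move=> hf hg; rewrite nrm2D//; last exact: L2Z.
by rewrite ipZr// nrm2Z// normc_sqr/= expr0n/= addr0; ring.
Qed.

(** Real and imaginary parts converge separately. The limit is in [L2] because it is at finite
    distance from some [g_ N]. *)
Lemma L2_complete (g_ : nat -> R * R -> R[i]) : (forall n, L2 (g_ n)) ->
  (forall e, 0 < e -> exists N, forall m n, (N <= m)%N -> (N <= n)%N ->
    (sqnorm2 (fun x => (g_ m x - g_ n x)%R) <= e%:E)%E) ->
  exists2 h, L2 h & (fun n => sqnorm2 (fun x => (g_ n x - h x)%R)) @ \oo --> (0 : \bar R)%E.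
Proof.
move=> hg cg.
have mB m n : cmeasurable (fun x => g_ m x - g_ n x).
  by apply: cmeasurableB; exact: L2_cmeasurable.
have [r mr hr] : exists2 r : R * R -> R, measurable_fun setT r &
    (fun n => \int[leb2]_x (((complex.Re (g_ n x) - r x) ^+ 2)%R)%:E)%E @ \oo --> (0 : \bar R)%E.
  apply: (riesz_fischer (mu := leb2)) => [n|e e0]; first by have [] := L2_cmeasurable (hg n).
  have [N gN] := cg e e0; exists N => m n Nm Nn; apply: le_trans (gN m n Nm Nn).
  rewrite sqnorm2_ReIm//; under eq_integral do rewrite -ReB.
  by rewrite leeDl// integral_ge0// => x _; rewrite lee_fin sqr_ge0.
have [i mi hi] : exists2 i : R * R -> R, measurable_fun setT i &
    (fun n => \int[leb2]_x (((complex.Im (g_ n x) - i x) ^+ 2)%R)%:E)%E @ \oo --> (0 : \bar R)%E.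
  apply: (riesz_fischer (mu := leb2)) => [n|e e0]; first by have [] := L2_cmeasurable (hg n).
  have [N gN] := cg e e0; exists N => m n Nm Nn; apply: le_trans (gN m n Nm Nn).
  rewrite sqnorm2_ReIm//; under eq_integral do rewrite -ImB.
  by rewrite leeDr// integral_ge0// => x _; rewrite lee_fin sqr_ge0.
pose h x : R[i] := r x +i* i x.
have mh : cmeasurable h by [].
have cgh : (fun n => sqnorm2 (fun x => (g_ n x - h x)%R)) @ \oo --> (0 : \bar R)%E.
  rewrite (_ : (fun n => _) = (fun n => \int[leb2]_x (((complex.Re (g_ n x) - r x) ^+ 2)%R)%:E +
      \int[leb2]_x (((complex.Im (g_ n x) - i x) ^+ 2)%R)%:E)%E); last first.
    apply/funext => n; rewrite sqnorm2_ReIm; last first.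
      by apply: cmeasurableB => //; exact: L2_cmeasurable.
    by congr (_ + _)%E; apply: eq_integral => x _; rewrite ?ReB ?ImB.
  by rewrite -(adde0 (0 : \bar R)%E); apply: cvgeD.
exists h => //.
have [N gN] := (cvge0P (fun n => sqnorm2_ge0 _)).1 cgh 1 ltr01.
have hB : L2 (fun x => h x - g_ N x).
  apply/L2P; split; first by apply: cmeasurableB => //; exact: L2_cmeasurable.
  by rewrite sqnorm2BC (le_lt_trans (gN N (leqnn _)))// ltry.
have := L2D hB (hg N); congr L2.
by apply/funext => x; rewrite subrK.
Qed.

End square_integrable.

(** * The Fourier transform *)

Section fourier_L1.
Local Open Scope complex_scope.
Context (R : realType).
Notation leb2 := (@leb2 R).
Implicit Types (f g h : R * R -> R[i]) (a b c : R[i]) (x w : R * R) (k e : R) (n m : nat).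

Definition cintegrable f :=
  leb2.-integrable setT (EFin \o (fun x => complex.Re (f x))) /\
  leb2.-integrable setT (EFin \o (fun x => complex.Im (f x))).

Lemma cintegrable_cmeasurable f : cintegrable f -> cmeasurable f.
Proof.
by move=> [fr fi]; split; apply/measurable_EFinP; exact: measurable_int fr || exact: measurable_int fi.
Qed.

Lemma normr_Re_le a : `|complex.Re a| <= normc a.
Proof. by rewrite -sqrtr_sqr; case: a => r i /=; rewrite ler_wsqrtr// lerDl sqr_ge0. Qed.

Lemma normr_Im_le a : `|complex.Im a| <= normc a.
Proof. by rewrite -sqrtr_sqr; case: a => r i /=; rewrite ler_wsqrtr// lerDr sqr_ge0. Qed.

Lemma normc_le_ReIm a : normc a <= `|complex.Re a| + `|complex.Im a|.
Proof.
rewrite -(@ler_pXn2r _ 2)// ?nnegrE ?normc_ge0 ?addr_ge0//.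
rewrite normc_sqr sqrrD !real_normK ?num_real// addrAC lerDl.
by rewrite mulrn_wge0// mulr_ge0.
Qed.

Lemma ler_normc a b : (normc a <= normc b) = (normc a ^+ 2 <= normc b ^+ 2).
Proof. by rewrite ler_pXn2r ?nnegrE ?normc_ge0. Qed.

Lemma cintegrable_le f (b : R * R -> R) : cmeasurable f ->
  leb2.-integrable setT (EFin \o b) -> (forall x, normc (f x) <= b x) ->
  cintegrable f.
Proof.
move=> [mr mi] ib fb; split; apply: (integrable_le _ ib) => // x.
  exact: le_trans (normr_Re_le _) (fb x).
exact: le_trans (normr_Im_le _) (fb x).
Qed.

Lemma cintegrable_normc f : cintegrable f ->
  leb2.-integrable setT (EFin \o (fun x => `|complex.Re (f x)| + `|complex.Im (f x)|)).
Proof.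
move=> [ir ii].
have ir' := integrable_norm ir; have ii' := integrable_norm ii.
exact: integrableD_EFin ir' ii'.
Qed.

Lemma cintegrable_dominated f g : cmeasurable f -> cintegrable g ->
  (forall x, normc (f x) <= normc (g x)) -> cintegrable f.
Proof.
move=> mf ig fg; apply: (cintegrable_le mf (cintegrable_normc ig)) => x.
exact: le_trans (fg x) (normc_le_ReIm _).
Qed.

Lemma cintegrableD f g : cintegrable f -> cintegrable g ->
  cintegrable (fun x => f x + g x).
Proof.
move=> [fr fi] [gr gi]; split.
  by under [_ \o _]eq_fun do rewrite /= ReD; exact: (integrableD_EFin fr gr).
by under [_ \o _]eq_fun do rewrite /= ImD; exact: (integrableD_EFin fi gi).
Qed.

Lemma cintegrableZ c f : cintegrable f -> cintegrable (fun x => c * f x).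
Proof.
move=> [fr fi]; split.
  under [_ \o _]eq_fun do rewrite /= ReM.
  exact: (integrableB_EFin (integrableZl_EFin _ fr) (integrableZl_EFin _ fi)).
under [_ \o _]eq_fun do rewrite /= ImM.
exact: (integrableD_EFin (integrableZl_EFin _ fi) (integrableZl_EFin _ fr)).
Qed.

Lemma cintegrableB f g : cintegrable f -> cintegrable g ->
  cintegrable (fun x => f x - g x).
Proof.
move=> hf /(cintegrableZ (-1)) hg; have := cintegrableD hf hg; congr cintegrable.
by apply/funext => x; rewrite mulN1r.
Qed.

Lemma cintegralD f g : cintegrable f -> cintegrable g ->
  cintegral (fun x => f x + g x) = cintegral f + cintegral g.
Proof.
move=> [fr fi] [gr gi]; apply: complex_eqP; rewrite ?ReD ?ImD/= -RintegralD//;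
  by apply: eq_Rintegral => x _; rewrite ?ReD ?ImD.
Qed.

Lemma cintegralZ c f : cintegrable f ->
  cintegral (fun x => c * f x) = c * cintegral f.
Proof.
move=> [fr fi].
have ir k := integrableZl_EFin k fr; have ii k := integrableZl_EFin k fi.
apply: complex_eqP; rewrite ?ReM ?ImM/=.
  rewrite -!RintegralZl// -RintegralB//.
  by apply: eq_Rintegral => x _; rewrite ReM.
rewrite -!RintegralZl// -RintegralD//.
by apply: eq_Rintegral => x _; rewrite ImM.
Qed.

Lemma normc_cexpi k : normc (cexpi k) = 1.
Proof. by rewrite /= cos2Dsin2 sqrtr1. Qed.

Lemma cmeasurable_cexpi (u : R * R -> R) : measurable_fun setT u ->
  cmeasurable (fun x => cexpi (u x)).
Proof.
move=> mu; split => /=.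
  exact: measurableT_comp (continuous_measurable_fun (@continuous_cos R)) mu.
exact: measurableT_comp (continuous_measurable_fun (@continuous_sin R)) mu.
Qed.

Lemma normcM a b : normc (a * b) = normc a * normc b.
Proof.
apply/eqP; rewrite -(@eqrXn2 _ 2) ?mulr_ge0 ?normc_ge0//.
by rewrite normc_sqrM exprMn.
Qed.

Lemma cintegrableM_cexpi f (u : R * R -> R) : cintegrable f ->
  measurable_fun setT u -> cintegrable (fun x => f x * cexpi (u x)).
Proof.
move=> hf mu; have mf := cintegrable_cmeasurable hf.
apply: cintegrable_dominated hf _ => [|x].
  by apply: cmeasurableM => //; exact: cmeasurable_cexpi.
by rewrite normcM normc_cexpi mulr1.
Qed.

Lemma measurable_phasel w : measurable_fun setT (fun x => phase x w).
Proof.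
exact: (measurableT_comp (@measurable_phase R)
  (measurable_fun_pair (@measurable_id _ _ setT) (@measurable_cst _ _ _ _ setT w))).
Qed.

Lemma fourierL1E f w :
  fourierL1 f w = cintegral (fun x => f x * cexpi (- phase x w)).
Proof. by []. Qed.

Lemma cintegrable_fourierL1 f w : cintegrable f ->
  cintegrable (fun x => f x * cexpi (- phase x w)).
Proof.
by move=> hf; apply: cintegrableM_cexpi => //; apply: measurableT_comp => //;
  exact: measurable_phasel.
Qed.

Lemma fourierL1D f g w : cintegrable f -> cintegrable g ->
  fourierL1 (fun x => f x + g x) w = fourierL1 f w + fourierL1 g w.
Proof.
move=> hf hg; rewrite !fourierL1E -cintegralD; [|exact: cintegrable_fourierL1..].
by congr cintegral; apply/funext => x; rewrite mulrDl.
Qed.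

Lemma fourierL1Z c f w : cintegrable f ->
  fourierL1 (fun x => c * f x) w = c * fourierL1 f w.
Proof.
move=> hf; rewrite !fourierL1E -cintegralZ; last exact: cintegrable_fourierL1.
by congr cintegral; apply/funext => x; rewrite mulrA.
Qed.

Lemma fourierL1B f g w : cintegrable f -> cintegrable g ->
  fourierL1 (fun x => f x - g x) w = fourierL1 f w - fourierL1 g w.
Proof.
move=> hf hg; have := fourierL1D w hf (cintegrableZ (-1) hg).
rewrite (fourierL1Z _ _ hg) mulN1r => <-.
suff -> : (fun x => f x - g x) = (fun x => f x + -1 * g x) by [].
by apply/funext => x; rewrite mulN1r.
Qed.

Let Re' f x := complex.Re (f x).
Let Im' f x := complex.Im (f x).

Lemma integrable_cos_phase (r : R * R -> R) w : leb2.-integrable setT (EFin \o r) ->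
  leb2.-integrable setT (EFin \o (fun x => r x * cos (phase x w))).
Proof.
move=> ir; apply: (integrable_le _ (integrable_norm ir)).
  apply: measurable_funM; first by apply/measurable_EFinP; exact: measurable_int ir.
  apply: (measurableT_comp (continuous_measurable_fun (@continuous_cos R))).
  exact: measurable_phasel.
by move=> x; rewrite normrM ler_piMr ?cos_max.
Qed.

Lemma integrable_sin_phase (r : R * R -> R) w : leb2.-integrable setT (EFin \o r) ->
  leb2.-integrable setT (EFin \o (fun x => r x * sin (phase x w))).
Proof.
move=> ir; apply: (integrable_le _ (integrable_norm ir)).
  apply: measurable_funM; first by apply/measurable_EFinP; exact: measurable_int ir.
  apply: (measurableT_comp (continuous_measurable_fun (@continuous_sin R))).
  exact: measurable_phasel.
by move=> x; rewrite normrM ler_piMr ?sin_max.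
Qed.

Lemma Re_fourierL1 f w : cintegrable f -> complex.Re (fourierL1 f w) =
  cos_transform (Re' f) w + sin_transform (Im' f) w.
Proof.
move=> [fr fi]; rewrite fourierL1E /= /cos_transform /sin_transform -RintegralD//.
- by apply: eq_Rintegral => x _; rewrite ReM /= cosN sinN mulrN opprK.
- exact: integrable_cos_phase.
- exact: integrable_sin_phase.
Qed.

Lemma Im_fourierL1 f w : cintegrable f -> complex.Im (fourierL1 f w) =
  cos_transform (Im' f) w - sin_transform (Re' f) w.
Proof.
move=> [fr fi]; rewrite fourierL1E /= /cos_transform /sin_transform -RintegralB//.
- by apply: eq_Rintegral => x _; rewrite ImM /= cosN sinN mulrN addrC.
- exact: integrable_cos_phase.
- exact: integrable_sin_phase.
Qed.

Lemma cmeasurable_fourierL1 f : cintegrable f -> cmeasurable (fourierL1 f).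
Proof.
move=> hf; have [mr mi] := cintegrable_cmeasurable hf; split.
  under eq_fun do rewrite Re_fourierL1//.
  by apply: measurable_funD; [exact: measurable_cos_transform|exact: measurable_sin_transform].
under eq_fun do rewrite Im_fourierL1//.
by apply: measurable_funB; [exact: measurable_cos_transform|exact: measurable_sin_transform].
Qed.

Definition opp2 w : R * R := (- w.1, - w.2).

Lemma rescales_opp2 : rescales leb2 opp2 1.
Proof.
have N10 : -1 != 0 :> R by rewrite oppr_eq0 oner_neq0.
have := rescales_upper 0 0 0 N10 N10; rewrite mulN1r opprK normr1 invr1.
by congr rescales; apply/funext => w; rewrite !mulN1r mul0r !addr0.
Qed.

Lemma phaseNr x w : phase x (opp2 w) = - phase x w.
Proof. by rewrite /phase/=; ring. Qed.

Lemma cos_transformN (r : R * R -> R) w : cos_transform r (opp2 w) = cos_transform r w.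
Proof. by apply: eq_Rintegral => x _; rewrite phaseNr cosN. Qed.

Lemma sin_transformN (r : R * R -> R) w : leb2.-integrable setT (EFin \o r) ->
  sin_transform r (opp2 w) = - sin_transform r w.
Proof.
move=> ir; rewrite -mulN1r /sin_transform -RintegralZl//.
  by apply: eq_Rintegral => x _; rewrite phaseNr sinN; ring.
exact: integrable_sin_phase.
Qed.

Lemma integral_sqnormD f g : cmeasurable f -> cmeasurable g ->
  (\int[leb2]_x ((normc (f x) ^+ 2)%:E + (normc (g x) ^+ 2)%:E) = sqnorm2 f + sqnorm2 g)%E.
Proof.
move=> mf mg; rewrite ge0_integralD//.
- by move=> w _; rewrite lee_fin sqr_ge0.
- exact: measurable_EFin_normc_sqr.
- by move=> w _; rewrite lee_fin sqr_ge0.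
- exact: measurable_EFin_normc_sqr.
Qed.

Lemma integral2D (p q : R * R -> \bar R) :
  measurable_fun setT p -> measurable_fun setT q ->
  (forall x, 0 <= p x)%E -> (forall x, 0 <= q x)%E ->
  (\int[leb2]_x (2%:E * (p x + q x)) = 2%:E * (\int[leb2]_x p x + \int[leb2]_x q x))%E.
Proof.
move=> mp mq p0 q0; rewrite ge0_integralZl//.
- by rewrite ge0_integralD.
- exact: emeasurable_funD.
- by move=> x _; rewrite adde_ge0.
Qed.

(* Its value is [1], but only its positivity matters: it cancels between the
   uses of Plancherel's identity in the space and in the frequency variable. *)
Definition plancherel_cst : R := fejer_mass R ^+ 2.

Lemma plancherel_cst_gt0 : 0 < plancherel_cst.
Proof. by rewrite exprn_gt0// fejer_mass_gt0. Qed.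

Lemma sqnorm2_fourierL1 f : cintegrable f -> L2 f ->
  sqnorm2 (fourierL1 f) = (plancherel_cst%:E * sqnorm2 f)%E.
Proof.
rewrite /plancherel_cst.
move=> hf f2; have [fr fi] := hf; have [mr mi] := cintegrable_cmeasurable hf.
have [fr2 fi2] := L2_integral_lty f2.
have mF := cmeasurable_fourierL1 hf.
have [_ mopp opp_int] := rescales_opp2.
have mFN : cmeasurable (fourierL1 f \o opp2) by exact: cmeasurable_comp.
have FN : sqnorm2 (fourierL1 f) = sqnorm2 (fourierL1 f \o opp2).
  rewrite /sqnorm2 (opp_int (fun w => (normc (fourierL1 f w) ^+ 2)%:E)) ?mul1e//.
    exact: measurable_EFin_normc_sqr.
  by move=> w; rewrite lee_fin sqr_ge0.
have mC (r : R * R -> R) : measurable_fun setT r -> measurable_fun setT (fun w =>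
    (cos_transform r w ^+ 2 + sin_transform r w ^+ 2)).
  by move=> m; apply: measurable_funD; apply: measurable_funX;
    [exact: measurable_cos_transform|exact: measurable_sin_transform].
(* Adding the values at [w] and [-w] cancels the cross terms between the
   transforms of the real and imaginary parts. *)
have dbl : (sqnorm2 (fourierL1 f) + sqnorm2 (fourierL1 f) =
   2%:E * ((fejer_mass R ^+ 2)%:E * sqnorm2 f))%E.
  transitivity (\int[leb2]_w ((normc (fourierL1 f w) ^+ 2)%:E +
      (normc ((fourierL1 f \o opp2) w) ^+ 2)%:E))%E.
    rewrite (integral_sqnormD mF mFN).
    move: FN; set A := sqnorm2 (_ \o _); set B := sqnorm2 _ => FN.
    by clearbody A B; rewrite FN.
  have P0 (r : R * R -> R) w : (0 <= (cos_transform r w ^+ 2 + sin_transform r w ^+ 2)%:E)%E.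
    by rewrite lee_fin addr_ge0 ?sqr_ge0.
  have mP (r : R * R -> R) : measurable_fun setT r -> measurable_fun setT (fun w =>
      (cos_transform r w ^+ 2 + sin_transform r w ^+ 2)%:E).
    by move=> mr'; apply/measurable_EFinP; exact: mC.
  transitivity (\int[leb2]_w (2%:E * ((cos_transform (Re' f) w ^+ 2 + sin_transform (Re' f) w ^+ 2)%:E +
      (cos_transform (Im' f) w ^+ 2 + sin_transform (Im' f) w ^+ 2)%:E)))%E.
    apply: eq_integral => w _; rewrite -!EFinD -EFinM !normc_sqr.
    rewrite -[(_ \o _) w]/(fourierL1 f (opp2 w)) !(Re_fourierL1 _ hf) !(Im_fourierL1 _ hf).
    rewrite !cos_transformN !(sin_transformN _ fr) !(sin_transformN _ fi).
    move: (cos_transform (Re' f) w) (cos_transform (Im' f) w).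
    move: (sin_transform (Re' f) w) (sin_transform (Im' f) w) => s1 s2 c1 c2.
    by congr EFin; ring.
  rewrite (integral2D (mP _ mr) (mP _ mi) (P0 _) (P0 _)).
  rewrite (plancherel_real mr fr fr2) (plancherel_real mi fi fi2) (sqnorm2_ReIm (conj mr mi)).
  apply: congr1; apply/esym/ge0_muleDr; by apply: integral_ge0 => x _; rewrite lee_fin sqr_ge0.
have : (2%:E * sqnorm2 (fourierL1 f) = 2%:E * ((fejer_mass R ^+ 2)%:E * sqnorm2 f))%E.
  by rewrite -dbl mule_natl mule2n.
move: (sqnorm2 (fourierL1 f)) (_ * sqnorm2 f)%E => y z.
move=> /(congr1 (fun y => (2^-1)%:E * y)%E).
by rewrite !muleA -!EFinM mulVf ?mul1e.
Qed.

Lemma L2_fourierL1 f : cintegrable f -> L2 f -> L2 (fourierL1 f).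
Proof.
move=> hf f2; apply/L2P; split; first exact: cmeasurable_fourierL1.
by rewrite sqnorm2_fourierL1// lte_mul_pinfty ?lee_fin ?sqr_ge0//; have /L2P[] := f2.
Qed.

End fourier_L1.

(** * Convergence in mean square and the Cauchy-Schwarz inequality *)

Section L2_convergence.
Local Open Scope complex_scope.
Context (R : realType).
Notation leb2 := (@leb2 R).
Implicit Types (f g h : R * R -> R[i]) (fs gs : nat -> R * R -> R[i]).
Implicit Types (a b c : R[i]) (x w : R * R) (k e : R) (n m : nat).

Lemma cvg0_le (u v : R^nat) : (forall n, 0 <= u n <= v n) ->
  v @ \oo --> (0 : R) -> u @ \oo --> (0 : R).
Proof.
move=> uv v0; apply: (@squeeze_cvgr _ _ _ _ (cst 0) v) => //; last exact: cvg_cst.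
exact: nearW.
Qed.

Lemma ipBl f g h : L2 f -> L2 g -> L2 h ->
  ip (fun x => f x - g x) h = ip f h - ip g h.
Proof.
move=> hf hg hh; rewrite /ip -RintegralB//; try exact: integrable_ip.
by apply: eq_Rintegral => x _; rewrite ReB ImB; ring.
Qed.

(** The nonnegative quadratic function [k |-> nrm2 (f + k g)] is evaluated at its minimiser; when
    [nrm2 g = 0] it is affine in [k], hence constant. *)
Lemma cauchy_schwarz f g : L2 f -> L2 g -> ip f g ^+ 2 <= nrm2 f * nrm2 g.
Proof.
move=> hf hg; have h k : 0 <= nrm2 f + 2 * k * ip f g + k ^+ 2 * nrm2 g.
  by rewrite -nrm2DZ// nrm2_ge0.
have [g0|gn0] := eqVneq (nrm2 g) 0.
  have [->|p0] := eqVneq (ip f g) 0; first by rewrite expr0n/= mulr_ge0 ?nrm2_ge0.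
  (* At this [k] the affine function would take the value [-1]. *)
  have := h (- (nrm2 f + 1) / (2 * ip f g)); rewrite g0 mulr0 addr0.
  rewrite (_ : 2 * _ * _ = - (nrm2 f + 1)); first by lra.
  by field.
have gp : 0 < nrm2 g by rewrite lt_neqAle eq_sym gn0 nrm2_ge0.
have := h (- ip f g / nrm2 g).
rewrite (_ : _ + _ = (nrm2 f * nrm2 g - ip f g ^+ 2) / nrm2 g); last by field.
by rewrite pmulr_lge0 ?invr_gt0// subr_ge0.
Qed.

Definition L2cvg fs f := [/\ forall n, L2 (fs n), L2 f &
  (fun n => nrm2 (fun x => fs n x - f x)) @ \oo --> (0 : R)].

Lemma L2cvgP fs f : (forall n, L2 (fs n)) -> L2 f ->
  L2cvg fs f <-> (fun n => sqnorm2 (fun x => (fs n x - f x)%R)) @ \oo --> (0 : \bar R)%E.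
Proof.
move=> hfs hf; rewrite (_ : (fun n => sqnorm2 _) =
    (fun n => (nrm2 (fun x => fs n x - f x))%:E)); last first.
  by apply/funext => n; rewrite sqnorm2_nrm2//; exact: L2B.
split=> [[_ _ cv]|cv]; first by apply: cvg_EFin => //; exact: nearW.
by split => //; exact: fine_cvg cv.
Qed.

Lemma L2cvg_cst f : L2 f -> L2cvg (fun=> f) f.
Proof.
move=> hf; split=> //; rewrite (_ : (fun n => _) = cst 0); first exact: cvg_cst.
apply/funext => n /=; rewrite /nrm2 (_ : (fun x => _) = (fun=> 0)).
  by rewrite (sqnorm2_eq0P (cmeasurable_cst _)).2//; exact: ae_forall.
by apply/funext => x; rewrite subrr.
Qed.

Lemma nrm2D_le2 f g : L2 f -> L2 g ->
  nrm2 (fun x => f x + g x) <= 2 * nrm2 f + 2 * nrm2 g.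
Proof.
move=> hf hg; rewrite -lee_fin EFinD !EFinM -!sqnorm2_nrm2//; last exact: L2D.
by apply: sqnorm2D_le2; exact: L2_cmeasurable.
Qed.

Lemma L2cvgD fs gs f g : L2cvg fs f -> L2cvg gs g ->
  L2cvg (fun n x => fs n x + gs n x) (fun x => f x + g x).
Proof.
move=> [hfs hf cf] [hgs hg cg]; split=> [n||]; [exact: L2D..|].
apply: (@cvg0_le _ (fun n => 2 * nrm2 (fun x => fs n x - f x) + 2 * nrm2 (fun x => gs n x - g x))).
  move=> n; rewrite nrm2_ge0/=.
  have := nrm2D_le2 (L2B (hfs n) hf) (L2B (hgs n) hg); congr (nrm2 _ <= _).
  by apply/funext => x; ring.
rewrite (_ : 0 = 2 * 0 + 2 * 0 :> R); last by rewrite mulr0 addr0.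
by apply: cvgD; apply: cvgM => //; exact: cvg_cst.
Qed.

Lemma L2cvgZ c fs f : L2cvg fs f -> L2cvg (fun n x => c * fs n x) (fun x => c * f x).
Proof.
move=> [hfs hf cf]; split=> [n||]; [exact: L2Z..|].
rewrite (_ : (fun n => _) = (fun n => normc c ^+ 2 * nrm2 (fun x => fs n x - f x))).
  by rewrite -(mulr0 (normc c ^+ 2)); apply: cvgM => //; exact: cvg_cst.
apply/funext => n; rewrite -nrm2Z; last exact: L2B.
by congr nrm2; apply/funext => x; rewrite mulrBr.
Qed.

Lemma L2cvgB fs gs f g : L2cvg fs f -> L2cvg gs g ->
  L2cvg (fun n x => fs n x - gs n x) (fun x => f x - g x).
Proof.
move=> hf /(L2cvgZ (-1)) hg; have := L2cvgD hf hg; congr L2cvg.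
  by apply/funext => n; apply/funext => x; rewrite mulN1r.
by apply/funext => x; rewrite mulN1r.
Qed.

Lemma L2cvg_ip fs f g : L2cvg fs f -> L2 g -> (fun n => ip (fs n) g) @ \oo --> ip f g.
Proof.
move=> [hfs hf cf] hg; apply/cvgrPdist_le => e e0.
have : (fun n => nrm2 (fun x => fs n x - f x) * nrm2 g) @ \oo --> (0 : R).
  by rewrite -(mul0r (nrm2 g)); apply: cvgM => //; exact: cvg_cst.
move=> /cvgrPdist_le/(_ _ (exprn_gt0 2 e0)); apply: filterS => n.
rewrite sub0r normrN ger0_norm ?mulr_ge0 ?nrm2_ge0// => ne.
rewrite -(@ler_pXn2r _ 2) ?nnegrE ?normr_ge0 ?(ltW e0)// real_normK ?num_real//.
rewrite -sqrrN opprB -ipBl//.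
exact: le_trans (cauchy_schwarz (L2B (hfs n) hf) hg) ne.
Qed.

Lemma L2cvg_nrm2 fs f : L2cvg fs f -> (fun n => nrm2 (fs n)) @ \oo --> nrm2 f.
Proof.
move=> cf; have [hfs hf cf0] := cf.
have cB := L2cvgB cf (L2cvg_cst hf).
have h0 : L2cvg (fun n x => fs n x - f x) (fun=> 0).
  by rewrite (_ : (fun=> 0) = (fun x => f x - f x))//; apply/funext => x; rewrite subrr.
rewrite (_ : (fun n => _) = (fun n => nrm2 f + 2 * ip (fun x => fs n x - f x) f +
    nrm2 (fun x => fs n x - f x))); last first.
  apply/funext => n; rewrite ipC -nrm2D//; last exact: L2B.
  by congr nrm2; apply/funext => x; rewrite addrC subrK.
have ip0 : ip (fun=> 0 : R[i]) f = 0.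
  rewrite (_ : (fun=> 0) = (fun x => f x - f x)) ?ipBl ?subrr//.
  by apply/funext => x; rewrite subrr.
rewrite (_ : nrm2 f = nrm2 f + 2 * ip (fun=> 0 : R[i]) f + 0); last first.
  by rewrite ip0 mulr0 !addr0.
apply: cvgD => //; apply: cvgD; last by apply: cvgM; [exact: cvg_cst|exact: L2cvg_ip].
by rewrite ip0 mulr0 !addr0; exact: cvg_cst.
Qed.

Lemma nrm2_eq0P f : L2 f -> nrm2 f = 0 <-> {ae leb2, forall x, f x = 0}.
Proof.
move=> hf; rewrite -sqnorm2_eq0P; last exact: L2_cmeasurable.
by rewrite sqnorm2_nrm2//; split => [->|[]].
Qed.

Lemma nrm2_ae_eq f g : L2 f -> L2 g -> {ae leb2, forall x, f x = g x} -> nrm2 f = nrm2 g.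
Proof. by move=> hf hg fg; rewrite /nrm2 (sqnorm2_ae_eq _ _ fg)//; exact: L2_cmeasurable. Qed.

Lemma ip_nrm2 f g : L2 f -> L2 g ->
  2 * ip f g = nrm2 (fun x => f x + g x) - nrm2 f - nrm2 g.
Proof. by move=> hf hg; rewrite nrm2D//; ring. Qed.

End L2_convergence.

(** * Extension of the transform to square integrable functions *)

Section fourier_L2.
Local Open Scope complex_scope.
Context (R : realType).
Notation leb2 := (@leb2 R).
Implicit Types (f g h : R * R -> R[i]) (fs gs hs : nat -> R * R -> R[i]).
Implicit Types (a b c : R[i]) (x w : R * R) (k e : R) (n m : nat).

Notation K := (plancherel_cst R).
#[local] Opaque fourierL1 plancherel_cst.

Lemma nrm2_fourierL1 f : cintegrable f -> L2 f ->
  nrm2 (fourierL1 f) = K * nrm2 f.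
Proof. by move=> hf f2; rewrite /nrm2 sqnorm2_fourierL1// fineM// sqnorm2_fin. Qed.

Lemma truncateE f n x : truncate f n x = (\1_(box n) x)%:C * f x.
Proof.
rewrite /truncate indicE in_box; case: ifP => _; last by rewrite mul0r.
by rewrite mul1r.
Qed.

Lemma normc_truncate f n x : normc (truncate f n x) <= normc (f x).
Proof.
rewrite /truncate; case: ifP => _ //.
by rewrite (_ : normc 0 = 0) ?normc_ge0//= expr0n/= addr0 sqrtr0.
Qed.

Lemma cmeasurable_real (r : R * R -> R) : measurable_fun setT r ->
  cmeasurable (fun x => (r x)%:C).
Proof. by move=> mr; split => //; exact: measurable_cst. Qed.

Lemma cmeasurable_truncate f n : cmeasurable f -> cmeasurable (truncate f n).
Proof.
move=> mf; rewrite (_ : truncate f n = (fun x => (\1_(box n) x)%:C * f x)); last first.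
  by apply/funext => x; rewrite truncateE.
apply: cmeasurableM => //; apply: cmeasurable_real; apply: measurable_indic.
exact: measurable_box.
Qed.

Lemma L2_dominated f g : cmeasurable f -> L2 g ->
  (forall x, normc (f x) <= normc (g x)) -> L2 f.
Proof.
move=> mf /L2P[mg gy] fg; apply/L2P; split => //.
apply: le_lt_trans gy; apply: sqnorm2_le => // x.
by rewrite -ler_normc.
Qed.

Lemma L2_truncate f n : L2 f -> L2 (truncate f n).
Proof.
move=> f2; apply: (L2_dominated _ f2); last exact: normc_truncate.
by apply: cmeasurable_truncate; exact: L2_cmeasurable.
Qed.

Lemma integrable_normc_sqr f : L2 f ->
  leb2.-integrable setT (EFin \o (fun x => normc (f x) ^+ 2)).
Proof.
move=> /L2P[mf fy]; apply/integrableP; split; first exact: measurable_EFin_normc_sqr.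
by under eq_integral do rewrite gee0_abs ?lee_fin ?sqr_ge0//.
Qed.

(** On the box [|f| <= 1 + |f|^2], and the box has finite measure. *)
Lemma cintegrable_truncate f n : L2 f -> cintegrable (truncate f n).
Proof.
move=> f2; have i1 : leb2.-integrable setT (EFin \o \1_(box n)).
  by apply: integrable_indic_lty; [exact: measurable_box|exact: box_lty].
apply: (cintegrable_le _ (integrableD_EFin i1 (integrable_normc_sqr f2))).
  by apply: cmeasurable_truncate; exact: L2_cmeasurable.
move=> x; rewrite /truncate indicE in_box; case: ifP => _ /=.
  by have := normc_ge0 (f x); have := sqr_ge0 (normc (f x) - 1); lra.
by rewrite expr0n/= addr0 sqrtr0 add0r sqr_ge0.
Qed.

Lemma L2cvg_truncate f : L2 f -> L2cvg (truncate f) f.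
Proof.
move=> f2; have mf := L2_cmeasurable f2.
apply/L2cvgP => // [n|]; first exact: L2_truncate.
apply: (@cvg_integral_dominated0 _ _ _ leb2 (fun n x => normc (truncate f n x - f x) ^+ 2)
  _ _ _ (integrable_normc_sqr f2)).
- move=> n; apply: measurable_normc_sqr; apply: cmeasurableB => //.
  exact: cmeasurable_truncate.
- move=> n x; rewrite sqr_ge0/=; rewrite /truncate; case: ifP => _.
    by rewrite subrr normc_sqr/= expr0n/= addr0 sqr_ge0.
  by rewrite sub0r !normc_sqr; case: (f x) => r i /=; rewrite !sqrrN.
- apply: ae_forall => x; apply: cvg_near_cst.
  have [N hN] : exists N : nat, `|x.1| + `|x.2| <= N%:R.
    exists (Num.bound (`|x.1| + `|x.2|)); apply/ltW.
    by apply: archi_boundP; rewrite addr_ge0.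
  exists N => // n /= Nn; rewrite /truncate.
  have h : `|x.1| + `|x.2| <= n%:R by rewrite (le_trans hN)// ler_nat.
  rewrite ifT; first by rewrite subrr normc_sqr/= expr0n/= addr0.
  by rewrite !(le_trans _ h)// ?lerDl ?lerDr.
Qed.

Lemma nrm2_fourierL1B f g : cintegrable f -> L2 f -> cintegrable g -> L2 g ->
  nrm2 (fun w => fourierL1 f w - fourierL1 g w) =
  K * nrm2 (fun x => f x - g x).
Proof.
move=> hf f2 hg g2; rewrite -nrm2_fourierL1; [|exact: cintegrableB|exact: L2B].
by congr nrm2; apply/funext => w; rewrite fourierL1B.
Qed.

(** The transforms of the truncations form a Cauchy sequence, since Plancherel's identity for
    integrable functions multiplies squared distances by [K]; completeness supplies the limit that
    [xget] picks. *)
Lemma is_fourier_fourier f : L2 f -> is_fourier f (fourier f).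
Proof.
move=> f2; rewrite [fourier f]/fourier; apply: xgetPex.
have tF n : L2 (fourierL1 (truncate f n)).
  by apply: L2_fourierL1; [exact: cintegrable_truncate|exact: L2_truncate].
have [g g2 cg] : exists2 g, L2 g &
    (fun n => sqnorm2 (fun w => (fourierL1 (truncate f n) w - g w)%R)) @ \oo --> (0 : \bar R)%E.
  apply: L2_complete => // e e0.
  have [_ _ /cvgrPdist_le ct] := L2cvg_truncate f2.
  have K0 := @plancherel_cst_gt0 R.
  (* Two truncation errors at most [e / (4 * K)] give [K (2 + 2) e / (4 K) = e]. *)
  have [N _ hN] := ct (e / (4 * K)) (divr_gt0 e0 (mulr_gt0 (ltr0n _ 4) K0)).
  exists N => m n Nm Nn; rewrite sqnorm2_nrm2; last exact: L2B.
  rewrite nrm2_fourierL1B; [|exact: cintegrable_truncate|exact: L2_truncate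
    |exact: cintegrable_truncate|exact: L2_truncate].
  have := hN m Nm; have := hN n Nn; rewrite /= !sub0r !normrN !ger0_norm ?nrm2_ge0//.
  move=> tn tm; rewrite lee_fin.
  have tmn : nrm2 (fun x => truncate f m x - truncate f n x) <=
      2 * nrm2 (fun x => truncate f m x - f x) + 2 * nrm2 (fun x => truncate f n x - f x).
    have := nrm2D_le2 (L2B (L2_truncate m f2) f2) (L2B f2 (L2_truncate n f2)).
    rewrite [X in _ + 2 * X](_ : _ = nrm2 (fun x => truncate f n x - f x)); last first.
      by rewrite /nrm2 sqnorm2BC.
    by congr (nrm2 _ <= _); apply/funext => x; rewrite addrA subrK.
  apply: (@le_trans _ _ (K * (4 * (e / (4 * K))))).
    rewrite ler_pM2l//; lra.
  rewrite le_eqVlt; apply/orP; left; apply/eqP.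
  by field; rewrite gt_eqF.
by exists g.
Qed.

#[local] Opaque fourier.

Lemma L2_fourier f : L2 f -> L2 (fourier f).
Proof. by move=> /is_fourier_fourier[]. Qed.

Lemma L2cvg_fourier_truncate f : L2 f ->
  L2cvg (fun n => fourierL1 (truncate f n)) (fourier f).
Proof.
move=> f2; have [F2 cF] := is_fourier_fourier f2.
have tF n : L2 (fourierL1 (truncate f n)).
  by apply: L2_fourierL1; [exact: cintegrable_truncate|exact: L2_truncate].
exact: (L2cvgP tF F2).2 cF.
Qed.

Lemma nrm2_fourier f : L2 f -> nrm2 (fourier f) = K * nrm2 f.
Proof.
move=> f2; have := L2cvg_nrm2 (L2cvg_fourier_truncate f2).
rewrite (_ : (fun n => _) = (fun n => K * nrm2 (truncate f n))).
  move=> h; apply: (cvg_unique _ h) => //; apply: cvgM; first exact: cvg_cst.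
  exact: L2cvg_nrm2 (L2cvg_truncate f2).
apply/funext => n; rewrite nrm2_fourierL1//; [exact: cintegrable_truncate|exact: L2_truncate].
Qed.

Lemma sqnorm2_fourier f : L2 f -> sqnorm2 (fourier f) = (K%:E * sqnorm2 f)%E.
Proof.
by move=> f2; rewrite !sqnorm2_nrm2//; [rewrite nrm2_fourier|exact: L2_fourier].
Qed.

(** The squared distance between the transforms of [truncate f n] and [hs n] is [K] times that
    between the functions, which tends to [0]. Rules valid for integrable functions thus carry over
    along any convenient approximating sequence, not only along truncations. *)
Lemma fourier_unique hs f g : (forall n, cintegrable (hs n)) -> L2cvg hs f ->
  L2cvg (fun n => fourierL1 (hs n)) g -> {ae leb2, forall w, fourier f w = g w}.
Proof.
move=> hi hf Fg; have [h2 f2 _] := hf; have [_ g2 _] := Fg.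
have tf := L2cvg_truncate f2.
apply/ae_eqB; apply/nrm2_eq0P; first by apply: L2B => //; exact: L2_fourier.
have c1 := L2cvg_nrm2 (L2cvgB (L2cvg_fourier_truncate f2) Fg).
apply: (cvg_unique _ c1) => //.
rewrite (_ : (fun n => _) = (fun n => K * nrm2 (fun x => truncate f n x - hs n x))).
  rewrite -(mulr0 K); apply: cvgM; first exact: cvg_cst.
  have := L2cvg_nrm2 (L2cvgB tf hf).
  rewrite (_ : nrm2 (fun x => f x - f x) = 0)//.
  by apply/nrm2_eq0P; [exact: L2B|apply: ae_forall => x; rewrite subrr].
apply/funext => n; rewrite nrm2_fourierL1B//; [exact: cintegrable_truncate|exact: L2_truncate].
Qed.

Lemma fourierD f g : L2 f -> L2 g ->
  {ae leb2, forall w, fourier (fun x => f x + g x) w = fourier f w + fourier g w}.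
Proof.
move=> f2 g2; apply: (@fourier_unique (fun n x => truncate f n x + truncate g n x)).
- by move=> n; apply: cintegrableD; exact: cintegrable_truncate.
- by apply: L2cvgD; exact: L2cvg_truncate.
- have := L2cvgD (L2cvg_fourier_truncate f2) (L2cvg_fourier_truncate g2).
  congr L2cvg; apply/funext => n; apply/funext => w.
  by rewrite fourierL1D//; exact: cintegrable_truncate.
Qed.

Lemma fourierZ c f : L2 f ->
  {ae leb2, forall w, fourier (fun x => c * f x) w = c * fourier f w}.
Proof.
move=> f2; apply: (@fourier_unique (fun n x => c * truncate f n x)).
- by move=> n; apply: cintegrableZ; exact: cintegrable_truncate.
- by apply: L2cvgZ; exact: L2cvg_truncate.
- have := L2cvgZ c (L2cvg_fourier_truncate f2).
  congr L2cvg; apply/funext => n; apply/funext => w.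
  by rewrite fourierL1Z//; exact: cintegrable_truncate.
Qed.

Lemma fourierB f g : L2 f -> L2 g ->
  {ae leb2, forall w, fourier (fun x => f x - g x) w = fourier f w - fourier g w}.
Proof.
move=> f2 g2; have := fourierD f2 (L2Z (-1) g2).
have -> : (fun x => f x + -1 * g x) = (fun x => f x - g x).
  by apply/funext => x; rewrite mulN1r.
by move=> hD; apply: ae_imp2 hD (fourierZ (-1) g2) => w -> ->; rewrite mulN1r.
Qed.

(** Polarisation: the norm identities for [f], [g] and [f + g] determine the inner product, the
    transform of the sum being the sum of the transforms almost everywhere. *)
Lemma ip_fourier f g : L2 f -> L2 g ->
  ip (fourier f) (fourier g) = K * ip f g.
Proof.
move=> f2 g2; have F2 := L2_fourier f2; have G2 := L2_fourier g2.
have e : nrm2 (fun w => fourier f w + fourier g w) =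
    K * nrm2 (fun x => f x + g x).
  rewrite -nrm2_fourier; last exact: L2D.
  apply/esym/nrm2_ae_eq; [exact/L2_fourier/L2D|exact: L2D|exact: fourierD].
have key (A B C a' b' c' p q k : R) : A = k * a' -> B = k * b' -> C = k * c' ->
    2 * p = C - A - B -> 2 * q = c' - a' - b' -> p = k * q.
  move=> -> -> -> hp hq; apply: (@mulfI _ 2) => //.
  by rewrite hp mulrCA hq !mulrBr.
exact: key (nrm2_fourier f2) (nrm2_fourier g2) e (ip_nrm2 F2 G2) (ip_nrm2 f2 g2).
Qed.

Lemma inner_ip f g : L2 f -> L2 g ->
  inner f g = ip f g +i* ip f (fun x => 'i * g x).
Proof.
move=> f2 g2; apply: complex_eqP => /=; apply: eq_Rintegral => x _;
  case: (f x) => ? ?; case: (g x) => ? ? /=; ring.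
Qed.

Lemma ip_ae_eq f g h : cmeasurable f -> cmeasurable g -> cmeasurable h ->
  {ae leb2, forall x, f x = g x} -> ip h f = ip h g.
Proof.
move=> [mfr mfi] [mgr mgi] [mhr mhi] fg; rewrite /ip /Rintegral; congr fine.
apply: ae_eq_integral => //.
- by apply/measurable_EFinP; apply: measurable_funD; exact: measurable_funM.
- by apply/measurable_EFinP; apply: measurable_funD; exact: measurable_funM.
- by apply: ae_imp fg => x -> _.
Qed.

(** The imaginary part is the real part taken against ['i * g], and the transform commutes with
    multiplication by ['i] almost everywhere. *)
Lemma inner_fourier f g : L2 f -> L2 g ->
  inner (fourier f) (fourier g) = K%:C * inner f g.
Proof.
move=> f2 g2; have F2 := L2_fourier f2; have G2 := L2_fourier g2.
rewrite !inner_ip// ip_fourier//.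
have -> : ip (fourier f) (fun x => 'i * fourier g x) =
    ip (fourier f) (fourier (fun x => 'i * g x)).
  apply: ip_ae_eq.
  - exact/L2_cmeasurable/L2Z.
  - exact/L2_cmeasurable/L2_fourier/L2Z.
  - exact: L2_cmeasurable.
  - by apply: ae_imp (fourierZ 'i g2) => x ->.
rewrite ip_fourier//; last exact: L2Z.
by apply: complex_eqP; rewrite ?ReM ?ImM /=; ring.
Qed.

End fourier_L2.

(** * Orthogonal projection onto the cone space *)

Section orthogonal_projection.
Local Open Scope complex_scope.
Context (R : realType).
Notation leb2 := (@leb2 R).
Implicit Types (f g h : R * R -> R[i]) (V : set (R * R -> R[i])).
Implicit Types (a b c : R[i]) (x w : R * R) (k e : R) (n m : nat).
#[local] Opaque fourierL1 fourier plancherel_cst.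

(** A quadratic function with a minimum at [0] has no linear term. *)
Lemma quadratic_ge0_eq0 (p q : R) : (forall k, 0 <= 2 * k * p + k ^+ 2 * q) -> p = 0.
Proof.
move=> h; apply/eqP; apply: contraT => p0.
have q0 : 0 <= q by have := h 1; have := h (-1); rewrite sqrrN expr1n; lra.
have pp : 0 < p ^+ 2 by rewrite lt_neqAle eq_sym sqrf_eq0 p0 sqr_ge0.
(* Taking [q + 1] for [q] avoids a zero denominator, and the value is still negative. *)
have := h (- p / (q + 1)).
rewrite (_ : _ + _ = - (p ^+ 2 * (q + 2)) / (q + 1) ^+ 2); last by field; rewrite gt_eqF// ltr_wpDl.
rewrite pmulr_lge0 ?invr_gt0 ?exprn_gt0 ?ltr_wpDl// oppr_ge0 leNgt pmulr_rgt0//.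
by rewrite ltr_wpDl.
Qed.

Lemma ip_iE f g : ip f (fun x => 'i * g x) = ip (fun x => - 'i * f x) g.
Proof.
by apply: eq_Rintegral => x _; case: (f x) => ? ?; case: (g x) => ? ? /=; ring.
Qed.

Section hilbert.
Variable V : set (R * R -> R[i]).
Hypothesis V_L2 : forall f, V f -> L2 f.
Hypothesis V0 : V (fun=> 0).
Hypothesis VD : forall f g, V f -> V g -> V (fun x => f x + g x).
Hypothesis VZ : forall c f, V f -> V (fun x => c * f x).
Hypothesis V_closed : forall fs f, (forall n, V (fs n)) -> L2cvg fs f -> V f.

(** A minimising sequence for the distance to [psi] is Cauchy, because midpoints stay in [V]. Its
    limit is in [V] by closedness and attains the infimum; first-order optimality in every direction
    of [V] is orthogonality. *)
Lemma orth_proj_ex psi : L2 psi -> exists g, is_orth_proj V psi g.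
Proof.
move=> psi2.
pose D := [set nrm2 (fun x => psi x - h x) | h in V].
have D0 : has_inf D.
  split; first by exists (nrm2 (fun x => psi x - 0)), (fun=> 0).
  by exists 0 => _ [h _ <-]; exact: nrm2_ge0.
have dD h : V h -> inf D <= nrm2 (fun x => psi x - h x).
  by move=> Vh; apply: ge_inf; [exact: D0.2|exists h].
have /choice[hs hsP] : forall n, exists h, V h /\
    nrm2 (fun x => psi x - h x) < inf D + n.+1%:R^-1.
  move=> n; have n0 : 0 < n.+1%:R^-1 :> R by rewrite invr_gt0.
  have [_ [h Vh <-] hlt] := inf_adherent n0 D0.
  by exists h.
have hV n : V (hs n) by have [] := hsP n.
have h2 n : L2 (hs n) by exact: V_L2.
have par m n : nrm2 (fun x => hs m x - hs n x) <= 2 * m.+1%:R^-1 + 2 * n.+1%:R^-1.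
  pose p x := psi x - hs m x; pose q x := psi x - hs n x.
  have p2 : L2 p by exact: L2B.
  have q2 : L2 q by exact: L2B.
  have Vmid : V (fun x => (2^-1)%:C * (hs m x + hs n x)) by apply: VZ; exact: VD.
  (* The midpoint is at squared distance at least [inf D], so the identity [|p - q|^2 = 2 |p|^2 + 2
     |q|^2 - 4 |(p + q) / 2|^2] leaves only the two slacks. *)
  have := dD _ Vmid.
  have -> : nrm2 (fun x => psi x - (2^-1)%:C * (hs m x + hs n x)) =
      2^-1 ^+ 2 * nrm2 (fun x => p x + 1%:C * q x).
    have -> : 2^-1 ^+ 2 = normc ((2^-1)%:C : R[i]) ^+ 2 :> R.
      by rewrite normc_sqr/= expr0n/= addr0.
    rewrite -nrm2Z; last by apply: L2D => //; exact: L2Z.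
    congr nrm2; apply/funext => x; rewrite /p /q; move: (psi x) (hs m x) (hs n x) => [a1 a2] [b1 b2] [c1 c2].
    by apply: complex_eqP => /=; field.
  have -> : nrm2 (fun x => hs m x - hs n x) = nrm2 (fun x => p x + (-1)%:C * q x).
    rewrite /nrm2 sqnorm2BC; congr fine; congr sqnorm2; apply/funext => x.
    rewrite /p /q; move: (psi x) (hs m x) (hs n x) => [a1 a2] [b1 b2] [c1 c2].
    by apply: complex_eqP => /=; ring.
  rewrite !nrm2DZ//.
  have [_ hm] := hsP m; have [_ hn] := hsP n.
  rewrite -/p -/q in hm hn.
  move: (nrm2 p) (nrm2 q) (ip p q) (inf D) hm hn => np nq ipq d.
  move: (m.+1%:R^-1) (n.+1%:R^-1) => i j; lra.
have [g g2 cg] : exists2 g, L2 g &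
    (fun n => sqnorm2 (fun x => (hs n x - g x)%R)) @ \oo --> (0 : \bar R)%E.
  apply: L2_complete => // e e0.
  have e4 : 0 < e / 4 by rewrite divr_gt0.
  have [N _ hN] := (cvgrPdist_le _ _).1 (@cvg_harmonic R) _ e4.
  exists N => m n Nm Nn; rewrite sqnorm2_nrm2; last exact: L2B.
  rewrite lee_fin (le_trans (par m n))//.
  have := hN m Nm; have := hN n Nn; rewrite /= !sub0r !normrN !ger0_norm ?invr_ge0//.
  by move: (m.+1%:R^-1) (n.+1%:R^-1) => i j; lra.
have hg : L2cvg hs g by apply/L2cvgP.
have Vg : V g by exact: V_closed hg.
have e2 : L2 (fun x => psi x - g x) by exact: L2B.
have ed : nrm2 (fun x => psi x - g x) <= inf D.
  have c1 := L2cvg_nrm2 (L2cvgB (L2cvg_cst psi2) hg).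
  have c2 : (fun n => inf D + n.+1%:R^-1) @ \oo --> inf D + 0.
    by apply: cvgD; [exact: cvg_cst|exact: cvg_harmonic].
  rewrite addr0 in c2.
  apply: ler_cvg_to c1 c2 _; apply: nearW => n.
  by have [_ /ltW] := hsP n.
have orth h : V h -> ip (fun x => psi x - g x) h = 0.
  move=> Vh; apply: (@quadratic_ge0_eq0 _ (nrm2 h)) => k.
  have := dD _ (VD Vg (VZ (- k)%:C Vh)).
  rewrite (_ : (fun x => psi x - (g x + (- k)%:C * h x)) =
    (fun x => (psi x - g x) + k%:C * h x)); last first.
    apply/funext => x; move: (psi x) (g x) (h x) => [a1 a2] [b1 b2] [c1 c2].
    by apply: complex_eqP => /=; ring.
  rewrite nrm2DZ//; last exact: V_L2.
  by move: ed; move: (nrm2 (fun x => psi x - g x)) (ip _ _) (nrm2 h) => y1 y2 y3; lra.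
exists g; split => // h Vh; rewrite inner_ip//; last exact: V_L2.
by rewrite !orth//; exact: VZ.
Qed.

Lemma orth_projP psi : L2 psi -> is_orth_proj V psi (orth_proj V psi).
Proof. by move=> psi2; apply: xgetPex; exact: orth_proj_ex. Qed.

(** The error [psi - P psi] is orthogonal to [f], which removes the projection from the
    coefficients. For the imaginary part the multiplication by ['i] is moved onto [f], which stays
    in [V]. *)
Lemma inner_orth_proj f psi : V f -> L2 psi ->
  inner f (orth_proj V psi) = inner f psi.
Proof.
move=> Vf psi2; have [Vp hp] := orth_projP psi2.
have f2 := V_L2 Vf; have p2 := V_L2 Vp.
have key h : V h -> ip h (orth_proj V psi) = ip h psi.
  move=> Vh; have h2 := V_L2 Vh.
  have := congr1 (@complex.Re R) (hp h Vh); rewrite inner_ip//; last exact: L2B.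
  by rewrite /= ipBl// => /eqP; rewrite subr_eq0 => /eqP; move=> e; rewrite ipC -e ipC.
by rewrite !inner_ip// !ip_iE !key//; exact: VZ.
Qed.

End hilbert.

Lemma sqnorm2_realM_le (r : R * R -> R) f : measurable_fun setT r ->
  (forall x, r x ^+ 2 <= 1) -> cmeasurable f ->
  (sqnorm2 (fun x => (r x)%:C * f x)%R <= sqnorm2 f)%E.
Proof.
move=> mr r1 mf; apply: sqnorm2_le => //.
  by apply: cmeasurableM => //; exact: cmeasurable_real.
move=> x; rewrite normc_sqrM ler_piMl ?sqr_ge0//.
by rewrite normc_sqr/= expr0n/= addr0.
Qed.

Lemma L2_realM (r : R * R -> R) f : measurable_fun setT r ->
  (forall x, r x ^+ 2 <= 1) -> L2 f -> L2 (fun x => (r x)%:C * f x).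
Proof.
move=> mr r1 /L2P[mf fy]; apply/L2P; split.
  by apply: cmeasurableM => //; exact: cmeasurable_real.
exact: le_lt_trans (sqnorm2_realM_le mr r1 mf) fy.
Qed.

(** * The cone space is a closed subspace *)

Section cone.
Variables (u v : R).

Let V := @L2_cone R u v.

Lemma L2_cone_L2 f : V f -> L2 f. Proof. by case. Qed.

Lemma L2_cone0 : V (fun=> 0).
Proof.
split; first exact: L20.
apply: (@ae_imp _ _ _ leb2 (fun w => fourier (fun=> 0) w = 0)) => //.
by apply/nrm2_eq0P; [exact/L2_fourier/L20|rewrite nrm2_fourier ?(nrm2_eq0P (L20 R)).2 ?mulr0//;
  [exact: ae_forall|exact: L20]].
Qed.

Lemma L2_coneD f g : V f -> V g -> V (fun x => f x + g x).
Proof.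
move=> [f2 f0] [g2 g0]; split; first exact: L2D.
have h : {ae leb2, forall w, ~ cone u v w -> fourier f w + fourier g w = 0}.
  by apply: ae_imp2 f0 g0 => w p q nw; rewrite p// q// addr0.
by apply: ae_imp2 h (fourierD f2 g2) => w p -> /p.
Qed.

Lemma L2_coneZ c f : V f -> V (fun x => c * f x).
Proof.
move=> [f2 f0]; split; first exact: L2Z.
by apply: ae_imp2 f0 (fourierZ c f2) => w p -> /p ->; rewrite mulr0.
Qed.

Lemma measurable_cone : measurable (@cone R u v).
Proof.
rewrite (_ : cone u v = [set x | u <= `|x.1|] `&` [set x | `|x.2| - v * `|x.1| <= 0]).
  have m1 : measurable_fun setT (fun x : R * R => `|x.1|).
    by apply: measurableT_comp => //; exact: measurable_fst.
  have m2 : measurable_fun setT (fun x : R * R => `|x.2|).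
    by apply: measurableT_comp => //; exact: measurable_snd.
  apply: measurableI.
    by rewrite -[X in measurable X]setTI; exact: measurable_fun_le.
  rewrite -[X in measurable X]setTI; apply: measurable_fun_le => //.
  by apply: measurable_funB => //; exact: measurable_funM.
by apply/seteqP; split => x /=; rewrite /cone/= subr_le0.
Qed.

(** Off the cone the transforms of the [fs n] vanish, hence the part of the transform of [f] there
    has squared norm at most [K * nrm2 (fs n - f)], which tends to [0]. *)
Lemma L2_cone_closed fs f : (forall n, V (fs n)) -> L2cvg fs f -> V f.
Proof.
move=> Vfs [hfs hf cf]; split => //.
pose ind x : R := \1_(~` cone u v) x.
have mind : measurable_fun setT ind.
  by apply: measurable_indic; apply: measurableC; exact: measurable_cone.
have ind01 x : ind x ^+ 2 <= 1.
  by rewrite /ind indicE; case: (_ \in _); rewrite ?expr1n// expr0n.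
pose g w := (ind w)%:C * fourier f w.
have F2 := L2_fourier hf.
have mg : cmeasurable g.
  by apply: cmeasurableM; [exact: cmeasurable_real|exact: L2_cmeasurable].
have g2 : L2 g := L2_realM mind ind01 F2.
have gle n : nrm2 g <= plancherel_cst R * nrm2 (fun x => fs n x - f x).
  have B2 := L2B (hfs n) hf; have FB2 := L2_fourier B2.
  rewrite -(nrm2_fourier B2) -lee_fin -(sqnorm2_nrm2 FB2).
  pose q w := (ind w)%:C * fourier (fun x => fs n x - f x) w.
  have mq : cmeasurable q.
    by apply: cmeasurableM; [exact: cmeasurable_real|exact: L2_cmeasurable].
  have gq : {ae leb2, forall w, - g w = q w}.
    have [_ f0] := Vfs n; apply: ae_imp2 f0 (fourierB (hfs n) hf) => w f0 e.
    rewrite /q /g e /ind indicE; case: (boolP (w \in _)) => [|_]; last by rewrite !mul0r oppr0.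
    by rewrite inE => /f0 ->; rewrite sub0r mulrN.
  have mNg : cmeasurable (fun w => - g w).
    by have [mgr mgi] := cmeasurableM (cmeasurable_cst (-1)) mg; split;
      [move: mgr|move: mgi]; congr measurable_fun; apply/funext => w; rewrite mulN1r.
  have gqE := sqnorm2_ae_eq mNg mq gq; rewrite sqnorm2N in gqE.
  have qle := sqnorm2_realM_le mind ind01 (L2_cmeasurable FB2).
  by rewrite -(sqnorm2_nrm2 g2) gqE; exact: qle.
have g0 : nrm2 g = 0.
  apply/eqP; rewrite eq_le nrm2_ge0 andbT.
  have c1 : (fun n => plancherel_cst R * nrm2 (fun x => fs n x - f x)) @ \oo --> (0 : R).
    by rewrite -(mulr0 (plancherel_cst R)); apply: cvgM => //; exact: cvg_cst.
  by apply: ler_cvg_to (cvg_cst (nrm2 g)) c1 _; exact: nearW.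
have /(nrm2_eq0P g2) := g0; apply: ae_imp => w; rewrite /g /ind indicE => gw nw.
by move: gw; rewrite mem_set// mul1r.
Qed.

End cone.

End orthogonal_projection.

(** * Shearlet coefficients *)

Section atoms.
Local Open Scope complex_scope.
Context (R : realType).
Notation leb2 := (@leb2 R).
Implicit Types (f g h psi : R * R -> R[i]) (phi : R * R -> R * R).
Implicit Types (b c : R[i]) (x w t : R * R) (a s k e : R) (n m : nat).
#[local] Opaque fourierL1 fourier plancherel_cst.

Lemma sqnorm2_comp phi k f : rescales leb2 phi k -> cmeasurable f ->
  sqnorm2 (f \o phi) = (k%:E * sqnorm2 f)%E.
Proof.
move=> [k0 mphi phiE] mf; rewrite /sqnorm2.
rewrite -(phiE (fun x => (normc (f x) ^+ 2)%:E))//; first exact: measurable_EFin_normc_sqr.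
by move=> x; rewrite lee_fin sqr_ge0.
Qed.

Lemma L2_comp phi k f : rescales leb2 phi k -> L2 f -> L2 (f \o phi).
Proof.
move=> hphi /L2P[mf fy]; apply/L2P; split.
  by have [_ mphi _] := hphi; exact: cmeasurable_comp.
by rewrite (sqnorm2_comp hphi)// lte_mul_pinfty// lee_fin; have [] := hphi.
Qed.

Lemma nrm2_comp phi k f : rescales leb2 phi k -> L2 f -> nrm2 (f \o phi) = k * nrm2 f.
Proof.
move=> hphi f2; rewrite /nrm2 (sqnorm2_comp hphi); last exact: L2_cmeasurable.
by rewrite fineM// sqnorm2_fin.
Qed.

Lemma L2cvg_comp phi k fs f : rescales leb2 phi k -> L2cvg fs f ->
  L2cvg (fun n => fs n \o phi) (f \o phi).
Proof.
move=> hphi [hfs hf cf]; split=> [n||]; [exact: (L2_comp hphi)..|].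
rewrite (_ : (fun n => _) = (fun n => k * nrm2 (fun x => fs n x - f x))).
  by rewrite -(mulr0 k); apply: cvgM => //; exact: cvg_cst.
by apply/funext => n; rewrite -(nrm2_comp hphi)//; exact: L2B.
Qed.

Lemma sqnorm2_unimodular (u f : R * R -> R[i]) : (forall x, normc (u x) = 1) ->
  sqnorm2 (fun x => u x * f x) = sqnorm2 f.
Proof.
by move=> u1; apply: eq_integral => x _; rewrite normc_sqrM u1 expr1n mul1r.
Qed.

Lemma L2_unimodular (u f : R * R -> R[i]) : cmeasurable u -> (forall x, normc (u x) = 1) ->
  L2 f -> L2 (fun x => u x * f x).
Proof.
move=> mu u1 /L2P[mf fy]; apply/L2P; split; first exact: cmeasurableM.
by rewrite sqnorm2_unimodular.
Qed.

Lemma L2cvg_unimodular (u : R * R -> R[i]) fs f : cmeasurable u ->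
  (forall x, normc (u x) = 1) -> L2cvg fs f ->
  L2cvg (fun n x => u x * fs n x) (fun x => u x * f x).
Proof.
move=> mu u1 [hfs hf cf]; split=> [n||]; [exact: L2_unimodular..|].
rewrite (_ : (fun n => _) = (fun n => nrm2 (fun x => fs n x - f x)))//.
apply/funext => n; rewrite /nrm2 -[in RHS](sqnorm2_unimodular _ u1).
by congr (fine (sqnorm2 _)); apply/funext => x; rewrite mulrBr.
Qed.

Lemma cintegrable_comp phi k f : rescales leb2 phi k -> cintegrable f ->
  cintegrable (f \o phi).
Proof. by move=> hphi [fr fi]; split; [exact: (rescales_integrable hphi fr)|exact: (rescales_integrable hphi fi)]. Qed.

Lemma cintegral_comp phi k f : rescales leb2 phi k -> cintegrable f ->
  cintegral (f \o phi) = k%:C * cintegral f.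
Proof.
move=> hphi [fr fi]; apply: complex_eqP; rewrite ?ReM ?ImM /= mul0r ?addr0 ?subr0.
  exact: (rescales_Rintegral hphi fr).
exact: (rescales_Rintegral hphi fi).
Qed.

Lemma cexpiD (x y : R) : cexpi (x + y) = cexpi x * cexpi y.
Proof. by apply: complex_eqP; rewrite ?ReM ?ImM /= ?cosD ?sinD//; ring. Qed.

Section atom.
Variables (a s : R) (a0 : 0 < a).

Definition atom_map t x : R * R :=
  ((x.1 - t.1 + s * (x.2 - t.2)) / a, (x.2 - t.2) / a `^ (1 / 2)).

(** The inverse transpose of the linear part of [atom_map]. Its orbit in [(a, s)] is what the orbit
    integral runs over. *)
Definition dual_map w : R * R := (a * w.1, Num.sqrt a * (w.2 - s * w.1)).

Let r := Num.sqrt a.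
Let r0 : 0 < r. Proof. by rewrite sqrtr_gt0. Qed.

Lemma powR_half_sqrt : a `^ (1 / 2) = Num.sqrt a.
Proof. by rewrite mul1r powR12_sqrt// ltW. Qed.

Lemma sqr_powR34 : (a `^ (3 / 4)) ^+ 2 = a * Num.sqrt a.
Proof.
rewrite -powR_mulrn ?powR_ge0// -powRrM.
have -> : 3 / 4 * 2 = 1 + 1 / 2 :> R by field.
by rewrite powRD ?gt_eqF ?implybT// powRr1 ?ltW// powR_half_sqrt.
Qed.

Lemma powRN34 : a `^ (- (3 / 4)) = (a `^ (3 / 4))^-1.
Proof. by rewrite powRN. Qed.

Lemma rescales_atom_map t : rescales leb2 (atom_map t) (a * r).
Proof.
have aV : a^-1 != 0 by rewrite invr_eq0 gt_eqF.
have rV : r^-1 != 0 by rewrite invr_eq0 gt_eqF.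
have := rescales_upper (s / a) (- (t.1 + s * t.2) / a) (- t.2 / r) aV rV.
rewrite -invfM normfV invrK gtr0_norm ?mulr_gt0//; congr rescales.
by apply/funext => x; rewrite /atom_map powR_half_sqrt -/r; congr (_, _); field; rewrite gt_eqF.
Qed.

Lemma rescales_dual_map : rescales leb2 dual_map (a * r)^-1.
Proof.
have aV : a != 0 by rewrite gt_eqF.
have rV : r != 0 by rewrite gt_eqF.
have := rescales_lower (- (r * s)) 0 0 aV rV.
rewrite gtr0_norm ?mulr_gt0//; congr rescales.
by apply/funext => x; rewrite /dual_map -/r; congr (_, _); ring.
Qed.

Lemma L2_shearlet_atom psi t : L2 psi -> L2 (shearlet_atom psi a s t).
Proof. by move=> psi2; apply: L2Z; exact: L2_comp (rescales_atom_map t) psi2. Qed.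

Lemma phase_atom_map x t w : phase x w = phase t w + phase (atom_map t x) (dual_map w).
Proof.
rewrite /phase /atom_map /dual_map/= powR_half_sqrt -/r.
by move: pi => p; field; rewrite !gt_eqF.
Qed.

(** The Jacobian [a sqrt a = (a^(3/4))^2] against the normalisation [a^(-3/4)] leaves the factor
    [a^(3/4)]; the translation becomes a phase. *)
Lemma fourierL1_atom psi t w : cintegrable psi ->
  fourierL1 (shearlet_atom psi a s t) w =
  (a `^ (3 / 4))%:C * (cexpi (- phase t w) * fourierL1 psi (dual_map w)).
Proof.
move=> hpsi; rewrite fourierL1E.
pose H y := psi y * cexpi (- phase y (dual_map w)).
have hH : cintegrable H by exact: cintegrable_fourierL1.
have hHc := cintegrable_comp (rescales_atom_map t) hH.
transitivity (cintegral (fun x => ((a `^ (- (3 / 4)))%:C * cexpi (- phase t w)) *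
    (H \o atom_map t) x)).
  congr cintegral; apply/funext => x; rewrite /H /= (phase_atom_map x t w).
  by rewrite opprD cexpiD /shearlet_atom -/(atom_map t x); move: (cexpi _) (cexpi _) => ? ?; ring.
rewrite cintegralZ// (cintegral_comp (rescales_atom_map t) hH) fourierL1E -/H.
move: (cexpi _) (cintegral _) => c1 c2.
have b0 : a `^ (3 / 4) != 0 by rewrite gt_eqF// powR_gt0.
have -> : a * r = (a `^ (3 / 4)) ^+ 2 by rewrite sqr_powR34.
rewrite powRN34; move: (a `^ (3 / 4)) b0 => b b0.
have e : (b^-1)%:C * (b ^+ 2)%:C = b%:C :> R[i].
  by apply: complex_eqP => /=; field.
by rewrite mulrACA e.
Qed.

(** The approximation uses the atoms of the truncations, not the truncations of the atom: their
    transforms are explicit. *)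
Lemma fourier_atom psi t : L2 psi -> {ae leb2, forall w,
  fourier (shearlet_atom psi a s t) w =
  (a `^ (3 / 4))%:C * (cexpi (- phase t w) * fourier psi (dual_map w))}.
Proof.
move=> psi2; apply: (@fourier_unique _ (fun n => shearlet_atom (truncate psi n) a s t)).
- move=> n; apply: cintegrableZ; apply: cintegrable_comp (rescales_atom_map t) _.
  exact: cintegrable_truncate.
- apply: L2cvgZ; apply: (L2cvg_comp (rescales_atom_map t)).
  exact: L2cvg_truncate.
- have mt : cmeasurable (fun w => cexpi (- phase t w)).
    apply: cmeasurable_cexpi; apply: measurableT_comp => //.
    exact: (measurableT_comp (@measurable_phase R)
      (measurable_fun_pair (@measurable_cst _ _ _ _ setT t) (@measurable_id _ _ setT))).
  have := L2cvgZ (a `^ (3 / 4))%:C (L2cvg_unimodular mt (fun w => normc_cexpi (- phase t w))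
    (L2cvg_comp rescales_dual_map (L2cvg_fourier_truncate psi2))).
  congr L2cvg; apply/funext => n; apply/funext => w.
  by rewrite fourierL1_atom//; exact: cintegrable_truncate.
Qed.

End atom.

(** By the convention that a nonzero power of [0] is [0]. The parameter set of the frame contains
    the edge [a = 0]. *)
Lemma shearlet_atom0 psi s t : shearlet_atom psi 0 s t = (fun=> 0).
Proof.
apply/funext => x; rewrite /shearlet_atom powR0 ?mul0r//.
Qed.

End atoms.

(** * Coefficients as Fourier transforms in the translation parameter *)

Section analysis_coefficients.
Local Open Scope complex_scope.
Context (R : realType).
Notation leb2 := (@leb2 R).
Implicit Types (f g h psi : R * R -> R[i]).
Implicit Types (b c : R[i]) (x w t : R * R) (a s k e : R) (n m : nat).
#[local] Opaque fourierL1 fourier plancherel_cst.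
Notation K := (plancherel_cst R).

Lemma conjcM b c : conjc (b * c) = conjc b * conjc c.
Proof. by apply: complex_eqP; rewrite ?ReM ?ImM !(ReJ, ImJ) ?ReM ?ImM; ring. Qed.

Lemma conjc_real k : conjc k%:C = k%:C :> R[i].
Proof. by apply: complex_eqP => //=; rewrite oppr0. Qed.

Lemma conjc_cexpi k : conjc (cexpi k) = cexpi (- k).
Proof. by apply: complex_eqP => /=; rewrite ?cosN ?sinN. Qed.

Lemma normc_conjc c : normc (conjc c) = normc c.
Proof. by case: c => r i /=; rewrite sqrrN. Qed.

Lemma cintegrable_L2M f g : L2 f -> L2 g -> cintegrable (fun x => f x * conjc (g x)).
Proof.
move=> f2 g2; have i := integrableD_EFin (integrable_normc_sqr f2) (integrable_normc_sqr g2).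
apply: (cintegrable_le _ i).
  by apply: cmeasurableM; [|apply: cmeasurable_conj]; exact: L2_cmeasurable.
move=> x; rewrite normcM normc_conjc.
move: (normc (f x)) (normc (g x)) (normc_ge0 (f x)) (normc_ge0 (g x)) => p q p0 q0.
have := sqr_ge0 (p - q); nra.
Qed.

Lemma cintegral_ae_eq f g : cmeasurable f -> cmeasurable g ->
  {ae leb2, forall x, f x = g x} -> cintegral f = cintegral g.
Proof.
move=> [fr fi] [gr gi] fg; apply: complex_eqP; rewrite /= /Rintegral; congr fine;
  (apply: ae_eq_integral => //; [exact/measurable_EFinP|exact/measurable_EFinP|]).
- by apply: ae_imp fg => x -> _.
- by apply: ae_imp fg => x -> _.
Qed.

Lemma phase_opp2 w t : - phase w (opp2 t) = phase t w.
Proof. by rewrite /phase /opp2/=; ring. Qed.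

Definition coef f psi a s w : R[i] :=
  fourier f w * conjc (fourier psi (dual_map a s w)).

Lemma cintegrable_coef f psi a s : 0 < a -> L2 f -> L2 psi ->
  cintegrable (coef f psi a s).
Proof.
move=> a0 f2 psi2; apply: cintegrable_L2M; first exact: L2_fourier.
exact: L2_comp (rescales_dual_map s a0) (L2_fourier psi2).
Qed.

(** Plancherel moves the coefficient to the frequency side; the conjugate of the phase [e(- t.w)] is
    then the kernel of a Fourier transform evaluated at [- t]. *)
Lemma inner_atom f psi a s t : 0 < a -> L2 f -> L2 psi ->
  inner f (shearlet_atom psi a s t) =
  (K^-1 * a `^ (3 / 4))%:C * fourierL1 (coef f psi a s) (opp2 t).
Proof.
move=> a0 f2 psi2; have A2 := L2_shearlet_atom s a0 t psi2.
have hc := cintegrable_coef s a0 f2 psi2.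
have mc := cintegrable_cmeasurable hc.
have e : inner (fourier f) (fourier (shearlet_atom psi a s t)) =
    (a `^ (3 / 4))%:C * fourierL1 (coef f psi a s) (opp2 t).
  rewrite fourierL1E -cintegralZ; last exact: cintegrable_fourierL1.
  apply: cintegral_ae_eq.
  - apply: cmeasurableM; last apply: cmeasurable_conj; exact/L2_cmeasurable/L2_fourier.
  - apply: cmeasurableM; first exact: cmeasurable_cst.
    exact/cintegrable_cmeasurable/cintegrable_fourierL1.
  - apply: ae_imp (fourier_atom s a0 t psi2) => w ->.
    rewrite !conjcM conjc_real conjc_cexpi opprK phase_opp2 /coef.
    by move: (cexpi _) (conjc _) (fourier f w) (_%:C) => c1 c2 c3 c4; ring.
have := inner_fourier f2 A2; rewrite e => e'.
have K0 : K != 0 by rewrite gt_eqF// plancherel_cst_gt0.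
have key (k l : R) (y z : R[i]) : k != 0 -> l%:C * y = k%:C * z ->
    z = (k^-1 * l)%:C * y.
  move=> k0 h; have -> : (k^-1 * l)%:C = (k^-1)%:C * l%:C :> R[i].
    by apply: complex_eqP => /=; ring.
  rewrite -mulrA h mulrA (_ : (k^-1)%:C * k%:C = 1) ?mul1r//.
  by apply: complex_eqP => /=; field.
exact: key K0 e'.
Qed.

(** Plancherel in [t], with the constant [(K^-1 a^(3/4))^2 K = K^-1 a sqrt a]. The square
    integrability of [coef] is an assumption here; it will hold for almost every [(a, s)] of the
    window. *)
Lemma integral_sqr_inner_atom f psi a s : 0 < a -> L2 f -> L2 psi ->
  L2 (coef f psi a s) ->
  (\int[leb2]_t (normc (inner f (shearlet_atom psi a s t)) ^+ 2)%:E =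
   (K^-1 * (a * Num.sqrt a))%:E * sqnorm2 (coef f psi a s))%E.
Proof.
move=> a0 f2 psi2 c2; have hc := cintegrable_coef s a0 f2 psi2.
have hF := cmeasurable_fourierL1 hc.
transitivity (sqnorm2 (fun t => (K^-1 * a `^ (3 / 4))%:C *
    (fourierL1 (coef f psi a s) \o @opp2 R) t)).
  by apply: eq_integral => t _; rewrite inner_atom.
rewrite sqnorm2Z; last first.
  by apply: cmeasurable_comp => //; have [] := rescales_opp2 R.
rewrite (sqnorm2_comp (rescales_opp2 R) hF) mul1e (sqnorm2_fourierL1 hc c2) muleA -EFinM.
congr (_%:E * _)%E; rewrite normc_sqr/= expr0n/= addr0 exprMn sqr_powR34//.
by field; rewrite gt_eqF// plancherel_cst_gt0.
Qed.

End analysis_coefficients.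

(** * Orbit integrals *)

Section orbits.
Local Open Scope complex_scope.
Context (R : realType).
Notation lambda := (@lebesgue_measure R).
Notation leb2 := (@leb2 R).
Implicit Types (psi : R * R -> R[i]) (h : R * R -> R).
Implicit Types (x w t xi q : R * R) (a s k e : R) (n m : nat).
#[local] Opaque fourierL1 fourier plancherel_cst.

Lemma measurable_sqrtr : measurable_fun setT (@Num.sqrt R).
Proof. exact: (continuous_measurable_fun (@sqrt_continuous R)). Qed.

Lemma measurable_dual_map : measurable_fun setT
  (fun z : (R * R) * (R * R) => dual_map z.1.1 z.1.2 z.2).
Proof.
have m11 : measurable_fun setT (fun z : (R * R) * (R * R) => z.1.1).
  by apply: (measurableT_comp measurable_fst); exact: measurable_fst.
have m12 : measurable_fun setT (fun z : (R * R) * (R * R) => z.1.2).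
  by apply: (measurableT_comp measurable_snd); exact: measurable_fst.
have m21 : measurable_fun setT (fun z : (R * R) * (R * R) => z.2.1).
  by apply: (measurableT_comp measurable_fst); exact: measurable_snd.
have m22 : measurable_fun setT (fun z : (R * R) * (R * R) => z.2.2).
  by apply: (measurableT_comp measurable_snd); exact: measurable_snd.
apply: measurable_fun_pair => /=; first exact: measurable_funM.
apply: measurable_funM; first exact: (measurableT_comp measurable_sqrtr m11).
by apply: measurable_funB => //; exact: measurable_funM.
Qed.

Lemma measurable_div_fst_sqr h : measurable_fun setT h ->
  measurable_fun setT (fun w => h w / `|w.1| ^+ 2).
Proof.
move=> mh; rewrite (_ : (fun w => _) = (fun w => h w * `|w.1| `^ (-2))).
  apply: measurable_funM => //; apply: (measurableT_comp (@measurable_powR R _)).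
  exact: (measurableT_comp (@normr_measurable R setT) (@measurable_fst _ _ _ _)).
by apply/funext => w; rewrite powRN -[2]/(2%:R) powR_mulrn.
Qed.

Lemma powRN32 a : 0 < a -> a `^ (- (3 / 2)) = (a * Num.sqrt a)^-1.
Proof.
move=> a0; rewrite powRN -powR_half_sqrt//; congr (_^-1).
have -> : 3 / 2 = 1 + 1 / 2 :> R by field.
by rewrite powRD ?gt_eqF ?implybT// powRr1 ?ltW.
Qed.

(** Extended by [0] to [a <= 0], so that Tonelli and changes of variables run over the whole plane
    of the [q = (a, s)]. *)
Definition orbit_kernel h xi q : R :=
  if 0 < q.1 then h (dual_map q.1 q.2 xi) * q.1 `^ (- (3 / 2)) else 0.

Lemma orbit_kernel_ge0 h xi q : (forall w, 0 <= h w) -> 0 <= orbit_kernel h xi q.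
Proof. by move=> h0; rewrite /orbit_kernel; case: ifP => // _; rewrite mulr_ge0 ?powR_ge0. Qed.

Lemma measurable_orbit_kernel h : measurable_fun setT h ->
  measurable_fun setT (fun z : (R * R) * (R * R) => orbit_kernel h z.2 z.1).
Proof.
move=> mh; have m11 : measurable_fun setT (fun z : (R * R) * (R * R) => z.1.1).
  by apply: (measurableT_comp measurable_fst); exact: measurable_fst.
apply: measurable_fun_ifT => //; first exact: measurable_fun_ltr.
apply: measurable_funM; first exact: (measurableT_comp mh measurable_dual_map).
exact: (measurableT_comp (@measurable_powR R _) m11).
Qed.

Lemma measurable_orbit_kernelr h xi : measurable_fun setT h ->
  measurable_fun setT (orbit_kernel h xi).
Proof.
move=> mh; exact: (measurableT_comp (measurable_orbit_kernel mh)
  (measurable_fun_pair (@measurable_id _ _ setT) (@measurable_cst _ _ _ _ setT xi))).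
Qed.

(* Only an inequality, as [q |-> dual_map q.1 q.2 xi] sweeps the half-plane of
   the [w] such that [w.1] has the sign of [xi.1]. *)
Lemma integral_orbit_kernel_le h xi : measurable_fun setT h -> (forall w, 0 <= h w) ->
  xi.1 != 0 ->
  (\int[leb2]_q (orbit_kernel h xi q)%:E <= \int[leb2]_w (h w / `|w.1| ^+ 2)%:E)%E.
Proof.
move=> mh h0 xi0.
have mk := measurable_orbit_kernelr xi mh.
rewrite leb2_tonelli1; last 2 first.
- exact/measurable_EFinP.
- by move=> q; rewrite lee_fin orbit_kernel_ge0.
pose H (x : R) := (\int[lambda]_y (h (x, y))%:E)%E.
have mH : measurable_fun setT H.
  apply: (@ge0_measurable_integral1 _ _ _ _ _ lambda (fun z => (h z)%:E)) => //.
  exact/measurable_EFinP.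
have H0 (x : R) : (0 <= H x)%E by apply: integral_ge0 => y _; rewrite lee_fin.
(* Density in [x = a xi_1] once [s] is integrated out: [a^(-3/2)] times the inverse Jacobian
   [1 / (sqrt a |xi_1|)] is [|xi_1| / x^2]; the test selects [a > 0]. *)
pose g (x : R) : R := if 0 < x / xi.1 then `|xi.1| / x ^+ 2 else 0.
have g0 (x : R) : 0 <= g x by rewrite /g; case: ifP => // _; rewrite divr_ge0 ?sqr_ge0.
have mg : measurable_fun setT g.
  rewrite (_ : g = fun x : R => if 0 < x / xi.1 then `|xi.1| * `|x| `^ (-2) else 0).
    apply: measurable_fun_ifT => //.
      by apply: measurable_fun_ltr => //; exact: measurable_funM.
    apply: measurable_funM => //.
    exact: (measurableT_comp (@measurable_powR R _) (@normr_measurable R setT)).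
  apply/funext => x; rewrite /g; case: ifP => // x0; congr (_ * _).
  by rewrite powRN -[2]/(2%:R) powR_mulrn// real_normK ?num_real.
have slice a : (\int[lambda]_s (orbit_kernel h xi (a, s))%:E =
    (g (xi.1 * a + 0)%R)%:E * H (xi.1 * a + 0)%R)%E.
  rewrite addr0 (mulrC xi.1) /g mulfK//; case: ifP => a0; last first.
    by rewrite mul0e integral0_eq// => s _; rewrite /orbit_kernel/= a0.
  have r0 : 0 < Num.sqrt a by rewrite sqrtr_gt0.
  have c0 : - (Num.sqrt a * xi.1) != 0 by rewrite oppr_eq0 mulf_neq0// gt_eqF.
  have [_ _ sE] := rescales_affine (Num.sqrt a * xi.2) c0.
  transitivity (\int[lambda]_s ((a `^ (- (3 / 2)))%:E *
      (h (a * xi.1, - (Num.sqrt a * xi.1) * s + Num.sqrt a * xi.2)%R)%:E))%E.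
    apply: eq_integral => s _; rewrite /orbit_kernel/= a0 -EFinM mulrC /dual_map/=.
    by congr (_ * h (_, _))%:E; ring.
  have mhx : measurable_fun setT (fun y => (h (a * xi.1, y))%:E : \bar R).
    apply/measurable_EFinP; apply: (measurableT_comp mh).
    exact: measurable_fun_pair.
  rewrite ge0_integralZl//; last 3 first.
  - by apply: (measurableT_comp mhx); exact: measurable_affine.
  - by move=> s _; rewrite lee_fin.
  - by rewrite lee_fin powR_ge0.
  rewrite (sE (fun y => (h (a * xi.1, y))%:E))//; last by move=> y; rewrite lee_fin.
  rewrite muleA -EFinM; congr (_%:E * _)%E.
  rewrite powRN32// normrN normrM (gtr0_norm r0) exprMn -(real_normK (num_real xi.1)).
  have x0 : `|xi.1| != 0 by rewrite normr_eq0.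
  have rr : a = Num.sqrt a ^+ 2 by rewrite sqr_sqrtr// ltW.
  move: (Num.sqrt a) r0 rr => r r0 ->; move: `|xi.1| x0 => y y0.
  by field; rewrite y0 gt_eqF.
under eq_integral do rewrite slice.
have [_ _ xE] := rescales_affine 0 xi0.
rewrite (xE (fun x : R => (g x)%:E * H x))%E; last 2 first.
- by apply: emeasurable_funM => //; exact/measurable_EFinP.
- by move=> x; rewrite mule_ge0// lee_fin.
have mw := measurable_div_fst_sqr mh.
rewrite leb2_tonelli1; last 2 first.
- exact/measurable_EFinP.
- by move=> w; rewrite lee_fin divr_ge0 ?sqr_ge0.
rewrite -ge0_integralZl//; last 2 first.
- by apply: emeasurable_funM => //; exact/measurable_EFinP.
- by move=> x _; rewrite mule_ge0// lee_fin.
apply: ge0_le_integral => //.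
- by move=> x _; rewrite !mule_ge0// lee_fin.
- by apply: measurable_funeM; apply: emeasurable_funM => //; exact/measurable_EFinP.
- apply: (@ge0_measurable_integral1 _ _ _ _ _ lambda (fun w => (h w / `|w.1| ^+ 2)%:E)).
    exact/measurable_EFinP.
  by move=> w; rewrite lee_fin divr_ge0 ?sqr_ge0.
move=> x _; rewrite muleA -EFinM -ge0_integralZl//; last 3 first.
- by apply/measurable_EFinP; apply: (measurableT_comp mh); exact: measurable_fun_pair.
- by move=> y _; rewrite lee_fin.
- by rewrite lee_fin mulr_ge0.
apply: ge0_le_integral => //.
- by move=> y _; rewrite -EFinM lee_fin mulr_ge0// mulr_ge0.
- apply: measurable_funeM; apply/measurable_EFinP; apply: (measurableT_comp mh).
  exact: measurable_fun_pair.
- apply: (measurableT_comp (_ : measurable_fun setT (fun w : R * R => (h w / `|w.1| ^+ 2)%:E))).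
    exact/measurable_EFinP.
  exact: measurable_fun_pair.
move=> y _; rewrite -EFinM lee_fin /= mulrC ler_wpM2l// /g; case: ifP => x0.
  by rewrite mulrA mulVf ?normr_eq0// mul1r real_normK ?num_real.
by rewrite mulr0 invr_ge0 sqr_ge0.
Qed.

Lemma orbit_integralE psi xi : L2 psi ->
  orbit_integral psi xi =
  (\int[leb2]_q (orbit_kernel (fun w => normc (fourier psi w) ^+ 2) xi q)%:E)%E.
Proof.
move=> psi2; have mP := measurable_normc_sqr (L2_cmeasurable (L2_fourier psi2)).
rewrite leb2_tonelli2; last 2 first.
- by apply/measurable_EFinP; exact: measurable_orbit_kernelr.
- by move=> q; rewrite lee_fin orbit_kernel_ge0// => w; exact: sqr_ge0.
apply: eq_integral => s _; rewrite integral_mkcond; apply: eq_integral => a _.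
rewrite patchE mem_setE in_itv/= andbT /orbit_kernel/=.
by case: ifP.
Qed.

End orbits.

(** * The multiplier of a bounded parameter window *)

Section truncated_orbits.
Context (R : realType).
Notation leb2 := (@leb2 R).
Implicit Types (x w t xi q : R * R) (a s k e : R) (n m : nat).
Variables (Phi : R * R -> R) (c u v : R).
Hypothesis mPhi : measurable_fun setT Phi.
Hypothesis Phi0 : forall w, 0 <= Phi w.
Hypothesis iPhi : leb2.-integrable setT (EFin \o (fun w => Phi w / `|w.1| ^+ 2)).
Hypothesis orbitE : forall xi, xi.1 != 0 ->
  (\int[leb2]_q (orbit_kernel Phi xi q)%:E = (c / 2)%:E)%E.
Hypotheses (u0 : 0 < u) (v0 : 0 < v) (c0 : 0 < c).

Definition window n q := (q.1 <= n%:R) && (`|q.2| <= n%:R).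

Definition window_kernel n xi q : R := if window n q then orbit_kernel Phi xi q else 0.

Lemma measurable_window n : measurable_fun setT (window n).
Proof.
apply: measurable_and; apply: measurable_fun_ler => //.
exact: (measurableT_comp (@normr_measurable R setT) (@measurable_snd _ _ _ _)).
Qed.

Lemma window_kernel_ge0 n xi q : 0 <= window_kernel n xi q.
Proof. by rewrite /window_kernel; case: ifP => // _; exact: orbit_kernel_ge0. Qed.

Lemma measurable_window_kernel n :
  measurable_fun setT (fun z : (R * R) * (R * R) => window_kernel n z.2 z.1).
Proof.
apply: measurable_fun_ifT => //; last exact: measurable_orbit_kernel.
exact: (measurableT_comp (measurable_window n) (@measurable_fst _ _ _ _)).
Qed.

Lemma measurable_window_kernelr n xi : measurable_fun setT (window_kernel n xi).
Proof.
exact: (measurableT_comp (measurable_window_kernel n)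
  (measurable_fun_pair (@measurable_id _ _ setT) (@measurable_cst _ _ _ _ setT xi))).
Qed.

(** The multiplier [Delta] for [Gamma = Xi = n]. *)
Definition window_mass n xi : \bar R := \int[leb2]_q (window_kernel n xi q)%:E.

Lemma window_mass_ge0 n xi : (0 <= window_mass n xi)%E.
Proof. by apply: integral_ge0 => q _; rewrite lee_fin window_kernel_ge0. Qed.

Lemma window_mass_le n xi : xi.1 != 0 -> (window_mass n xi <= (c / 2)%:E)%E.
Proof.
move=> xi0; rewrite -(orbitE xi0); apply: ge0_le_integral => //.
- by move=> q _; rewrite lee_fin window_kernel_ge0.
- by apply/measurable_EFinP; exact: measurable_window_kernelr.
- by apply/measurable_EFinP; exact: measurable_orbit_kernelr.
- move=> q _; rewrite lee_fin /window_kernel; case: ifP => // _.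
  exact: orbit_kernel_ge0.
Qed.

Definition outer n w := (n%:R * u < `|w.1|) || ((n%:R - v) ^+ 2 * (u * `|w.1|) < w.2 ^+ 2).

Definition outer_part n w : R := if outer n w then Phi w else 0.

Lemma outer_part_ge0 n w : 0 <= outer_part n w.
Proof. by rewrite /outer_part; case: ifP. Qed.

Lemma measurable_outer_part n : measurable_fun setT (outer_part n).
Proof.
have m1 : measurable_fun setT (fun w : R * R => `|w.1|).
  exact: (measurableT_comp (@normr_measurable R setT) (@measurable_fst _ _ _ _)).
apply: measurable_fun_ifT => //; apply: measurable_or; apply: measurable_fun_ltr => //.
  by apply: measurable_funM => //; exact: measurable_funM.
by apply: measurable_funX; exact: measurable_snd.
Qed.

(** If [a > n], then [|x_1| = a |xi_1| > n u]. If [|s| > n], then [|xi_2 - s xi_1| > (n - v) |xi_1|]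
    because [|xi_2| <= v |xi_1|]; squaring, which needs [v <= n], and using [a |xi_1| = |x_1|] and
    [|xi_1| >= u] gives the other alternative. *)
Lemma outer_dual_map n xi q : v <= n%:R -> cone u v xi -> 0 < q.1 -> ~~ window n q ->
  outer n (dual_map q.1 q.2 xi).
Proof.
move=> vn [/= uxi xiv] q0; rewrite /window /outer negb_and -!ltNge /dual_map/=.
have x0 : 0 < `|xi.1| by exact: lt_le_trans uxi.
have n0 : 0 < n%:R :> R by exact: lt_le_trans vn.
rewrite normrM (gtr0_norm q0) => /orP[nq|nq]; apply/orP; [left|right].
  apply: (@le_lt_trans _ _ (n%:R * `|xi.1|)); first by rewrite ler_pM2l.
  by rewrite ltr_pM2r.
rewrite exprMn sqr_sqrtr ?(ltW q0)//.
have h : (n%:R - v) * `|xi.1| < `|xi.2 - q.2 * xi.1|.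
  rewrite distrC; apply: lt_le_trans (lerB_dist _ _).
  rewrite normrM mulrBl ltrBlDr -addrA; apply: (@lt_le_trans _ _ (`|q.2| * `|xi.1|)).
    by rewrite ltr_pM2r.
  by rewrite lerDl addrC subr_ge0.
have h2 : ((n%:R - v) * `|xi.1|) ^+ 2 < (xi.2 - q.2 * xi.1) ^+ 2.
  rewrite -[X in _ < X]real_normK ?num_real// ltr_pXn2r ?nnegrE//.
  by rewrite mulr_ge0// subr_ge0.
apply: (@le_lt_trans _ _ (q.1 * ((n%:R - v) * `|xi.1|) ^+ 2)); last by rewrite ltr_pM2l.
rewrite (_ : _ * (u * _) = (n%:R - v) ^+ 2 * q.1 * `|xi.1| * u); last by ring.
rewrite [X in _ <= X](_ : _ = (n%:R - v) ^+ 2 * q.1 * `|xi.1| * `|xi.1|); last by ring.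
apply: ler_wpM2l => //; apply: mulr_ge0 => //.
by apply: mulr_ge0; [exact: sqr_ge0|exact: ltW].
Qed.

Lemma cvg_outer_part :
  (fun n => \int[leb2]_w (outer_part n w / `|w.1| ^+ 2)%:E)%E @ \oo --> (0 : \bar R)%E.
Proof.
apply: (@cvg_integral_dominated0 _ _ _ leb2 (fun n w => outer_part n w / `|w.1| ^+ 2)
  _ _ _ iPhi).
- by move=> n; apply: measurable_div_fst_sqr; exact: measurable_outer_part.
- move=> n w; rewrite divr_ge0 ?outer_part_ge0 ?sqr_ge0//= ler_wpM2r ?invr_ge0 ?sqr_ge0//.
  by rewrite /outer_part; case: ifP.
- apply: ae_forall => w; apply: cvg_near_cst.
  (* On the line [w.1 = 0] the quotient is [0] by the convention for the inverse of [0]. *)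
  have [->|w0] := eqVneq w.1 0.
    by apply: nearW => n; rewrite normr0 expr0n/= invr0 mulr0.
  have w1 : 0 < `|w.1| by rewrite normr_gt0.
  (* Beyond [M] both alternatives fail: the first summand excludes [n u < |w_1|], and the others
     give [n - v >= 1], so that [(n - v)^2 >= n - v >= w_2^2 / (u |w_1|)]. *)
  pose M := `|w.1| / u + (v + 1 + w.2 ^+ 2 / (u * `|w.1|)).
  have p1 : 0 <= `|w.1| / u by rewrite divr_ge0// ltW.
  have p2 : 0 <= w.2 ^+ 2 / (u * `|w.1|) by rewrite divr_ge0 ?sqr_ge0// mulr_ge0// ltW.
  have [N hN] : exists N : nat, M <= N%:R.
    exists (Num.bound M); apply/ltW; apply: archi_boundP.
    by rewrite /M !addr_ge0// ltW.
  exists N => // n /= Nn; have Mn : M <= n%:R by rewrite (le_trans hN)// ler_nat.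
  rewrite /outer_part /outer ifF ?mul0r//; apply/negbTE; rewrite negb_or -!leNgt.
  apply/andP; split.
    rewrite -ler_pdivrMr//; apply: le_trans Mn; rewrite lerDl.
    by rewrite !addr_ge0// ltW.
  rewrite -ler_pdivrMr ?mulr_gt0//.
  have h1 : 1 + w.2 ^+ 2 / (u * `|w.1|) <= n%:R - v.
    by rewrite lerBrDl (le_trans _ Mn)// /M addrA lerDr.
  have h2 : 1 <= n%:R - v by apply: le_trans h1; rewrite lerDl.
  apply: (@le_trans _ _ (n%:R - v)); first by apply: le_trans h1; rewrite lerDr.
  by rewrite expr2 ler_peMr// (le_trans ler01).
Qed.

Lemma window_mass_ge : exists2 n : nat, (0 < n)%N &
  forall xi, cone u v xi -> ((c / 4)%:E <= window_mass n xi)%E.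
Proof.
have h0 n : (0 <= \int[leb2]_w (outer_part n w / `|w.1| ^+ 2)%:E)%E.
  by apply: integral_ge0 => w _; rewrite lee_fin divr_ge0 ?outer_part_ge0 ?sqr_ge0.
have c4 : 0 < c / 4 by rewrite divr_gt0.
have [N hN] := (cvge0P h0).1 cvg_outer_part _ c4.
(* [N] makes the outer share at most [c / 4]; the other bound ensures [v <= n] and [0 < n]. *)
pose n := maxn N (Num.bound v).+1.
have vn : v <= n%:R.
  apply: (@le_trans _ _ (Num.bound v)%:R); first by apply/ltW/archi_boundP/ltW.
  by rewrite ler_nat (leq_trans (leqnSn _))// leq_maxr.
exists n; first by rewrite (leq_trans _ (leq_maxr _ _)).
move=> xi cxi; have xi0 : xi.1 != 0.
  by rewrite -normr_gt0; apply: lt_le_trans cxi.1.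
have mo := measurable_outer_part n.
pose rest q : R := if window n q then 0 else orbit_kernel Phi xi q.
have rest0 q : 0 <= rest q by rewrite /rest; case: ifP => // _; exact: orbit_kernel_ge0.
have mrest : measurable_fun setT rest.
  by apply: measurable_fun_ifT => //; [exact: measurable_window|exact: measurable_orbit_kernelr].
have split_ : ((c / 2)%:E = window_mass n xi + \int[leb2]_q (rest q)%:E)%E.
  rewrite -(orbitE xi0) -ge0_integralD//.
  - apply: eq_integral => q _; rewrite -EFinD /window_kernel /rest.
    by case: ifP => _; rewrite ?addr0 ?add0r.
  - by move=> q _; rewrite lee_fin window_kernel_ge0.
  - by apply/measurable_EFinP; exact: measurable_window_kernelr.
  - by move=> q _; rewrite lee_fin.
  - exact/measurable_EFinP.
(* Off the window [Phi] may be replaced by [outer_part n]; the resulting bound is an integral over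
   frequencies, the same for all [xi] in the cone. *)
have rest_le : (\int[leb2]_q (rest q)%:E <= (c / 4)%:E)%E.
  apply: le_trans (hN n (leq_maxl _ _)).
  apply: le_trans (integral_orbit_kernel_le mo (outer_part_ge0 n) xi0).
  apply: ge0_le_integral => //.
  - by move=> q _; rewrite lee_fin.
  - exact/measurable_EFinP.
  - by apply/measurable_EFinP; exact: measurable_orbit_kernelr.
  - move=> q _; rewrite lee_fin /rest /orbit_kernel.
    case: ifPn => wq; case: ifPn => q0 //.
      by rewrite mulr_ge0 ?outer_part_ge0 ?powR_ge0.
    by rewrite /outer_part (outer_dual_map vn cxi q0 wq).
have rf : (\int[leb2]_q (rest q)%:E)%E \is a fin_num.
  by rewrite ge0_fin_numE ?integral_ge0//= ?(le_lt_trans rest_le) ?ltry// => q _; rewrite lee_fin.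
have wE : window_mass n xi = ((c / 2)%:E - \int[leb2]_q (rest q)%:E)%E.
  by rewrite split_ addeK.
rewrite wE leeBrDr//; apply: (@le_trans _ _ ((c / 4)%:E + (c / 4)%:E)%E).
  by rewrite leeD2l.
by rewrite -EFinD lee_fin; lra.
Qed.

End truncated_orbits.

(** * The frame integral *)

Section density.
Local Open Scope ereal_scope.
Context d (T : measurableType d) (R : realType).
Variables (mu nu : {measure set T -> \bar R}) (rho : T -> R).
Hypothesis mrho : measurable_fun setT rho.
Hypothesis rho0 : forall x, (0 <= rho x)%R.
Hypothesis nuE : forall A, measurable A -> nu A = \int[mu]_(x in A) (rho x)%:E.

Let integral_density_indic (A : set T) : measurable A ->
  \int[nu]_x (\1_A x)%:E = \int[mu]_x ((\1_A x)%:E * (rho x)%:E).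
Proof.
move=> mA; rewrite integral_indic// setIT nuE// integral_mkcond.
apply: eq_integral => x _; rewrite patchE indicE; case: ifP => _; first by rewrite mul1e.
by rewrite mul0e.
Qed.

Import HBNNSimple.

Let integral_density_nnsfun (h : {nnsfun T >-> R}) :
  \int[nu]_x (h x)%:E = \int[mu]_x ((h x)%:E * (rho x)%:E).
Proof.
have mh1 r : measurable (h @^-1` [set r]) by exact: measurable_sfunP.
have h0 r x : 0 <= (r * \1_(h @^-1` [set r]) x)%:E by rewrite EFinM nnfun_muleindic_ge0.
under [LHS]eq_integral do rewrite fimfunE -fsumEFin//.
rewrite [LHS]ge0_integral_fsum//; last first.
  by move=> r; exact/measurable_EFinP/measurableT_comp.
under [RHS]eq_integral.
  move=> x _; rewrite fimfunE -fsumEFin// ge0_mule_fsuml//.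
  over.
rewrite [RHS]ge0_integral_fsum//; last 2 first.
- move=> r; apply/measurable_EFinP; apply: measurable_funM => //.
  exact: measurableT_comp.
- by move=> r x _; rewrite mule_ge0// lee_fin.
apply: eq_fsbigr => r /set_mem[y _ <-].
have hy0 : (0 <= h y)%R by [].
under eq_integral do rewrite EFinM.
rewrite ge0_integralZl//; last first.
  exact/measurable_EFinP/measurable_indic.
under [RHS]eq_integral do rewrite EFinM -muleA.
rewrite ge0_integralZl//; last 2 first.
- by apply: emeasurable_funM; apply/measurable_EFinP => //; exact: measurable_indic.
- by move=> x _; rewrite mule_ge0// lee_fin.
by rewrite integral_density_indic.
Qed.

(** From indicators, where it is the hypothesis on [nu], through simple functions to monotone
    limits. It turns integrals for [shearlet_measure] into Lebesgue integrals with weight [a^-3]. *)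
Lemma ge0_integral_density (h : T -> \bar R) : measurable_fun setT h ->
  (forall x, 0 <= h x) -> \int[nu]_x h x = \int[mu]_x (h x * (rho x)%:E).
Proof.
move=> mh h0; pose g := nnsfun_approx measurableT mh.
have gnd x : {homo (fun n => g n x) : m n / (m <= n)%N >-> (m <= n)%R}.
  by move=> m n mn; exact/lefP/nd_nnsfun_approx.
have cv x : (g n x)%:E @[n --> \oo] --> h x by exact: cvg_nnsfun_approx.
transitivity (limn (fun n => \int[nu]_x (g n x)%:E)).
  rewrite -monotone_convergence//.
  - by apply: eq_integral => x _; apply/esym/cvg_lim.
  - by move=> n; exact/measurable_EFinP.
  - by move=> n x _; rewrite lee_fin.
  - by move=> x _ m n mn; rewrite lee_fin gnd.
transitivity (limn (fun n => \int[mu]_x ((g n x)%:E * (rho x)%:E))).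
  by congr (limn _); apply/funext => n; exact: integral_density_nnsfun.
rewrite -monotone_convergence//.
- apply: eq_integral => x _; apply/cvg_lim => //.
  by apply: cvgeMr.
- by move=> n; apply: emeasurable_funM; exact/measurable_EFinP.
- by move=> n x _; rewrite mule_ge0// lee_fin.
- by move=> x _ m n mn; rewrite lee_pmul// lee_fin// gnd.
Qed.

End density.

(** * From the parameter integral to the frequency multiplier *)

Section frame_integral.
Local Open Scope complex_scope.
Context (R : realType).
Notation leb2 := (@leb2 R).
Notation K := (plancherel_cst R).
Notation param := ((R * R) * (R * R))%type.
Implicit Types (x w t xi q : R * R) (p : param) (a s k e : R).
Variables (psi f : R * R -> R[i]) (n : nat).
Hypotheses (psi2 : L2 psi) (f2 : L2 f).
#[local] Opaque fourierL1 fourier plancherel_cst.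

(* On [0 <= a] this is [shearlet_atom]; division is replaced by powers, which
   are known to be measurable in their base. *)
Definition atom_powR p x : R[i] :=
  (p.1.1 `^ (- (3 / 4)))%:C *
  psi ((x.1 - p.2.1 + p.1.2 * (x.2 - p.2.2)) * p.1.1 `^ (-1),
       (x.2 - p.2.2) * p.1.1 `^ (- (1 / 2))).

Lemma atom_powRE p : 0 <= p.1.1 -> atom_powR p = shearlet_atom psi p.1.1 p.1.2 p.2.
Proof. by move=> a0; apply/funext => x; rewrite /atom_powR powR_inv1// [in X in (_, X)]powRN. Qed.

Definition sqr_coef p : R := normc (inner f (atom_powR p)) ^+ 2.

(** The real and imaginary parts of the coefficient are integrals in [x] of functions [Fr] and [Fi]
    that are jointly measurable in the parameter and [x]. *)
Lemma measurable_sqr_coef : measurable_fun setT sqr_coef.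
Proof.
have m1 : measurable_fun setT (fun z : param * (R * R) => z.1) by exact: measurable_fst.
have m2 : measurable_fun setT (fun z : param * (R * R) => z.2) by exact: measurable_snd.
have m11 : measurable_fun setT (fun z : param * (R * R) => z.1.1).
  exact: (measurableT_comp (@measurable_fst _ _ _ _) m1).
have m12 : measurable_fun setT (fun z : param * (R * R) => z.1.2).
  exact: (measurableT_comp (@measurable_snd _ _ _ _) m1).
have ma : measurable_fun setT (fun z : param * (R * R) => z.1.1.1).
  exact: (measurableT_comp (@measurable_fst _ _ _ _) m11).
have ms : measurable_fun setT (fun z : param * (R * R) => z.1.1.2).
  exact: (measurableT_comp (@measurable_snd _ _ _ _) m11).
have mt1 : measurable_fun setT (fun z : param * (R * R) => z.1.2.1).
  exact: (measurableT_comp (@measurable_fst _ _ _ _) m12).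
have mt2 : measurable_fun setT (fun z : param * (R * R) => z.1.2.2).
  exact: (measurableT_comp (@measurable_snd _ _ _ _) m12).
have mx1 : measurable_fun setT (fun z : param * (R * R) => z.2.1).
  exact: (measurableT_comp (@measurable_fst _ _ _ _) m2).
have mx2 : measurable_fun setT (fun z : param * (R * R) => z.2.2).
  exact: (measurableT_comp (@measurable_snd _ _ _ _) m2).
pose phi (z : param * (R * R)) : R * R :=
  ((z.2.1 - z.1.2.1 + z.1.1.2 * (z.2.2 - z.1.2.2)) * z.1.1.1 `^ (-1),
   (z.2.2 - z.1.2.2) * z.1.1.1 `^ (- (1 / 2))).
have mpow r : measurable_fun setT (fun z : param * (R * R) => z.1.1.1 `^ r).
  exact: (measurableT_comp (@measurable_powR R r) ma).
have mphi : measurable_fun setT phi.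
  apply: measurable_fun_pair => /=; apply: measurable_funM => //.
    apply: measurable_funD; first exact: measurable_funB.
    by apply: measurable_funM => //; exact: measurable_funB.
  exact: measurable_funB.
have [fr fi] := L2_cmeasurable f2; have [pr pi'] := L2_cmeasurable psi2.
have mfr := measurableT_comp fr m2; have mfi := measurableT_comp fi m2.
have mpr := measurableT_comp pr mphi; have mpi := measurableT_comp pi' mphi.
pose Fr (z : param * (R * R)) : R := z.1.1.1 `^ (- (3 / 4)) *
  (complex.Re (f z.2) * complex.Re (psi (phi z)) + complex.Im (f z.2) * complex.Im (psi (phi z))).
pose Fi (z : param * (R * R)) : R := z.1.1.1 `^ (- (3 / 4)) *
  (complex.Im (f z.2) * complex.Re (psi (phi z)) - complex.Re (f z.2) * complex.Im (psi (phi z))).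
have mFr : measurable_fun setT Fr.
  by apply: measurable_funM => //; apply: measurable_funD; exact: measurable_funM.
have mFi : measurable_fun setT Fi.
  by apply: measurable_funM => //; apply: measurable_funB; exact: measurable_funM.
rewrite (_ : sqr_coef = fun p => Rintegral leb2 setT (fun x => Fr (p, x)) ^+ 2 +
    Rintegral leb2 setT (fun x => Fi (p, x)) ^+ 2); last first.
  apply/funext => p; rewrite /sqr_coef normc_sqr /=; congr (_ ^+ 2 + _ ^+ 2);
    apply: eq_Rintegral => x _; rewrite /atom_powR /Fr /Fi /phi /=;
    case: (f x) => ? ?; case: (psi _) => ? ? /=; ring.
apply: measurable_funD; apply: measurable_funX.
  exact: (@measurable_Rintegral1 _ _ _ _ R leb2 Fr).
exact: (@measurable_Rintegral1 _ _ _ _ R leb2 Fi).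
Qed.

Definition window_set : set param :=
  [set p | 0 <= p.1.1 <= n%:R /\ - n%:R <= p.1.2 <= n%:R].

Lemma measurable_window_set : measurable window_set.
Proof.
have m11 : measurable_fun setT (fun p : param => p.1.1).
  by apply: (measurableT_comp measurable_fst); exact: measurable_fst.
have m12 : measurable_fun setT (fun p : param => p.1.2).
  by apply: (measurableT_comp measurable_snd); exact: measurable_fst.
rewrite (_ : window_set = ([set p | 0 <= p.1.1] `&` [set p | p.1.1 <= n%:R]) `&`
    ([set p | - n%:R <= p.1.2] `&` [set p | p.1.2 <= n%:R])); last first.
  apply/seteqP; split => p /=; first by move=> [/andP[-> ->] /andP[-> ->]].
  by move=> [[h1 h2] [h3 h4]]; split; apply/andP.
by apply: measurableI; apply: measurableI; rewrite -[X in measurable X]setTI;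
  exact: measurable_fun_le.
Qed.

Let Phi w := normc (fourier psi w) ^+ 2.

Let mPhi : measurable_fun setT Phi.
Proof. exact: measurable_normc_sqr (L2_cmeasurable (L2_fourier psi2)). Qed.

Let Phi0 w : 0 <= Phi w. Proof. exact: sqr_ge0. Qed.

Let F2 w := normc (fourier f w) ^+ 2.

Let mF2 : measurable_fun setT F2.
Proof. exact: measurable_normc_sqr (L2_cmeasurable (L2_fourier f2)). Qed.

(** The contribution of [q = (a, s)], up to [K], written on the frequency side: the integral of a
    nonnegative function, to which Tonelli applies even where it is infinite. *)
Definition slice q : \bar R := \int[leb2]_w (F2 w * window_kernel Phi n w q)%:E.

Lemma slice_ge0 q : (0 <= slice q)%E.
Proof.
by apply: integral_ge0 => w _; rewrite lee_fin mulr_ge0 ?sqr_ge0 ?window_kernel_ge0.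
Qed.

Let mslice2 : measurable_fun setT
  (fun z : param => (F2 z.2 * window_kernel Phi n z.2 z.1)%:E : \bar R).
Proof.
apply/measurable_EFinP; apply: measurable_funM.
  exact: (measurableT_comp mF2 (@measurable_snd _ _ _ _)).
exact: measurable_window_kernel.
Qed.

Let slice2_ge0 z : (0 <= (F2 z.2 * window_kernel Phi n z.2 z.1)%:E :> \bar R)%E.
Proof. by rewrite lee_fin mulr_ge0 ?sqr_ge0 ?window_kernel_ge0. Qed.

Lemma measurable_slice : measurable_fun setT slice.
Proof. exact: (@ge0_measurable_integral1 _ _ _ _ R leb2 _ mslice2 slice2_ge0). Qed.

Lemma integral_slice :
  (\int[leb2]_q slice q = \int[leb2]_w ((F2 w)%:E * window_mass Phi n w))%E.
Proof.
transitivity (\int[(leb2 \x leb2)%E]_z (F2 z.2 * window_kernel Phi n z.2 z.1)%:E)%E.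
  by rewrite leb4_tonelli1.
rewrite leb4_tonelli2//; apply: eq_integral => w _ /=.
under eq_integral do rewrite EFinM.
rewrite ge0_integralZl//.
- by apply/measurable_EFinP; exact: measurable_window_kernelr.
- by move=> q _; rewrite lee_fin window_kernel_ge0.
- by rewrite lee_fin sqr_ge0.
Qed.

Lemma sliceE q : 0 < q.1 -> window n q ->
  slice q = ((q.1 `^ (- (3 / 2)))%:E * sqnorm2 (coef f psi q.1 q.2))%E.
Proof.
move=> q0 wq; have hc := cintegrable_cmeasurable (cintegrable_coef q.2 q0 f2 psi2).
rewrite /sqnorm2 -ge0_integralZl//.
- apply: eq_integral => w _; rewrite -EFinM /window_kernel wq /orbit_kernel q0; congr EFin.
  by rewrite /coef normc_sqrM normc_conjc mulrA mulrC.
- exact: measurable_EFin_normc_sqr.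
- by move=> w _; rewrite lee_fin sqr_ge0.
- by rewrite lee_fin powR_ge0.
Qed.

(** A finite slice forces [coef] into [L2], so Plancherel in [t] applies; the powers combine as
    [a^(3/2) a^(-3) = a^(-3/2)]. *)
Lemma integral_sqr_coef q : 0 < q.1 -> window n q -> (slice q < +oo)%E ->
  (\int[leb2]_t ((sqr_coef (q, t))%:E * (q.1 `^ (- 3))%:E) = (K^-1)%:E * slice q)%E.
Proof.
move=> q0 wq; rewrite sliceE// => sy.
have p0 : 0 < q.1 `^ (- (3 / 2)) by rewrite powR_gt0.
have hc := cintegrable_cmeasurable (cintegrable_coef q.2 q0 f2 psi2).
have c2 : L2 (coef f psi q.1 q.2).
  apply/L2P; split => //; rewrite ltNge; apply/negP; rewrite leye_eq => /eqP ey.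
  by move: sy; rewrite ey gt0_muley ?ltxx ?lte_fin.
rewrite ge0_integralZr//; last 3 first.
- apply/measurable_EFinP; exact: (measurableT_comp measurable_sqr_coef
    (measurable_fun_pair (@measurable_cst _ _ _ _ setT q) (@measurable_id _ _ setT))).
- by move=> t _; rewrite lee_fin sqr_ge0.
- by rewrite lee_fin powR_ge0.
transitivity (\int[leb2]_t (normc (inner f (shearlet_atom psi q.1 q.2 t)) ^+ 2)%:E *
    (q.1 `^ (- 3))%:E)%E.
  apply: (congr1 (fun y => y * _)%E); apply: eq_integral => t _.
  by rewrite /sqr_coef (@atom_powRE (q, t) (ltW q0)).
rewrite integral_sqr_inner_atom// muleAC -EFinM muleA -EFinM; congr (_%:E * _)%E.
rewrite -mulrA; congr (_ * _).
have -> : q.1 * Num.sqrt q.1 = (q.1 `^ (- (3 / 2)))^-1 by rewrite powRN32// invrK.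
apply: (@mulfI _ (q.1 `^ (- (3 / 2)))); first by rewrite gt_eqF.
rewrite mulrA mulfV ?mul1r ?gt_eqF// -powRD; last by rewrite (gt_eqF q0) implybT.
by congr powR; field.
Qed.

Let dens p := p.1.1 `^ (- 3).

Let mdens : measurable_fun setT dens.
Proof.
apply: (measurableT_comp (@measurable_powR R _)).
by apply: (measurableT_comp measurable_fst); exact: measurable_fst.
Qed.

(** Finiteness of the frequency integral makes almost every slice finite, which is what Plancherel
    in [t] requires at fixed [(a, s)]. For [a <= 0] and off the window both sides are [0]. *)
Lemma integral_shearlet_measure :
  (\int[leb2]_w ((F2 w)%:E * window_mass Phi n w) < +oo)%E ->
  (\int[@shearlet_measure R]_(p in window_set) (sqr_coef p)%:E =
   (K^-1)%:E * \int[leb2]_w ((F2 w)%:E * window_mass Phi n w))%E.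
Proof.
move=> wy; rewrite -integral_slice in wy *.
have msq := measurable_sqr_coef; have mW := measurable_window_set.
pose I p : \bar R := ((\1_window_set p * sqr_coef p)%R%:E * (dens p)%:E)%E.
have mI0 : measurable_fun setT (fun p => (\1_window_set p * sqr_coef p)%:E : \bar R).
  by apply/measurable_EFinP; apply: measurable_funM => //; exact: measurable_indic.
have mI : measurable_fun setT I.
  by apply: emeasurable_funM => //; exact/measurable_EFinP.
have I00 p : (0 <= (\1_window_set p * sqr_coef p)%:E :> \bar R)%E.
  by rewrite lee_fin mulr_ge0 ?sqr_ge0.
have I0 p : (0 <= I p)%E by rewrite mule_ge0// lee_fin powR_ge0.
transitivity (\int[@shearlet_measure R]_p (\1_window_set p * sqr_coef p)%:E)%E.
  rewrite integral_mkcond; apply: eq_integral => p _; rewrite patchE indicE.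
  by case: ifP => _; rewrite ?mul1r ?mul0r.
rewrite (ge0_integral_density (mu := (leb2 \x leb2)%E) (rho := dens))//; last first.
  by move=> p; exact: powR_ge0.
rewrite -/I leb4_tonelli1//.
rewrite -ge0_integralZl//; last 3 first.
- exact: measurable_slice.
- by move=> q _; exact: slice_ge0.
- by rewrite lee_fin invr_ge0 ltW// plancherel_cst_gt0.
have islice : leb2.-integrable setT slice.
  apply/integrableP; split; first exact: measurable_slice.
  by under eq_integral do rewrite gee0_abs ?slice_ge0//.
apply: ge0_ae_eq_integral => //.
- exact: (@ge0_measurable_integral1 _ _ _ _ R leb2 _ mI I0).
- by apply: measurable_funeM; exact: measurable_slice.
- by move=> q _; apply: integral_ge0 => t _; exact: I0.
- by move=> q _; rewrite mule_ge0 ?slice_ge0// lee_fin invr_ge0 ltW// plancherel_cst_gt0.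
apply: ae_imp (integrable_ae measurableT islice) => q /(_ Logic.I) qfin _.
(* A parameter with [a < 0] is outside [window_set]; at [a = 0] it may be inside, but the density is
   [0] there by the convention on powers of [0]. *)
have [q0|q0] := ltP 0 q.1; last first.
  have -> : slice q = 0%E.
    rewrite /slice integral0_eq// => w _.
    by rewrite /window_kernel /orbit_kernel ltNge q0/=; case: ifP; rewrite mulr0.
  rewrite mule0 integral0_eq// => t _; rewrite /I indicE.
  case: (boolP (_ \in _)) => [|_]; last by rewrite mul0r mul0e.
  rewrite inE /window_set/= => -[/andP[q0' _] _].
  have -> : dens (q, t) = 0.
    by rewrite /dens/= (_ : q.1 = 0) ?powR0//; apply/eqP; rewrite eq_le q0 q0'.
  by rewrite mule0.
have wE t : ((q, t) \in window_set) = window n q.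
  rewrite /window ler_norml; apply/idP/idP.
    by rewrite inE /window_set/= => -[/andP[_ ->] ->].
  by rewrite inE /window_set/= => /andP[-> ->]; rewrite (ltW q0).
case: (boolP (window n q)) => wq.
  rewrite -integral_sqr_coef//; last by rewrite -ge0_fin_numE ?slice_ge0.
  by apply: eq_integral => t _; rewrite /I indicE wE wq mul1r.
have -> : slice q = 0%E.
  by rewrite /slice integral0_eq// => w _; rewrite /window_kernel (negbTE wq) mulr0.
by rewrite mule0 integral0_eq// => t _; rewrite /I indicE wE (negbTE wq) mul0r mul0e.
Qed.

End frame_integral.

(** * Frame bounds *)

Section frame_bounds.
Local Open Scope complex_scope.
Context (R : realType).
Notation leb2 := (@leb2 R).
Notation K := (plancherel_cst R).
Implicit Types (psi f : R * R -> R[i]) (x w xi q : R * R) (n : nat).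
#[local] Opaque fourierL1 fourier plancherel_cst.

Lemma ae_fst_neq0 : {ae leb2, forall w, w.1 != 0}.
Proof.
exists ([set 0] `*` setT); split.
- by apply: measurableX.
- rewrite /leb2 product_measure1E//.
  by rewrite [X in (X * _)%E](_ : _ = 0%E) ?mul0e//; exact: (@lebesgue_measure_set1 R 0).
- by move=> w /negP; rewrite negbK => /eqP w0; split.
Qed.

(** If [C_psi] vanished, the transform of [psi] would be [0] almost everywhere, the line [w.1 = 0]
    being null, and so would [psi] by Plancherel's identity. *)
Lemma C_psi_gt0 psi : L2 psi -> ~ {ae leb2, forall x, psi x = 0} -> (0 < C_psi psi)%E.
Proof.
move=> psi2 psi_neq0; have P2 := L2_fourier psi2; have mP := L2_cmeasurable P2.
have g0 w : (0 <= (normc (fourier psi w) ^+ 2 / `|w.1| ^+ 2)%:E :> \bar R)%E.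
  by rewrite lee_fin divr_ge0 ?sqr_ge0.
have mg : measurable_fun setT (fun w => (normc (fourier psi w) ^+ 2 / `|w.1| ^+ 2)%:E : \bar R).
  by apply/measurable_EFinP; apply: measurable_div_fst_sqr; exact: measurable_normc_sqr.
rewrite lt0e integral_ge0 ?andbT//; apply/negP => /eqP C0; apply: psi_neq0.
have : (\int[leb2]_w `|(normc (fourier psi w) ^+ 2 / `|w.1| ^+ 2)%:E| = 0)%E.
  by under eq_integral do rewrite gee0_abs ?g0//.
move/(ae_eq_integral_abs leb2 measurableT mg).1 => h.
have F0 : {ae leb2, forall w, fourier psi w = 0}.
  apply: ae_imp2 h ae_fst_neq0 => w /(_ Logic.I) /eqP; rewrite eqe mulf_eq0 normc_sqr_eq0.
  by move=> /orP[/eqP//|]; rewrite invr_eq0 sqrf_eq0 normr_eq0 => ->.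
apply/nrm2_eq0P => //; have := nrm2_fourier psi2.
rewrite (nrm2_eq0P P2).2// => /esym/eqP; rewrite mulf_eq0 gt_eqF ?plancherel_cst_gt0//=.
by move/eqP.
Qed.

Lemma integrable_C_psi psi : L2 psi -> (C_psi psi < +oo)%E ->
  leb2.-integrable setT (EFin \o (fun w => normc (fourier psi w) ^+ 2 / `|w.1| ^+ 2)).
Proof.
move=> psi2 Cy; apply/integrableP; split.
  apply/measurable_EFinP; apply: measurable_div_fst_sqr.
  exact: measurable_normc_sqr (L2_cmeasurable (L2_fourier psi2)).
by under eq_integral do rewrite gee0_abs ?lee_fin ?divr_ge0 ?sqr_ge0//.
Qed.

Lemma L2_shearlet_atom_ge0 psi (a s : R) t : 0 <= a -> L2 psi -> L2 (shearlet_atom psi a s t).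
Proof.
rewrite le_eqVlt => /orP[/eqP <-|a0] psi2; last exact: L2_shearlet_atom.
by rewrite shearlet_atom0; exact: L20.
Qed.

Section cone_projection.
Variables u v : R.
Notation V := (@L2_cone R u v).

Lemma orth_proj_L2_cone psi : L2 psi -> V (orth_proj V psi).
Proof.
move=> psi2; have [] := orth_projP (@L2_cone_L2 R u v) (L2_cone0 u v) (@L2_coneD R u v)
  (@L2_coneZ R u v) (@L2_cone_closed R u v) psi2.
by [].
Qed.

Lemma inner_orth_proj_L2_cone f psi : V f -> L2 psi -> inner f (orth_proj V psi) = inner f psi.
Proof.
exact: (inner_orth_proj (@L2_cone_L2 R u v) (L2_cone0 u v) (@L2_coneD R u v)
  (@L2_coneZ R u v) (@L2_cone_closed R u v)).
Qed.

End cone_projection.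

(** The multiplier is bounded below on the cone only, which is enough as [F], to be taken as the
    transform of an element of the cone space, vanishes almost everywhere off it. *)
Lemma integral_window_mass (Phi : R * R -> R) (F : R * R -> R[i]) (u v c : R) n :
  0 < u -> 0 < c -> measurable_fun setT Phi -> (forall w, 0 <= Phi w) ->
  cmeasurable F -> {ae leb2, forall w, ~ cone u v w -> F w = 0} ->
  (forall xi, xi.1 != 0 -> (window_mass Phi n xi <= (c / 2)%:E)%E) ->
  (forall xi, cone u v xi -> ((c / 4)%:E <= window_mass Phi n xi)%E) ->
  ((c / 4)%:E * sqnorm2 F <=
   \int[leb2]_w ((normc (F w) ^+ 2)%:E * window_mass Phi n w) <=
   (c / 2)%:E * sqnorm2 F)%E.
Proof.
move=> u0 c0 mPhi Phi0 cF f0 wle wge.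
have mF := measurable_EFin_normc_sqr cF.
have F0 w : (0 <= (normc (F w) ^+ 2)%:E)%E by rewrite lee_fin sqr_ge0.
have mw : measurable_fun setT (window_mass Phi n).
  apply: (@ge0_measurable_integral2 _ _ _ _ R leb2
    (fun z => (window_kernel Phi n z.2 z.1)%:E)).
    by apply/measurable_EFinP; exact: measurable_window_kernel.
  by move=> z; rewrite lee_fin window_kernel_ge0.
have w0 w : (0 <= window_mass Phi n w)%E by exact: window_mass_ge0.
have c40 : 0 <= c / 4 by rewrite divr_ge0// ltW.
have c20 : 0 <= c / 2 by rewrite divr_ge0// ltW.
have mFw : measurable_fun setT (fun w => (normc (F w) ^+ 2)%:E * window_mass Phi n w)%E.
  exact: emeasurable_funM.
have Fw0 w : (0 <= (normc (F w) ^+ 2)%:E * window_mass Phi n w)%E by rewrite mule_ge0.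
have off w : ~ cone u v w -> F w = 0 -> normc (F w) ^+ 2 = 0.
  by move=> _ ->; apply/eqP; rewrite normc_sqr_eq0.
rewrite /sqnorm2 -!ge0_integralZl//.
apply/andP; split; apply: ae_ge0_le_integral => //.
- by move=> w _; rewrite mule_ge0// lee_fin.
- exact: measurable_funeM.
- apply: ae_imp f0 => w fw _; have [cw|ncw] := pselect (cone u v w).
    by rewrite muleC lee_wpmul2l// wge.
  by rewrite off ?fw// mul0e mule0.
- by move=> w _; rewrite mule_ge0// lee_fin.
- exact: measurable_funeM.
- apply: ae_imp f0 => w fw _; have [cw|ncw] := pselect (cone u v w).
    rewrite [leRHS]muleC lee_wpmul2l// wle//.
    by rewrite -normr_gt0; apply: lt_le_trans cw.1.
  by rewrite off ?fw// mul0e mule0.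
Qed.

End frame_bounds.

Theorem theorem4p3 (R : realType) (u v : R) (hu : 0 < u) (hv : 0 < v)
    (psi : R * R -> R[i])
    (psi_shearlet : shearlet psi)
    (psi_neq0 : ~ {ae @leb2 R, forall x, psi x = 0})
    (eps tau mu : R) (heps : 0 < eps) (htau : 1 / 2 < tau) (hmu : 0 < mu)
    (psi_moments : vanishing_moments psi (1 + eps))
    (psi_decay2 : fourier_decay2 psi tau)
    (psi_decay1 : fourier_decay1 psi mu) :
  exists Gamma Xi : R, [/\ 0 < Gamma, 0 < Xi &
    is_frame (@shearlet_measure R)
      [set p | 0 <= p.1.1 <= Gamma /\ - Xi <= p.1.2 <= Xi]
      (fun p => orth_proj (L2_cone u v) (shearlet_atom psi p.1.1 p.1.2 p.2))
      (L2_cone u v)].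
Proof.
have [psi2 Cy orb] := psi_shearlet.
pose Phi w := normc (fourier psi w) ^+ 2.
have mPhi : measurable_fun setT Phi.
  exact: measurable_normc_sqr (L2_cmeasurable (L2_fourier psi2)).
have Phi0 w : 0 <= Phi w by exact: sqr_ge0.
have iPhi := integrable_C_psi psi2 Cy.
pose c := fine (C_psi psi).
have Cgt0 := C_psi_gt0 psi2 psi_neq0.
have CE : C_psi psi = c%:E by rewrite /c fineK// ge0_fin_numE// ltW.
have c0 : 0 < c by rewrite -lte_fin -CE.
have orbitE xi : xi.1 != 0 -> (\int[@leb2 R]_q (orbit_kernel Phi xi q)%:E = (c / 2)%:E)%E.
  move=> xi0; rewrite -orbit_integralE//.
  (* As [c] is finite, the orbit integral cannot be infinite, and the factor [2] can be divided
     out. *)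
  have := orb xi xi0; rewrite CE; case: (orbit_integral psi xi) => [r||].
  - by rewrite -EFinM => -[->]; rewrite [2 * r]mulrC mulfK.
  - by rewrite gt0_muley ?lte_fin.
  - by rewrite gt0_muleNy ?lte_fin.
have [n n0 wge] := window_mass_ge mPhi Phi0 iPhi orbitE hu hv c0.
have wle := window_mass_le mPhi Phi0 orbitE n.
have nR : 0 < n%:R :> R by rewrite ltr0n.
have projE f p : L2_cone u v f -> window_set n p ->
    normc (inner f (orth_proj (L2_cone u v) (shearlet_atom psi p.1.1 p.1.2 p.2))) ^+ 2 =
    sqr_coef psi f p.
  move=> Vf [/andP[a0 _] _].
  rewrite (inner_orth_proj_L2_cone Vf (L2_shearlet_atom_ge0 p.1.2 p.2 a0 psi2)).
  by rewrite /sqr_coef (atom_powRE psi a0).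
(* One integer bounds both parameters, so that the parameter set is [window_set n]. *)
exists n%:R, n%:R; split => //; split.
- move=> p [/andP[a0 _] _].
  exact: orth_proj_L2_cone (L2_shearlet_atom_ge0 p.1.2 p.2 a0 psi2).
- move=> f Vf; have [f2 _] := Vf.
  (* The modulus agrees on the parameter set with the square root of the measurable [sqr_coef]. *)
  apply: (@eq_measurable_fun _ _ _ _ _ (fun p => Num.sqrt (sqr_coef psi f p))).
    move=> p /set_mem Dp; rewrite -projE// sqrtr_sqr ger0_norm//.
    exact: normc_ge0.
  apply: measurable_funTS; apply: (measurableT_comp (@measurable_sqrtr R)).
  exact: measurable_sqr_coef.
(* The bounds on the multiplier are the frame bounds themselves: the factor [K^-1] of the frame
   integral also relates [sqnorm2 f] to the squared norm of its transform. *)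
- exists (c / 4), (c / 2); split; [by rewrite divr_gt0..|move=> f Vf].
  have [f2 f0] := Vf; have F2 := L2_fourier f2.
  have /andP[lo hi] := integral_window_mass hu c0 mPhi Phi0 (L2_cmeasurable F2) f0 wle wge.
  rewrite (_ : (\int[_]_(p in _) _)%E =
      (\int[@shearlet_measure R]_(p in window_set n) (sqr_coef psi f p)%:E)%E); last first.
    by apply: eq_integral => p /set_mem Dp; rewrite projE.
  rewrite integral_shearlet_measure//; last first.
    apply: le_lt_trans hi _; rewrite sqnorm2_nrm2// -EFinM ltry//.
  have K0 := @plancherel_cst_gt0 R.
  have sqE : sqnorm2 f = ((plancherel_cst R)^-1%:E * sqnorm2 (fourier f))%E.
    by rewrite sqnorm2_fourier// muleA -EFinM mulVf ?mul1e// gt_eqF.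
  rewrite sqE !(muleCA (_ / _)%:E); apply/andP; split.
    by rewrite lee_wpmul2l// lee_fin invr_ge0 ltW.
  by rewrite lee_wpmul2l// lee_fin invr_ge0 ltW.
Qed.
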